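(* Let $L$ be an honest time satisfying condition $(\mathbf{A})$: $\mathbb{P}[L=T]=0$ for every $(\mathcal{F}_t)$-stopping time $T$. Write $A=A^L$. Let $M_t\equiv\mathbb{E}[x_L\mid\mathcal{F}_t]$ be a uniformly integrable martingale, where $(x_t)$ is an $(\mathcal{F}_t)$-predictable process. Then $$M_L=\mathbb{E}\left[\int_t^\infty x_s\,dA_s\,\Big|\,\mathcal{F}_t\right]\Big|_{t=L}=\mathbb{E}\left[\int_0^\infty x_s\,dA_s\,\Big|\,\mathcal{F}_t\right]\Big|_{t=L}-\int_0^\infty x_s\,dA_s.$$ Consequently, $\mathbb{E}[M_\infty\mid\mathcal{F}_L]=M_L$ if and only if $$\mathbb{E}\left[\int_t^\infty x_s\,dA_s\,\Big|\,\mathcal{F}_t\right]\Big|_{t=L}=x_L.$$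
   Context: $(\Omega,\mathcal{F},(\mathcal{F}_t)_{t\ge0},\mathbb{P})$ is a filtered probability space satisfying the usual hypotheses; martingales are taken càdlàg. An honest time is a random time $L:\Omega\to\mathbb{R}_+$ which is the end of an $(\mathcal{F}_t)$-optional set $\Gamma$, $L=\sup\{t:(t,\omega)\in\Gamma\}$; it is assumed that $\mathbb{P}[L=0]=\mathbb{P}[L=\infty]=0$. $A^L$ is the $(\mathcal{F}_t)$ dual optional projection of $1_{\{L\le t\}}$ (the increasing right-continuous adapted process with $\mathbb{E}[\int_0^\infty H_s\,dA^L_s]=\mathbb{E}[H_L]$ for all bounded optional $H$; it is continuous under $(\mathbf{A})$). $\mathcal{F}_L=\sigma\{z_L:\ z\text{ any }(\mathcal{F}_t)\text{-optional process}\}$. The notation $Y_t|_{t=L}$ means the (càdlàg) process $Y$ evaluated at the random time $L$; $\mathbb{E}[\int_t^\infty x_s\,dA_s\mid\mathcal{F}_t]$ is the process $\mathbb{E}[\int_0^\infty x_s\,dA_s\mid\mathcal{F}_t]-\int_0^tx_s\,dA_s$. Equalities hold almost surely. *)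

(* Defs.v *)
From mathcomp Require Import all_boot all_order all_algebra.
From mathcomp Require Import all_classical all_reals all_analysis measurable_realfun.

Set Implicit Arguments.
Unset Strict Implicit.
Unset Printing Implicit Defensive.

Import Order.TTheory GRing.Theory Num.Theory.
Import numFieldNormedType.Exports.

Local Open Scope classical_set_scope.
Local Open Scope ring_scope.

(* Time is [0, +oo[.  Families indexed by time are written as families indexed
   by R, and every condition below is restricted to nonnegative indices. *)

Section filtrations.
Context {d : measure_display} {Omega : measurableType d} {R : realType}.
Variable P : probability Omega R.

Definition measurable_wrt (G : set (set Omega)) (X : Omega -> R) : Prop :=
  measurable_fun [set: g_sigma_algebraType G]
    (X : g_sigma_algebraType G -> R).

Definition filtration (F : R -> set (set Omega)) : Prop :=
  [/\ forall t, 0 <= t -> sigma_algebra setT (F t),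
      forall t, 0 <= t -> F t `<=` measurable &
      forall s t, 0 <= s -> s <= t -> F s `<=` F t].

(* The second condition makes the underlying measurable sets P-complete too. *)
Definition usual_hypotheses (F : R -> set (set Omega)) : Prop :=
  (forall t, 0 <= t -> F t = \bigcap_(u in `]t, +oo[) F u) /\
  P.-negligible `<=` F 0.

(* Y is a version of E[X | <<s G >>]. *)
Definition cond_exp (G : set (set Omega)) (X Y : Omega -> R) : Prop :=
  [/\ P.-integrable setT (EFin \o X),
      measurable_wrt G Y,
      P.-integrable setT (EFin \o Y) &
      forall B, <<s G >> B ->
        (\int[P]_(w in B) (Y w)%:E = \int[P]_(w in B) (X w)%:E)%E].

End filtrations.

Section paths.
Context {R : realType}.

Definition cadlag (f : R -> R) : Prop :=
  (forall t, 0 <= t -> f s @[s --> t^'+] --> f t) /\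
  (forall t, 0 < t -> exists l : R, f s @[s --> t^'-] --> l).

Definition left_continuous (f : R -> R) : Prop :=
  forall t, 0 < t -> f s @[s --> t^'-] --> f t.

End paths.

Section processes.
Context {d : measure_display} {Omega : measurableType d} {R : realType}.
Variables (P : probability Omega R) (F : R -> set (set Omega)).

Definition adapted (X : R -> Omega -> R) : Prop :=
  forall t, 0 <= t -> measurable_wrt (F t) (X t).

Definition time_space : set (R * Omega) := [set z | 0 <= z.1].

(* The sets {(t, w) : 0 <= t, X t w in B} for X ranging over C. *)
Definition process_events (C : set (R -> Omega -> R)) : set (set (R * Omega)) :=
  [set E | exists X (B : set R), [/\ C X, measurable B &
     E = time_space `&` [set z | B (X z.1 z.2)]]].

Definition optional_sets : set (set (R * Omega)) :=
  <<s time_space, process_events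
    [set X | adapted X /\ forall w, cadlag (X ^~ w)] >>.

Definition predictable_sets : set (set (R * Omega)) :=
  <<s time_space, process_events
    [set X | adapted X /\ forall w, left_continuous (X ^~ w)] >>.

Definition optional (X : R -> Omega -> R) : Prop :=
  forall B : set R, measurable B ->
    optional_sets (time_space `&` [set z | B (X z.1 z.2)]).

Definition predictable (X : R -> Omega -> R) : Prop :=
  forall B : set R, measurable B ->
    predictable_sets (time_space `&` [set z | B (X z.1 z.2)]).

Definition stopping_time (T : Omega -> \bar R) : Prop :=
  (forall w, (0 <= T w)%E) /\
  (forall t, 0 <= t -> F t [set w | (T w <= t%:E)%E]).

Definition uniformly_integrable (M : R -> Omega -> R) : Prop :=
  forall e : R, 0 < e -> exists K : R, forall t, 0 <= t ->
    (\int[P]_(w in [set w | (K < `|M t w|)%R]) (`|M t w|%R)%:E <= e%:E)%E.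

Definition martingale (M : R -> Omega -> R) : Prop :=
  [/\ adapted M, forall w, cadlag (M ^~ w) &
      forall s t, 0 <= s -> s <= t -> cond_exp P (F s) (M t) (M s)].

(* N is a cadlag version of the martingale E[X | F_t], t >= 0. *)
Definition cadlag_cond_exp (X : Omega -> R) (N : R -> Omega -> R) : Prop :=
  (forall w, cadlag (N ^~ w)) /\
  (forall t, 0 <= t -> cond_exp P (F t) X (N t)).

Definition terminal_value (M : R -> Omega -> R) (w : Omega) : R :=
  lim (M t w @[t --> +oo]).

End processes.

Section random_times.
Context {d : measure_display} {Omega : measurableType d} {R : realType}.
Variables (P : probability Omega R) (F : R -> set (set Omega)).

(* Random times take values in [0, +oo].  Adding 0 to the set whose supremum
   is taken gives sup set0 = 0 and changes nothing otherwise. *)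
Definition honest_time (L : Omega -> \bar R) : Prop :=
  measurable_fun setT L /\
  exists2 Gamma : set (R * Omega), optional_sets F Gamma &
    forall w, L w = ereal_sup (0%E |` [set t%:E | t in [set t | Gamma (t, w)]]).

(* Y_L; on {L = +oo} this is Y_0, because fine +oo = 0. *)
Definition at_time (Y : R -> Omega -> R) (L : Omega -> \bar R) (w : Omega) : R :=
  Y (fine (L w)) w.

Definition avoids_stopping_times (L : Omega -> \bar R) : Prop :=
  forall T, stopping_time F T -> P [set w | L w = T w] = 0%E.

Definition sigma_at_time (L : Omega -> \bar R) : set (set Omega) :=
  <<s [set E | exists z (B : set R), [/\ optional F z, measurable B &
        E = at_time z L @^-1` B]] >>.

(* A w : R -> R is nondecreasing and right-continuous by its type and, being 0
   on ]-oo, 0[, is the path of an increasing process with A_{0-} = 0: its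
   Stieltjes measure restricted to [0, +oo[ has an atom of mass A_0 at 0. *)
Definition dual_optional_projection (L : Omega -> \bar R)
    (A : Omega -> cumulative R R) : Prop :=
  [/\ forall w t, t < 0 -> A w t = 0,
      adapted F (fun t w => A w t) &
      forall H, optional F H ->
        (exists K : R, forall t w, 0 <= t -> `|H t w| <= K) ->
        (\int[P]_w
           \int[lebesgue_stieltjes_measure (A w)]_(s in `[0%R, +oo[) (H s w)%:E
         = 'E_P[at_time H L])%E].

End random_times.

Section stieltjes.
Context {d : measure_display} {Omega : measurableType d} {R : realType}.
Variables (A : Omega -> cumulative R R) (x : R -> Omega -> R).

Definition integral_upto (t : R) (w : Omega) : R :=
  \int[lebesgue_stieltjes_measure (A w)]_(s in `[0, t]) x s w.

Definition total_integral (w : Omega) : R :=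
  \int[lebesgue_stieltjes_measure (A w)]_(s in `[0, +oo[) x s w.

(* The process E[int_t^oo x dA | F_t], given a cadlag version N of
   E[int_0^oo x dA | F_t]. *)
Definition future_integral (N : R -> Omega -> R) (t : R) (w : Omega) : R :=
  N t w - integral_upto t w.

End stieltjes.

(* Main.v *)
From HB Require Import structures.
Require Import Defs.
From mathcomp Require Import all_boot all_order all_algebra.
From mathcomp Require Import all_classical all_reals all_analysis measurable_realfun.
From mathcomp Require Import ring lra.

Set Implicit Arguments.
Unset Strict Implicit.
Unset Printing Implicit Defensive.

Import Order.TTheory GRing.Theory Num.Theory.
Import numFieldNormedType.Exports.

Local Open Scope classical_set_scope.
Local Open Scope ring_scope.

(** Let [Y_t] be the conditional expectation given [F_t] of [x_L] on the event
    [L <= t]; it is called the past part below.  For [B] in [F_t], apply the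
    definition of the dual projection to the optional process that equals
    [x_s(w)] for [s > t] and [w] in [B] and vanishes elsewhere: on the event
    [L > t], the conditional expectation of [x_L] is that of the integral of
    [x] against [dA] over [(t, oo)].  Therefore [M] is the sum of [Y] and of the
    future integral, and the first equality says exactly that [Y_L = 0]
    ([past_part_at_end]).

    Two facts about [A] are used.  It does not increase after [L]
    ([mass_after_end]): the dual projection charges only the optional sets that
    [L] meets, and [L] lies in the set [Gamma] that it ends, enlarged by the
    limits of [Gamma] from the left.  It has no jumps
    ([dual_projection_left_continuous]): the first jump of size at least [e] is
    a stopping time [T], and the mass that [A] gives to the graph of [T] has
    expectation [P (L = T) = 0].  That a last visit is an adapted process and
    that a first jump is a stopping time both rest on the projection theorem
    ([measurable_projection]): the projection on [Omega] of a measurable subset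
    of [R * Omega] is measurable for a complete sigma-algebra.

    To see that [Y_L = 0], choose a bounded odd function [damp] with
    [y * damp y > 0] for [y != 0], and consider the nonnegative optional process
    [f = Y * damp Y * exp (- A)].  The expectation of [f_L] is the expectation of
    the integral of [f] against [dA], which is a limit of Riemann sums over
    finer and finer grids.  In such a sum the factor [Y] at a grid point [t] can
    be replaced by [x_L] on the event [L <= t], because the other factors are
    known at time [t].  What is left is the expectation of [x_L] times a sum of
    terms bounded by the increments of [A] over the grid intervals that do not
    end before [L].  As [A] is continuous and does not increase after [L], this sum
    tends to 0.  The factor [exp (- A)] keeps all these sums bounded by 1, which
    permits dominated convergence.  So [f_L], and with it [Y_L], is almost
    surely 0.

    The second equality holds because the integral of [x] up to time [L] is the
    total integral.  For the equivalence, [M] converges almost surely to [x_L]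
    ([levy_upward]): if a time [m] exceeds [L], then [L] is the last visit
    before [m], so [x_L] is a limit of variables that are known at finite times.
    Thus the terminal value of [M] is [x_L], which is measurable for the
    sigma-algebra at time [L], as is [M_L]; so [M_L] is its conditional
    expectation if and only if the two agree almost surely. *)

(** * The projection theorem *)

Section projection.
Context {d : measure_display} {Omega : measurableType d} {R : realType}.
Variables (P : probability Omega R) (G : set (set Omega)).
Hypothesis sG : sigma_algebra setT G.

Lemma sigma_measurableE (E : set Omega) :
  G E = measurable (E : set (g_sigma_algebraType G)).
Proof. by rewrite -[in LHS](measurable_g_measurableTypeE sG). Qed.

(** The Suslin operation applied to the rectangles [C u `*` H u]. *)
Definition suslin (C : seq nat -> set R) (H : seq nat -> set Omega) :
    set (R * Omega) :=
  [set z | exists sigma : nat -> nat,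
     forall n, C (mkseq sigma n) z.1 /\ H (mkseq sigma n) z.2].

(** The sides in the time direction are closed so that compactness applies to
    them. *)
Definition suslin_set (E : set (R * Omega)) : Prop :=
  exists C H, [/\ forall u, closed (C u), forall u, G (H u) & E = suslin C H].

Lemma suslin_set_rectangle (C : set R) (H : set Omega) :
  closed C -> G H -> suslin_set (C `*` H).
Proof.
move=> cC GH; exists (fun=> C), (fun=> H); split => //.
apply/seteqP; split => [z [Cz Hz]|z [s /(_ 0%N)//]].
by exists (fun=> 0%N).
Qed.

Lemma suslin_set_bigcup (E : (set (R * Omega))^nat) :
  (forall i, suslin_set (E i)) -> suslin_set (\bigcup_i E i).
Proof.
move=> /choice[C] /choice[H] EE.
pose C' u := if u is i :: v then C i v else setT.
pose H' u := if u is i :: v then H i v else setT.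
have mkS (s : nat -> nat) n : mkseq s n.+1 = s 0%N :: mkseq (s \o S) n.
  by rewrite /mkseq /= -[1%N]addn0 iotaDl -map_comp.
exists C', H'; split.
- by case=> [|i v] /=; [exact: closedT|case: (EE i)].
- case=> [|i v] /=; last by case: (EE i).
  by rewrite sigma_measurableE; exact: measurableT.
apply/seteqP; split => [z [i _]|z [s sz]].
  have [_ _ ->] := EE i; move=> [s sz].
  exists (fun n => if n is m.+1 then s m else i) => -[|n] //.
  rewrite mkS /=; have := sz n.
  by rewrite (_ : _ \o _ = s).
exists (s 0%N) => //; have [_ _ ->] := EE (s 0%N).
by exists (s \o S) => n; have := sz n.+1; rewrite mkS.
Qed.

(** Countably many branches are coded by the single branch [sigma] whose value
    at [pickle (i, l)] is the value at [l] of the branch for the [i]-th set; a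
    constraint on the [i]-th branch is imposed as soon as the known prefix of
    [sigma] determines the coordinates it mentions. *)
Lemma suslin_set_bigcap (E : (set (R * Omega))^nat) :
  (forall i, suslin_set (E i)) -> suslin_set (\bigcap_i E i).
Proof.
move=> /choice[C] /choice[H] EE.
pose ok (u : seq nat) (p : nat * nat) :=
  [forall l : 'I_p.2, (pickle (p.1, val l) < size u)%N].
pose br (u : seq nat) (p : nat * nat) :=
  mkseq (fun l => nth 0%N u (pickle (p.1, l))) p.2.
pose C' u := \bigcap_(p in [set p | ok u p]) C p.1 (br u p).
pose H' u := \bigcap_(p in [set p | ok u p]) H p.1 (br u p).
have brE (s : nat -> nat) n p : ok (mkseq s n) p ->
    br (mkseq s n) p = mkseq (fun l => s (pickle (p.1, l))) p.2.
  move=> /forallP okp; apply/eq_in_map => l; rewrite mem_iota /= add0n => lp.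
  by have := okp (Ordinal lp); rewrite size_mkseq /= => h; rewrite nth_mkseq.
exists C', H'; split.
- by move=> u; apply: closed_bigI => p _; case: (EE p.1).
- move=> u; rewrite sigma_measurableE.
  rewrite [X in measurable X](_ : _ = \bigcap_n
    (if unpickle n is Some p then if ok u p then H p.1 (br u p) else setT
     else setT)); last first.
    apply/seteqP; split => w Hw.
      move=> n _; case: (unpickle n) => // p; case: ifPn => // okp.
      exact: Hw.
    by move=> p okp; have := Hw (pickle p) I; rewrite pickleK okp.
  apply: bigcapT_measurable => n; case: (unpickle n) => // p.
  by case: ifPn => // _; rewrite -sigma_measurableE; case: (EE p.1).
apply/seteqP; split => [z Ez|z [s sz] i _].
  have /choice[s sz] : forall i, exists s : nat -> nat,
      forall n, C i (mkseq s n) z.1 /\ H i (mkseq s n) z.2.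
    by move=> i; have := Ez i I; have [_ _ ->] := EE i.
  exists (fun n => if unpickle n is Some p then s p.1 p.2 else 0%N) => n.
  by split => -[i j] okp; rewrite brE//=;
    under eq_mkseq do rewrite pickleK /=; case: (sz i j).
have [_ _ ->] := EE i; exists (fun l => s (pickle (i, l))) => n.
pose N := (\max_(l < n) pickle (i, val l)).+1.
have okN : ok (mkseq s N) (i, n).
  apply/forallP => l; rewrite size_mkseq ltnS.
  exact: (leq_bigmax (F := fun l : 'I_n => pickle (i, val l))).
by have [/(_ _ okN) + /(_ _ okN)] := sz N; rewrite brE.
Qed.

Lemma suslin_setT : suslin_set setT.
Proof.
rewrite -setXTT; apply: suslin_set_rectangle; first exact: closedT.
by rewrite sigma_measurableE; exact: measurableT.
Qed.

Lemma suslin_setU (A B : set (R * Omega)) :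
  suslin_set A -> suslin_set B -> suslin_set (A `|` B).
Proof.
move=> sA sB.
rewrite (_ : _ `|` _ = \bigcup_i (if i == 0%N then A else B)); last first.
  apply/seteqP; split => [z [Az|Bz]|z [i _]].
  - by exists 0%N.
  - by exists 1%N.
  - by case: ifP => _ ?; [left|right].
by apply: suslin_set_bigcup => i; case: ifP.
Qed.

(** The sets that are Suslin together with their complement form a sigma-algebra
    that contains the generating rectangles. *)
Lemma measurable_suslin_set (E : set (R * g_sigma_algebraType G)) :
  measurable E -> suslin_set E.
Proof.
have GT : G setT by rewrite sigma_measurableE; exact: measurableT.
have G0 : G set0 by rewrite sigma_measurableE; exact: measurable0.
pose D : set (set (R * Omega)) := [set E | suslin_set E /\ suslin_set (~` E)].
have s0 : suslin_set set0.
  rewrite -(set0X (T:=R) (set0 : set Omega)); apply: suslin_set_rectangle => //.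
  exact: closed0.
have sD : sigma_algebra setT D.
  split.
  - by split => //; rewrite setC0; exact: suslin_setT.
  - by move=> A [sA sAC]; rewrite setTD; split => //; rewrite setCK.
  - move=> A DA; split; first by apply: suslin_set_bigcup => i; case: (DA i).
    by rewrite setC_bigcup; apply: suslin_set_bigcap => i; case: (DA i).
suff h : (measurable : set (set (R * g_sigma_algebraType G))) `<=` D.
  by move=> mE; case: (h _ mE).
rewrite measurable_prod_measurableType; apply: smallest_sub => //.
have RD (B : set R) : measurable B -> D (B `*` setT).
  move: B; have : (@ocitv R).-sigma.-measurable `<=` [set B | D (B `*` setT)].
    rewrite RGenCInfty.measurableE; apply: smallest_sub.
      split; first by rewrite /= set0X; case: sD.
      - move=> A DA /=; have [_ + _] := sD => /(_ _ DA).
        rewrite !setTD (_ : ~` (A `*` setT) = ~` A `*` setT)//.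
        by apply/seteqP; split => [z /= h|z [/= h _] []//]; split => // ?; apply: h.
      - move=> A DA /=; have [_ _ +] := sD => /(_ _ DA).
        rewrite (_ : \bigcup_k (A k `*` setT) = \bigcup_k A k `*` setT)//.
        apply/seteqP; split => [z [i _ [Az _]]|z [[i _ Az] _]].
          by split => //; exists i.
        by exists i.
    move=> _ [x ->]; split.
      by apply: suslin_set_rectangle => //; exact: rray_closed.
    rewrite (_ : ~` _ = \bigcup_n (`]-oo, x - n.+1%:R^-1]%classic `*` setT)).
      by apply: suslin_set_bigcup => n; apply: suslin_set_rectangle.
    apply/seteqP; split => [[s w] /= h|[s w] [n _ []]]/=.
      have {h} : s < x.
        by rewrite ltNge; apply/negP => xs; apply: h; rewrite in_itv /= xs.
      rewrite -subr_gt0 => sx.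
      have [n _ hn] := near_infty_natSinv_lt (PosNum sx).
      exists n => //=; split => //; rewrite in_itv /= lerBrDr -lerBrDl.
      by apply/ltW/(hn n) => /=.
    rewrite in_itv /= => sx _ [+ _]; rewrite in_itv /= andbT => xs.
    have := le_trans xs sx; rewrite leNgt => /negP; apply.
    by rewrite ltrBlDr ltrDl invr_gt0.
  by move=> h B /h.
move=> _ [A mA [B mB <-]].
have -> : A `*` B = (A `*` setT) `&` (setT `*` B) :> set (R * Omega).
  by apply/seteqP; split => [[r w] []|[r w] [[Ar _] [_ Bw]]].
have DI (X Y : set (R * Omega)) : D X -> D Y -> D (X `&` Y).
  move=> [sX sXC] [sY sYC]; split; last by rewrite setCI; exact: suslin_setU.
  rewrite (_ : _ `&` _ = \bigcap_i (if i == 0%N then X else Y)).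
    by apply: suslin_set_bigcap => i; case: ifP.
  apply/seteqP; split => [z [Xz Yz] i _|z h]; first by case: ifP.
  by split; [have := h 0%N I|have := h 1%N I].
apply: DI; first exact: RD.
move: mB; rewrite -sigma_measurableE => GB.
split; first by apply: suslin_set_rectangle => //; exact: closedT.
rewrite (_ : ~` _ = setT `*` ~` B).
  apply: suslin_set_rectangle; first exact: closedT.
  by rewrite sigma_measurableE; apply: measurableC; rewrite -sigma_measurableE.
by apply/seteqP; split => [[r w] /= h|[r w] [_ /= h] [_ /= ?]//]; split => // ?; exact: h.
Qed.

Hypothesis mG : G `<=` measurable.

(** The intersection of sets of [G] whose probabilities approach the infimum. *)
Lemma measurable_envelope (D : set Omega) : exists E, [/\ G E, D `<=` E &
  forall B, G B -> D `<=` B -> P (E `\` B) = 0%E].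
Proof.
pose S := [set P B | B in [set B | G B /\ D `<=` B]].
have GT : G setT by rewrite sigma_measurableE; exact: measurableT.
have S1 : S (P setT) by exists setT.
have lS : ((0%:E : \bar R) <= ereal_inf S)%E.
  by apply: le_ereal_inf_tmp => _ [B _ <-]; exact: measure_ge0.
have Sfin : ereal_inf S \is a fin_num.
  rewrite ge0_fin_numE//; apply: le_lt_trans (ereal_inf_lbound S1) _.
  by rewrite probability_setT ltry.
have /choice[B hB] : forall n : nat, exists B, [/\ G B, D `<=` B &
    (P B < ereal_inf S + n.+1%:R^-1%:E)%E].
  move=> n; have n0 : (0 < n.+1%:R^-1 :> R) by rewrite invr_gt0.
  have [_ [B [GB DB] <-] ltB] := lb_ereal_inf_adherent n0 Sfin.
  by exists B.
have GE : G (\bigcap_n B n).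
  rewrite sigma_measurableE; apply: bigcapT_measurable => n.
  by rewrite -sigma_measurableE; case: (hB n).
exists (\bigcap_n B n); split => //.
  by move=> w Dw n _; have [_ /(_ _ Dw)] := hB n.
move=> B' GB' DB'.
have mE := mG GE; have mB' := mG GB'.
have mPE : (P (\bigcap_n B n) <= ereal_inf S)%E.
  apply/lee_addgt0Pr => e e0.
  have [n _ hn] := near_infty_natSinv_lt (PosNum e0).
  have [GBn DBn ltn] := hB n.
  apply: (@le_trans _ _ (P (B n))).
    by apply: le_measure; rewrite ?inE//; [exact: mG|exact: bigcap_inf].
  apply: (le_trans (ltW ltn)); rewrite leeD2l// lee_fin ltW//.
  exact: (hn n (leqnn n)).
have mPI : (ereal_inf S <= P (\bigcap_n B n `&` B'))%E.
  apply: ereal_inf_lbound; exists (\bigcap_n B n `&` B') => //; split.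
    by rewrite sigma_measurableE; apply: measurableI;
      rewrite -sigma_measurableE.
  by move=> w Dw; split; [move=> n _; have [_ /(_ _ Dw)] := hB n|exact: DB'].
have Pfin : P (\bigcap_n B n) \is a fin_num by exact: fin_num_measure.
apply/eqP; rewrite -measure_le0 measureD//; last by rewrite -ge0_fin_numE.
by rewrite sube_le0; exact: le_trans mPE mPI.
Qed.

Hypothesis nG : P.-negligible `<=` G.

Lemma nested_closed_nonempty (a b : R) (D : (set R)^nat) :
  (forall n, closed (D n)) -> (forall n, D n !=set0) ->
  (forall n, D n.+1 `<=` D n) -> D 0%N `<=` `[a, b]%classic ->
  \bigcap_n D n !=set0.
Proof.
move=> cD D0 ndD D0ab.
have leD m n : (m <= n)%N -> D n `<=` D m.
  elim: n => [|n IH]; first by rewrite leqn0 => /eqP ->.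
  rewrite leq_eqVlt => /predU1P[->//|]; rewrite ltnS => /IH h.
  exact: subset_trans h.
have FF : ProperFilter (filter_from setT D).
  apply: filter_from_proper => //; apply: filter_from_filter => [|i j _ _].
    by exists 0%N.
  exists (maxn i j) => // x Dx; split.
    by apply: leD Dx; exact: leq_maxl.
  by apply: leD Dx; exact: leq_maxr.
have [p [_ clp]] := @segment_compact _ a b _ FF (ex_intro2 _ _ 0%N I D0ab).
exists p => n _; rewrite (_ : D n = closure (D n)); last exact/closure_id.
by move=> B nB; apply: clp => //; exists n.
Qed.

(** For a finite sequence [u], let [A u] be the set of those [w] for which some
    time [s] and some branch extending [u] witness that [(s, w)] belongs to the
    Suslin set.  Then [A u] is the union of the [A (rcons u i)], so its envelope
    is covered, up to a null set, by the envelopes of the [A (rcons u i)].  Off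
    the union of these countably many null sets, a point of the envelope of
    [A [::]] can be followed along an infinite branch; compactness of the time
    interval then yields a time [s], so the point is in [A [::]]. *)
Theorem measurable_projection (a b : R) (E : set (R * g_sigma_algebraType G)) :
  measurable E -> G [set w | exists2 s, a <= s <= b & E (s, w)].
Proof.
move=> /measurable_suslin_set[C0 [H [cC0 GH EE]]].
pose C u := C0 u `&` `[a, b]%classic.
have cC u : closed (C u).
  by apply: closedI; [exact: cC0|exact: interval_closed].
pose A (u : seq nat) := [set w | exists s (sigma : nat -> nat),
  mkseq sigma (size u) = u /\
  forall n, C (mkseq sigma n) s /\ H (mkseq sigma n) w].
(* The condition on the time does not involve [w], so that [K u] is in [G]. *)
pose K (u : seq nat) := [set w |
  (exists s, forall n, (n <= size u)%N -> C (take n u) s) /\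
  (forall n, (n <= size u)%N -> H (take n u) w)].
have -> : [set w | exists2 s, a <= s <= b & E (s, w)] = A [::].
  apply/seteqP; split => [w [s sab]|w [s [sigma [_ h]]]].
    rewrite EE => -[sigma h]; exists s, sigma; split => // n.
    by have [? ?] := h n; split => //; split => //=; rewrite in_itv.
  exists s; first by have [[_ +] _] := h 0%N; rewrite /= in_itv.
  by rewrite EE; exists sigma => n; have [[? _] ?] := h n.
have takemk (sigma : nat -> nat) n m : (n <= m)%N ->
    take n (mkseq sigma m) = mkseq sigma n.
  by move=> nm; rewrite /mkseq -map_take take_iota (minn_idPl nm).
have GK u : G (K u).
  rewrite sigma_measurableE.
  have [hs|hs] := pselect (exists s, forall n, (n <= size u)%N -> C (take n u) s).
    rewrite (_ : K u = \bigcap_n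
      (if (n <= size u)%N then H (take n u) else setT)); last first.
      apply/seteqP; split => [w [_ Kw] n _|w Kw]; first by case: ifPn => // /Kw.
      by split => // n nu; have := Kw n I; rewrite nu.
    apply: bigcapT_measurable => n; case: ifPn => // _.
    by rewrite -sigma_measurableE.
  rewrite (_ : K u = set0); first exact: measurable0.
  by apply/seteqP; split => // w [].
have AK u : A u `<=` K u.
  move=> w [s [sigma [su h]]]; split.
    by exists s => n nu; rewrite -su takemk//; case: (h n).
  by move=> n nu; rewrite -su takemk//; case: (h n).
have /choice[V hV] := fun u => measurable_envelope (A u).
pose W u := V u `&` K u.
have GW u : G (W u).
  rewrite sigma_measurableE; apply: measurableI;
    rewrite -sigma_measurableE//; by case: (hV u).
have AW u : A u `<=` W u.
  by move=> w Aw; split; [have [_ + _] := hV u; exact|exact: AK].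
pose N u := W u `\` \bigcup_i W (rcons u i).
have N0 u : P.-negligible (N u).
  have GU : G (\bigcup_i W (rcons u i)).
    rewrite sigma_measurableE; apply: bigcupT_measurable => i.
    by rewrite -sigma_measurableE.
  have [GV AV /(_ _ GU) V0] := hV u.
  exists (V u `\` \bigcup_i W (rcons u i)); split.
  - by apply: measurableD; exact: mG.
  - apply: V0 => w [s [sigma [su h]]].
    exists (sigma (size u)) => //; apply: AW; exists s, sigma; split => //.
    by rewrite size_rcons mkseqS su.
  - by move=> w [[Vw _] ?]; split.
pose N' o := if o is Some u then N u else set0.
pose NN := \bigcup_n N' (unpickle n).
have NN0 : P.-negligible NN.
  apply: negligible_bigcup => n.
  by case: (unpickle n : option (seq nat)) => [u|] /=;
    [exact: N0|exact: negligible_set0].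
suff WA : W [::] `\` NN `<=` A [::].
  have -> : A [::] = W [::] `\` (W [::] `\` A [::]).
    by rewrite setDD setIidr//; exact: AW.
  rewrite sigma_measurableE; apply: measurableD;
    rewrite -sigma_measurableE//; apply: nG.
  apply: (negligibleS _ NN0) => w [Ww nAw].
  by apply: contrapT => nNw; apply: nAw; apply: WA.
move=> w [Ww nNw].
have /choice[f hf] : forall u, exists i, W u w -> W (rcons u i) w.
  move=> u; have [Wu|nWu] := pselect (W u w); last by exists 0%N.
  have [[i _ Wi]|h] := pselect ((\bigcup_i W (rcons u i)) w); first by exists i.
  by exfalso; apply: nNw; exists (pickle u) => //; rewrite pickleK.
pose us n := iter n (fun u => rcons u (f u)) [::].
pose sigma n := f (us n).
have usE n : mkseq sigma n = us n.
  by elim: n => // n IH; rewrite mkseqS IH.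
have Wus n : W (us n) w by elim: n => // n IH; exact: hf.
pose D n := [set s | forall j, (j <= n)%N -> C (mkseq sigma j) s].
have : \bigcap_n D n !=set0.
  apply: (@nested_closed_nonempty a b).
  - move=> n; rewrite (_ : D n = \bigcap_(j in [set j | (j <= n)%N])
        C (mkseq sigma j)); last by apply/seteqP; split.
    by apply: closed_bigI => j _; exact: cC.
  - move=> n; have [_ [[s hs] _]] := Wus n; exists s => j jn.
    have := hs j; rewrite -usE size_mkseq => /(_ jn).
    by rewrite takemk.
  - by move=> n s Ds j jn; apply: Ds; exact: leqW.
  - by move=> s /(_ 0%N (leqnn _))[].
move=> [s Ds]; exists s, sigma; split => // n; split.
  exact: (Ds n I n).
have [_ [_ h]] := Wus n; have := h n.
by rewrite -usE size_mkseq => /(_ (leqnn _)); rewrite takemk.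
Qed.

End projection.

(** * Sampling on grids and progressive measurability *)

Section grids.
Context {R : realType}.

Lemma measurable_truncn_preimage (k : nat) :
  measurable [set s : R | Num.truncn s = k].
Proof.
have le_m n : measurable [set s : R | (Num.truncn s <= n)%N].
  rewrite (_ : mkset _ = `]-oo, n.+1%:R[%classic) //.
  by apply/seteqP; split => s /=; rewrite truncn_le_nat in_itv.
case: k => [|k].
  rewrite (_ : mkset _ = [set s : R | (Num.truncn s <= 0)%N])//.
  by apply/seteqP; split => s /=; rewrite leqn0 => /eqP.
rewrite (_ : mkset _ = [set s : R | (Num.truncn s <= k.+1)%N] `\`
  [set s : R | (Num.truncn s <= k)%N]); first exact: measurableD.
apply/seteqP; split => s /=.
  by move=> ->; split => //; apply/negP; rewrite ltnn.
by move=> [h1 /negP h2]; apply/eqP; rewrite eqn_leq h1 ltnNge.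
Qed.

(** The points [k / (n + 1)] form the grid of rank [n]; [grid_up] is the grid
    point strictly above [s], so that sampling there uses right-continuity. *)
Definition grid_down (n : nat) (s : R) : R :=
  (Num.truncn (n.+1%:R * s))%:R / n.+1%:R.
Definition grid_up (n : nat) (s : R) : R :=
  (Num.truncn (n.+1%:R * s)).+1%:R / n.+1%:R.

Lemma grid_down_bounds n s : 0 <= s -> s - n.+1%:R^-1 <= grid_down n s <= s.
Proof.
move=> s0; have n0 : 0 < n.+1%:R :> R by [].
have /truncn_itv/andP[h1 h2] : 0 <= n.+1%:R * s by rewrite mulr_ge0.
rewrite /grid_down ler_pdivrMr// [s * _]mulrC h1 andbT.
rewrite ler_pdivlMr// mulrBl mulVf ?gt_eqF// lerBlDr natr1 [s * _]mulrC.
exact: ltW.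
Qed.

Lemma grid_up_bounds n s : 0 <= s -> s <= grid_up n s <= s + n.+1%:R^-1.
Proof.
move=> s0; have n0 : 0 < n.+1%:R :> R by [].
have /truncn_itv/andP[h1 h2] : 0 <= n.+1%:R * s by rewrite mulr_ge0.
rewrite /grid_up ler_pdivlMr// [s * _]mulrC (ltW h2) /=.
by rewrite ler_pdivrMr// mulrDl mulVf ?gt_eqF// -natr1 lerD2r [s * _]mulrC.
Qed.

Lemma dist_min_le (t m g v : R) : 0 <= v -> m <= g <= m + v ->
  `|Num.min t m - Num.min t g| <= v.
Proof.
move=> v0 /andP[mg gm]; rewrite ler_norml !minEle.
by case: (leP t m) => ?; case: (leP t g) => ?; apply/andP; split; lra.
Qed.

Lemma natSinv_lt (e : R) : 0 < e -> exists n : nat, n.+1%:R^-1 < e.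
Proof.
move=> e0; have [n _ hn] := near_infty_natSinv_lt (PosNum e0).
by exists n; exact: hn n (leqnn n).
Qed.

Lemma cvg_of_natSinv_bound (u : nat -> R) (p : R) :
  (forall n, `|p - u n| <= n.+1%:R^-1) -> u n @[n --> \oo] --> p.
Proof.
move=> h; apply/cvgrPdist_lt => e e0.
near=> n; apply: le_lt_trans (h n) _.
by near: n; exact: (near_infty_natSinv_lt (PosNum e0)).
Unshelve. all: by end_near. Qed.

Lemma cvg_at_right_seq (f : R -> R) (p : R) (u : nat -> R) :
  f s @[s --> p^'+] --> f p -> (forall n, p <= u n) -> u n @[n --> \oo] --> p ->
  f (u n) @[n --> \oo] --> f p.
Proof.
move=> fp pu up; apply/cvgrPdist_lt => e e0.
move/cvgrPdist_lt : fp => /(_ e e0)[r /= r0 hr].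
move/cvgrPdist_lt : up => /(_ r r0)[N _ hN].
exists N => // n /= Nn; have := pu n; rewrite le_eqVlt => /predU1P[<-|pun].
  by rewrite subrr normr0.
by apply: hr => //; exact: hN.
Qed.

Lemma cvg_at_left_seq (f : R -> R) (p : R) (u : nat -> R) :
  f s @[s --> p^'-] --> f p -> (forall n, u n <= p) -> u n @[n --> \oo] --> p ->
  f (u n) @[n --> \oo] --> f p.
Proof.
move=> fp pu up; apply/cvgrPdist_lt => e e0.
move/cvgrPdist_lt : fp => /(_ e e0)[r /= r0 hr].
move/cvgrPdist_lt : up => /(_ r r0)[N _ hN].
exists N => // n /= Nn; have := pu n; rewrite le_eqVlt => /predU1P[->|pun].
  by rewrite subrr normr0.
by apply: hr => //; exact: hN.
Qed.

End grids.

Lemma measurable_fun_nat_index {d1 d2} {Z : measurableType d1}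
    {W : measurableType d2} (N : Z -> nat) (Y : nat -> Z -> W) :
  (forall k, measurable (N @^-1` [set k])) ->
  (forall k, measurable_fun setT (Y k)) ->
  measurable_fun setT (fun z => Y (N z) z).
Proof.
move=> mN mY _ B mB; rewrite setTI.
rewrite (_ : _ @^-1` B = \bigcup_k (N @^-1` [set k] `&` Y k @^-1` B)).
  apply: bigcupT_measurable => k; apply: measurableI => //.
  by rewrite -[X in measurable X]setTI; exact: mY.
apply/seteqP; split => [z Bz|z [k _ [/= <-]]//].
by exists (N z).
Qed.

Section filtered.
Context {d : measure_display} {Omega : measurableType d} {R : realType}.
Variable F : R -> set (set Omega).
Hypothesis hF : filtration F.

Lemma filtration_sigma t : 0 <= t -> sigma_algebra setT (F t).
Proof. by case: hF => + _ _; exact. Qed.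

Lemma filtration_sub t : 0 <= t -> F t `<=` measurable.
Proof. by case: hF => _ + _; exact. Qed.

Lemma filtration_mono s t : 0 <= s -> s <= t -> F s `<=` F t.
Proof. by case: hF => _ _; exact. Qed.

Lemma filtrationE t (E : set Omega) : 0 <= t ->
  F t E = measurable (E : set (g_sigma_algebraType (F t))).
Proof. by move=> t0; apply: sigma_measurableE; exact: filtration_sigma. Qed.

Lemma measurable_wrtP t (X : Omega -> R) : 0 <= t ->
  measurable_wrt (F t) X <-> forall B, measurable B -> F t (X @^-1` B).
Proof.
move=> t0; split => [mX B mB|h _ B mB].
  by rewrite filtrationE// -[X in measurable X]setTI; exact: mX.
by rewrite setTI -filtrationE//; exact: h.
Qed.

Lemma measurable_wrt_mono s t (X : Omega -> R) : 0 <= s -> s <= t ->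
  measurable_wrt (F s) X -> measurable_wrt (F t) X.
Proof.
move=> s0 st; have t0 := le_trans s0 st.
move=> /(measurable_wrtP _ s0) h; apply/(measurable_wrtP _ t0) => B mB.
by apply: filtration_mono st _ _ => //; exact: h.
Qed.

Lemma measurable_wrt_fun t (X : Omega -> R) : 0 <= t ->
  measurable_wrt (F t) X -> measurable_fun setT X.
Proof.
move=> t0 /(measurable_wrtP _ t0) h _ B mB; rewrite setTI.
by apply: (filtration_sub t0); exact: h.
Qed.

Let clamp t (s : R) := Num.min t (Num.max 0 s).

(** Sampling the process at the next grid point, capped at [t], gives jointly
    measurable processes that only use times up to [t]; by right-continuity they
    converge to the process. *)
Lemma adapted_rc_progressive (X : R -> Omega -> R) t : 0 <= t ->
  adapted F X ->
  (forall w s, 0 <= s -> X r w @[r --> s^'+] --> X s w) ->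
  measurable_fun setT
    (fun z : R * g_sigma_algebraType (F t) => X (clamp t z.1) z.2).
Proof.
move=> t0 aX rX.
pose Xn n (z : R * g_sigma_algebraType (F t)) :=
  X (Num.min t (grid_up n (Num.max 0 z.1))) z.2.
apply: (@measurable_fun_cvg _ _ _ _ Xn) => [n|z _].
  apply: (@measurable_fun_nat_index _ _ (R * g_sigma_algebraType (F t))%type R
    (fun z => Num.truncn (n.+1%:R * Num.max 0 z.1))
    (fun k z => X (Num.min t (k.+1%:R / n.+1%:R)) z.2)) => k.
    have mg : measurable_fun setT (fun z : R * g_sigma_algebraType (F t) =>
        n.+1%:R * Num.max 0 z.1).
      apply: measurable_funM => //; apply: measurable_maxr => //.
    by have := mg measurableT _ (measurable_truncn_preimage k); rewrite setTI.
  have k0 : 0 <= Num.min t (k.+1%:R / n.+1%:R) by rewrite le_min t0 divr_ge0.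
  have mk : measurable_wrt (F t) (X (Num.min t (k.+1%:R / n.+1%:R))).
    by apply: (measurable_wrt_mono k0); [rewrite ge_min lexx|exact: aX].
  by apply: (measurableT_comp mk); exact: measurable_snd.
have z0 : 0 <= Num.max 0 z.1 by rewrite le_max lexx.
have c0 : 0 <= clamp t z.1 by rewrite le_min t0.
apply: (@cvg_at_right_seq _ (X ^~ z.2)).
- exact: rX.
- move=> n; rewrite le_min !ge_min lexx /=.
  by have /andP[-> _] := grid_up_bounds n z0; rewrite orbT.
- apply: cvg_of_natSinv_bound => n.
  apply: dist_min_le; first by rewrite invr_ge0.
  exact: grid_up_bounds.
Qed.

Let progressive t (E : set (R * Omega)) :=
  measurable ((`[0, t]%classic `*` setT) `&` E :
    set (R * g_sigma_algebraType (F t))).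

Lemma optional_progressive E t : optional_sets F E -> 0 <= t -> progressive t E.
Proof.
move=> + t0; move: E; apply: smallest_sub.
have mT : measurable (`[0, t]%classic `*` setT :
    set (R * g_sigma_algebraType (F t))) by exact: measurableX.
  split.
  - by rewrite /= /progressive setI0.
  - move=> E mE; rewrite /= /progressive (_ : _ `&` _ = (`[0, t]%classic `*` setT)
      `\` ((`[0, t]%classic `*` setT) `&` E)); first exact: measurableD.
    apply/seteqP; split => [[s w] [[/= st _] [_ nE]]|[s w] [[/= st _] nE]].
      by split => // -[_ /nE].
    split => //; split; first by move: st; rewrite in_itv /= => /andP[].
    by move=> Ez; apply: nE.
  - move=> E mE; rewrite /= /progressive setI_bigcupr.
    exact: bigcupT_measurable.
move=> _ [X [B [[aX cX] mB ->]]]; rewrite /= /progressive.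
have mX : measurable_fun setT
    (fun z : R * g_sigma_algebraType (F t) => X (clamp t z.1) z.2).
  by apply: adapted_rc_progressive => // w s s0; case: (cX w) => + _; exact.
rewrite (_ : _ `&` _ = (`[0, t]%classic `*` setT) `&`
    ((fun z : R * g_sigma_algebraType (F t) => X (clamp t z.1) z.2) @^-1` B)).
  apply: measurableI; first exact: measurableX.
  by rewrite -[X in measurable X]setTI; exact: mX.
apply/seteqP; split => [[s w] [[/= st _] [_ /= Bs]]|[s w] [[/= st _] /= Bs]].
  split => //=; move: st; rewrite in_itv /= => /andP[s0 st].
  by rewrite /clamp max_r// min_r.
split => //; move: st; rewrite in_itv /= => /andP[s0 st]; split => //=.
by move: Bs; rewrite /clamp max_r// min_r.
Qed.

Lemma optional_sub_time_space E : optional_sets F E -> E `<=` time_space.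
Proof.
move: E; apply: smallest_sub; first (split; [exact: sub0set|by move=> A _; exact: subDsetl|by move=> A AD; exact: bigcup_sub]).
by move=> _ [X [B [_ _ ->]]] z [].
Qed.

End filtered.

(** * Optional processes *)

Lemma cadlag_step {R : realType} (a k : R) :
  cadlag (fun s => (a <= s)%R%:R * k).
Proof.
split => t t0.
  have [at_|ta] := leP a t.
    apply: cvg_near_cst; near=> s; rewrite (_ : a <= s)//.
    by apply: (le_trans at_); near: s; exact: nbhs_right_ge.
  apply: cvg_near_cst; near=> s.
  have sa : s < a by near: s; exact: nbhs_right_lt.
  by rewrite leNgt sa.
exists ((a < t)%R%:R * k); have [at_|ta] := ltP a t.
  apply: cvg_near_cst; near=> s; rewrite (_ : a <= s)//.
  by near: s; exact: nbhs_left_ge.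
apply: cvg_near_cst; near=> s; rewrite leNgt (_ : s < a)//.
by apply: lt_le_trans ta; near: s; exact: nbhs_left_lt.
Unshelve. all: by end_near. Qed.

Lemma trace_sigma_algebra (T : Type) (D : set T) (G : set (set T)) :
  sigma_algebra setT [set E | <<s D, G >> (D `&` E)].
Proof.
split => /=.
- by rewrite setI0; exact: sigma_algebra0.
- move=> A GA; rewrite setTD (_ : D `&` ~` A = D `\` (D `&` A)).
    exact: sigma_algebraCD.
  by rewrite setDIr setDv set0U setDE.
- by move=> A GA; rewrite setI_bigcupr; exact: sigma_algebra_bigcup.
Qed.

(** The optional sigma-algebra is a sigma-algebra on the set of nonnegative
    times; pulling it back to all of [R * Omega] makes it the sigma-algebra of a
    measurable type, on which optional processes are the measurable functions. *)
Definition optional_system {d} {Omega : measurableType d} {R : realType}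
    (F : R -> set (set Omega)) : set (set (R * Omega)) :=
  [set E | optional_sets F (time_space `&` E)].

Section optional_processes.
Context {d : measure_display} {Omega : measurableType d} {R : realType}.
Variable F : R -> set (set Omega).
Hypothesis hF : filtration F.

Local Notation Opt := (g_sigma_algebraType (optional_system F)).

Lemma optional_systemE (E : set (R * Omega)) :
  optional_sets F (time_space `&` E) = measurable (E : set Opt).
Proof.
rewrite -[RHS]/(<<s _ >> E).
by rewrite sigma_algebra_id//; exact: trace_sigma_algebra.
Qed.

Lemma optional_setsE (E : set (R * Omega)) : E `<=` time_space ->
  optional_sets F E = measurable (E : set Opt).
Proof. by move=> ED; rewrite -optional_systemE setIidr. Qed.

Lemma optionalP (X : R -> Omega -> R) :
  optional F X <-> measurable_fun setT (fun z : Opt => X z.1 z.2).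
Proof.
split => [oX _ B mB|mX B mB]; first by rewrite setTI -optional_systemE; exact: oX.
by rewrite optional_systemE -[X in measurable X]setTI; exact: mX.
Qed.

Lemma adapted_cadlag_optional (X : R -> Omega -> R) :
  adapted F X -> (forall w, cadlag (X ^~ w)) -> optional F X.
Proof. by move=> aX cX B mB; apply: sub_sigma_algebra; exists X, B. Qed.

(** The indicator of the rectangle is itself an adapted cadlag process. *)
Lemma optional_rectangle a (B : set Omega) : 0 <= a -> F a B ->
  optional_sets F (`[a, +oo[%classic `*` B).
Proof.
move=> a0 FB; pose X (s : R) (w : Omega) : R := (a <= s)%R%:R * \1_B w.
have aX : adapted F X.
  move=> t t0; apply/(measurable_wrtP hF _ t0) => C mC; rewrite /X.
  case: leP => [at_|ta]; last first.
    rewrite (_ : _ @^-1` C = if pselect (C 0) then setT else set0).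
      by rewrite (filtrationE hF _ t0); case: pselect => ?;
        [exact: measurableT|exact: measurable0].
    by apply/seteqP; split => w /=; case: pselect => //=; rewrite mul0r.
  have FtB : F t B by exact: (filtration_mono hF a0 at_).
  have mB : measurable (B : set (g_sigma_algebraType (F t))).
    by rewrite -filtrationE.
  rewrite (filtrationE hF _ t0) -[X in measurable X]setTI.
  have : measurable_fun [set: g_sigma_algebraType (F t)] (\1_B : _ -> R).
    exact: measurable_indic.
  move=> /(_ measurableT C mC); congr measurable.
  by apply/seteqP; split => w /=; rewrite mul1r.
have cX w : cadlag (X ^~ w) by exact: cadlag_step.
rewrite (_ : _ `*` _ = time_space `&` [set z | [set 1] (X z.1 z.2)]).
  exact: adapted_cadlag_optional.
apply/seteqP; split => [[s w] [/= + Bw]|[s w] [/= s0]].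
  rewrite in_itv /= andbT => as_; split; first exact: le_trans as_.
  by rewrite /X /= as_ indicE mem_set// mulr1.
rewrite /X in_itv /= andbT; case: (a <= s); last first.
  by rewrite mul0r => /esym/eqP; rewrite oner_eq0.
rewrite mul1r indicE; case: (boolP (w \in B)); first by rewrite inE.
by move=> _ /esym/eqP; rewrite oner_eq0.
Qed.

Lemma optional_itv_co a b (B : set Omega) : 0 <= a -> F a B ->
  optional_sets F (`[a, b[%classic `*` B).
Proof.
move=> a0 FB; have [ab|ba] := leP a b; last first.
  rewrite (_ : _ `*` _ = set0); first exact: sigma_algebra0.
  apply/seteqP; split => // -[s w] [/=]; rewrite in_itv /= => /andP[as_ sb].
  by have := lt_trans (le_lt_trans as_ sb) ba; rewrite ltxx.
have b0 := le_trans a0 ab.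
rewrite optional_setsE; last first.
  move=> [s w] [/=]; rewrite in_itv /= => /andP[as_ _] _.
  exact: le_trans as_.
rewrite (_ : _ `*` _ = (`[a, +oo[%classic `*` B) `\` (`[b, +oo[%classic `*` B)).
  apply: measurableD; rewrite -optional_setsE.
  - exact: optional_rectangle.
  - move=> [s w] [/=]; rewrite in_itv /= andbT => as_ _.
    exact: le_trans as_.
  - by apply: optional_rectangle => //; exact: (filtration_mono hF a0 ab).
  - move=> [s w] [/=]; rewrite in_itv /= andbT => as_ _.
    exact: le_trans as_.
apply/seteqP; split => [[s w]|[s w]] /=; rewrite !in_itv /= ?andbT.
  by move=> [/andP[as_ sb] Bw]; split => // -[]; rewrite leNgt sb.
move=> [[as_ Bw] h]; split => //; rewrite as_ /= ltNge; apply/negP => bs.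
by apply: h.
Qed.

(** An adapted left-continuous process is the limit of the optional processes
    that sample it at the preceding point of a grid. *)
Lemma adapted_lc_optional (X : R -> Omega -> R) :
  adapted F X -> (forall w, left_continuous (X ^~ w)) -> optional F X.
Proof.
move=> aX lX; apply/optionalP.
pose Xn n (z : Opt) := X (grid_down n (Num.max 0 z.1)) z.2.
suff : measurable_fun setT (fun z : Opt => X (Num.max 0 z.1) z.2).
  move=> mX _ B mB; rewrite setTI -optional_systemE.
  have := mX measurableT B mB; rewrite setTI -optional_systemE.
  congr optional_sets; apply/seteqP.
  by split => -[s w] [/= s0]; rewrite max_r.
apply: (@measurable_fun_cvg _ _ _ _ Xn) => [n|z _]; last first.
  have z0 : 0 <= Num.max 0 z.1 by rewrite le_max lexx.
  have [zE|zn0] := eqVneq (Num.max 0 z.1) 0.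
    apply: cvg_near_cst; near=> n; rewrite /Xn zE.
    by rewrite /grid_down mulr0 truncn0 mul0r.
  apply: (@cvg_at_left_seq _ (X ^~ z.2)).
  - by apply: lX; rewrite lt_neqAle eq_sym zn0.
  - by move=> n; have /andP[] := grid_down_bounds n z0.
  - apply: cvg_of_natSinv_bound => n.
    have /andP[h1 h2] := grid_down_bounds n z0.
    by rewrite ger0_norm ?subr_ge0// lerBlDl -lerBlDr.
move=> _ B mB; rewrite setTI -optional_systemE.
rewrite (_ : _ `&` _ = \bigcup_k
  (`[k%:R / n.+1%:R, k.+1%:R / n.+1%:R[%classic `*` (X (k%:R / n.+1%:R) @^-1` B))).
  apply: sigma_algebra_bigcup => k; apply: optional_itv_co.
    by rewrite divr_ge0.
  have k0 : 0 <= k%:R / n.+1%:R :> R by rewrite divr_ge0.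
  by move: (aX _ k0) => /(measurable_wrtP hF _ k0); exact.
have n0 : 0 < n.+1%:R :> R by [].
apply/seteqP; split => [[s w] [/= s0]|[s w] [k _ []]] /=.
  rewrite /Xn /grid_down max_r// => Bs.
  exists (Num.truncn (n.+1%:R * s)) => //; split => //=.
  have /truncn_itv/andP[h1 h2] : 0 <= n.+1%:R * s by rewrite mulr_ge0.
  by rewrite in_itv /= ler_pdivrMr// ltr_pdivlMr// [s * _]mulrC h1.
rewrite in_itv /= ler_pdivrMr// ltr_pdivlMr// [s * _]mulrC => kn Bw.
have s0 : 0 <= s.
  rewrite -(pmulr_rge0 _ n0); case/andP: kn => + _; exact: le_trans.
split => //; rewrite /Xn /= max_r// /grid_down.
by rewrite (truncn_def kn).
Unshelve. all: by end_near. Qed.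

Lemma predictable_optional_sets : predictable_sets F `<=` optional_sets F.
Proof.
apply: smallest_sub; first exact: smallest_sigma_algebra.
by move=> _ [X [B [[aX lX] mB ->]]]; exact: (adapted_lc_optional aX lX mB).
Qed.

Lemma predictable_optional X : predictable F X -> optional F X.
Proof. by move=> pX B mB; apply: predictable_optional_sets; exact: pX. Qed.

(** On [[0, t]] an optional set is measurable for the product with [F t], and
    the section along [tau] is its preimage by [w |-> (tau w, w)]. *)
Lemma optional_section_time t (tau : Omega -> R) (E : set (R * Omega)) :
  0 <= t -> measurable_wrt (F t) tau -> (forall w, 0 <= tau w <= t) ->
  optional_sets F E -> F t [set w | E (tau w, w)].
Proof.
move=> t0 mtau htau oE; rewrite (filtrationE hF _ t0).
have mp : measurable_fun [set: g_sigma_algebraType (F t)]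
    (fun w : g_sigma_algebraType (F t) =>
       (tau w, w) : R * g_sigma_algebraType (F t)).
  by apply: measurable_fun_pair => //; exact: mtau.
have := mp measurableT _ (optional_progressive hF oE t0); rewrite setTI.
congr measurable; apply/seteqP; split => [w [_ //]|w Ew].
by split => //; split => //=; rewrite in_itv /= htau.
Qed.

Lemma optional_at_bounded_time t (tau : Omega -> R) (X : R -> Omega -> R) :
  0 <= t -> measurable_wrt (F t) tau -> (forall w, 0 <= tau w <= t) ->
  optional F X -> measurable_wrt (F t) (fun w => X (tau w) w).
Proof.
move=> t0 mtau htau oX; apply/(measurable_wrtP hF _ t0) => B mB.
have := optional_section_time t0 mtau htau (oX B mB); congr (F t).
apply/seteqP; split => [w [_ //]|w Bw]; split => //.
by rewrite /time_space /=; case/andP: (htau w).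
Qed.

Lemma measurable_prod_filtration t (E : set (R * Omega)) : 0 <= t ->
  measurable (E : set (R * g_sigma_algebraType (F t))) ->
  measurable (E : set (R * Omega)).
Proof.
move=> t0 mE.
have mi : measurable_fun setT
    (fun z : R * Omega => (z.1, z.2) : R * g_sigma_algebraType (F t)).
  apply: measurable_fun_pair; first exact: measurable_fst.
  move=> _ B mB; rewrite setTI -[_ @^-1` _]/(snd @^-1` B).
  have /(_ measurableT B) := @measurable_snd _ _ R Omega; rewrite setTI; apply.
  by apply: (filtration_sub hF t0); rewrite (filtrationE hF _ t0).
have := mi measurableT _ mE; rewrite setTI; congr measurable.
by apply/seteqP; split => -[].
Qed.

Lemma optional_sets_measurable (E : set (R * Omega)) :
  optional_sets F E -> measurable E.
Proof.
move=> oE; rewrite (_ : E = \bigcup_n ((`[0, n%:R]%classic `*` setT) `&` E)).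
  apply: bigcupT_measurable => n; apply: (@measurable_prod_filtration n%:R) => //.
  exact: optional_progressive.
rewrite -setI_bigcupl; apply/seteqP; split => [[s w] Es|z []//].
split => //; have s0 := optional_sub_time_space oE Es.
exists (Num.truncn s).+1 => //; split => //=.
by rewrite in_itv /= s0 /= ltW// truncnS_gt.
Qed.

Lemma measurable_at_time (X : R -> Omega -> R) (L : Omega -> \bar R) :
  optional F X -> measurable_fun setT L -> (forall w, (0 <= L w)%E) ->
  measurable_fun setT (at_time X L).
Proof.
move=> oX mL L0 _ B mB; rewrite setTI.
have mp : measurable_fun setT (fun w => (fine (L w), w) : R * Omega).
  apply: measurable_fun_pair => //.
  by apply: measurableT_comp => //; exact: mL.
have := mp measurableT _ (optional_sets_measurable (oX B mB)); rewrite setTI.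
congr measurable; apply/seteqP; split => [w [_ //]|w Bw]; split => //.
by rewrite /time_space /= fine_ge0.
Qed.

Lemma optional_path_measurable (X : R -> Omega -> R) w : optional F X ->
  measurable_fun (`[0, +oo[%classic : set R) (X ^~ w).
Proof.
move=> oX _ B mB.
have := measurable_ysection w (optional_sets_measurable (oX B mB)).
congr measurable; apply/seteqP; split => s /=;
  by rewrite /ysection /= inE /time_space /= in_itv /= andbT.
Qed.

Variable P : probability Omega R.
Hypothesis hU : usual_hypotheses P F.

Lemma negligible_filtration t : 0 <= t -> P.-negligible `<=` F t.
Proof.
move=> t0; case: hU => _ /subset_trans; apply.
exact: (filtration_mono hF).
Qed.

Lemma negligible_measurable : P.-negligible `<=` (measurable : set (set Omega)).
Proof.
apply: subset_trans (negligible_filtration (lexx 0)) _.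
exact: filtration_sub.
Qed.

Lemma optional_projection t (I : set R) (E : set (R * Omega)) :
  0 <= t -> measurable I -> optional_sets F E ->
  F t [set w | exists s, [/\ 0 <= s <= t, I s & E (s, w)]].
Proof.
move=> t0 mI oE.
pose E' : set (R * g_sigma_algebraType (F t)) :=
  (I `*` setT) `&` ((`[0, t]%classic `*` setT) `&` E).
have mE' : measurable E'.
  apply: measurableI; first exact: measurableX.
  exact: (optional_progressive hF oE t0).
have := measurable_projection (filtration_sigma hF t0)
  (filtration_sub hF t0) (negligible_filtration t0) 0 t mE'.
congr (F t); apply/seteqP; split => w.
  by move=> [s st [[/= Is _] [_ Es]]]; exists s.
by move=> [s [st Is Es]]; exists s.
Qed.

End optional_processes.

(** * Stieltjes measures of adapted increasing processes *)

Section stieltjes_measure.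
Context {R : realType}.
Variable f : cumulative R R.
Local Notation mu := (lebesgue_stieltjes_measure f).

Lemma stieltjes_measure_itv_oc (a b : R) : a <= b ->
  mu `]a, b]%classic = (f b - f a)%:E.
Proof.
move=> ab; rewrite /lebesgue_stieltjes_measure /measure_extension.
rewrite measurable_mu_extE/=; last exact: is_ocitv.
by rewrite wlength_itv_bnd.
Qed.

End stieltjes_measure.

Section stieltjes_kernel.
Import HBNNSimple.
Context {d : measure_display} {Omega : measurableType d} {R : realType}.
Variables (F : R -> set (set Omega)) (A : Omega -> cumulative R R).
Hypothesis hF : filtration F.
Hypothesis A0 : forall w t, t < 0 -> A w t = 0.
Hypothesis aA : adapted F (fun t w => A w t).
Local Notation mu w := (lebesgue_stieltjes_measure (A w)).

Section fixed_time.
Variables (t : R) (t0 : 0 <= t).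
Local Notation Ft := (g_sigma_algebraType (F t)).

Lemma adapted_stieltjes_measurable s : s <= t ->
  measurable_fun [set: Ft] (fun w => A w s).
Proof.
move=> st; have [s0|s0] := ltP s 0.
  by rewrite (_ : (fun w => A w s) = cst 0)//; apply/funext => w; rewrite A0.
exact: (measurable_wrt_mono hF s0 st (aA s0)).
Qed.

Let D : set R := `]-1, t]%classic.
Let mD : measurable (D : set (measurableTypeR R)).
Proof. exact: measurable_itv. Qed.

Let kD (w : Ft) : {measure set (measurableTypeR R) -> \bar R} :=
  mrestr (mu w) mD.

Let kD_lt w U : measurable U -> (kD w U < (A w t + 1)%:E)%E.
Proof.
move=> mU; rewrite /kD /= /mrestr.
apply: (@le_lt_trans _ _ (mu w D)).
  by apply: le_measure; rewrite ?inE//; exact: measurableI.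
have le1 : -1 <= t :> R by move: t0; lra.
by rewrite /D stieltjes_measure_itv_oc// (A0 _ (ltrN10 _)) subr0 lte_fin ltrDl.
Qed.

Let measurable_kD (U : set (measurableTypeR R)) : measurable U ->
  measurable_fun [set: Ft] (kD ^~ U).
Proof.
move: U; pose H := [set U : set (measurableTypeR R) | measurable U /\
  measurable_fun [set: Ft] (kD ^~ U)].
suff : measurable `<=` H by move=> h U /h[].
have le1 : -1 <= t :> R by move: t0; lra.
apply: lambda_system_subset.
- exact: ocitvI.
- split => //.
  + split; first exact: measurableT.
    rewrite (_ : kD ^~ _ = fun w => (A w t)%:E).
      by apply/measurable_EFinP; exact: adapted_stieltjes_measurable.
    apply/funext => w; rewrite /kD /= /mrestr setTI.
    by rewrite /D stieltjes_measure_itv_oc// (A0 _ (ltrN10 _)) subr0.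
  + move=> X Y YX [mX hX] [mY hY]; split; first exact: measurableD.
    rewrite (_ : kD ^~ _ = fun w => kD w X - kD w Y)%E.
      exact: emeasurable_funB.
    apply/funext => w; rewrite measureD//; last first.
      by apply: lt_trans (kD_lt w mX) _; rewrite ltry.
    by rewrite setIidr.
  + move=> X ndX HX; split; first by apply: bigcupT_measurable => n; case: (HX n).
    apply: (@emeasurable_fun_cvg _ _ _ _ (fun n w => kD w (X n))).
      by move=> n; case: (HX n).
    move=> w _; apply: nondecreasing_cvg_mu => //.
      by move=> n; case: (HX n).
    by apply: bigcupT_measurable => n; case: (HX n).
- move=> X [a _ <-]; split; first by apply: sub_sigma_algebra; exact: is_ocitv.
  pose m := Num.max a.1 (-1); pose M := Num.min a.2 t.
  have UE : `]a.1, a.2]%classic `&` D = `]m, M]%classic :> set R.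
    apply/seteqP; split => s; rewrite /D /m /M /= !in_itv /= gt_max le_min.
      by move=> [/andP[-> ->] /andP[-> ->]].
    by move=> /andP[/andP[-> ->] /andP[-> ->]].
  have [mM|Mm] := leP m M.
    rewrite (_ : kD ^~ _ = fun w => (A w M - A w m)%:E).
      have Mt : M <= t by rewrite ge_min lexx orbT.
      apply/measurable_EFinP; apply: measurable_funB;
        apply: adapted_stieltjes_measurable => //.
      exact: le_trans mM Mt.
    by apply/funext => w; rewrite /kD /= /mrestr UE stieltjes_measure_itv_oc.
  rewrite (_ : kD ^~ _ = cst 0%E)//.
  apply/funext => w; rewrite /kD /= /mrestr UE set_itv_ge ?measure0//.
  by rewrite bnd_simp -leNgt ltW.
- by [].
Qed.

HB.instance Definition _ := isKernel.Build _ _ Ft (measurableTypeR R) R kD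
  measurable_kD.

(** The restrictions of the measures [mu w] to an interval containing [[0, t]]
    form a finite kernel from [F t], by a monotone class argument from the
    intervals, and integrals against a kernel are measurable. *)
Lemma measurable_stieltjes_integral (f : R * Ft -> \bar R) :
  (forall z, (0 <= f z)%E) -> measurable_fun setT f ->
  measurable_fun [set: Ft]
    (fun w => \int[mu w]_(s in `[0%R, t]) f (s, w))%E.
Proof.
move=> f0 mf.
pose k (z : Ft * measurableTypeR R) :=
  ((fun z => f (z.2, z.1)) \_
    ([set: Ft] `*` (`[0, t]%classic : set (measurableTypeR R)))) z.
have k0 z : (0 <= k z)%E by rewrite /k patchE; case: ifP.
have mk : measurable_fun setT k.
  apply/(measurable_restrictT (fun z : Ft * measurableTypeR R =>
    f (z.2, z.1))); first by apply: measurableX => //; exact: measurable_itv.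
  apply: measurable_funTS.
  have ms : measurable_fun setT
      (fun z : Ft * measurableTypeR R => (z.2, z.1) : R * Ft).
    by apply: measurable_fun_pair; [exact: measurable_snd|exact: measurable_fst].
  exact: (measurableT_comp mf ms).
rewrite (_ : (fun w => _) = fun w => \int[kD w]_s k (w, s))%E.
  pose k_ := nnsfun_approx measurableT mk.
  apply: (@measurable_fun_xsection_integral _ _ _ _ _ _ kD k_).
  - by move=> a b ab; exact/nd_nnsfun_approx.
  - by move=> z; exact/cvg_nnsfun_approx.
  - move=> n r.
    have mkr : measurable ((k_ n : Ft * measurableTypeR R -> R) @^-1` [set r]).
      by [].
    have kT w U : mrestr (kD w) measurableT U = kD w U by rewrite /mrestr setIT.
    have bD w : exists c, forall U, measurable U ->
        (mrestr (kD w) measurableT U < c%:E)%E.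
      by exists (A w t + 1) => U mU; rewrite kT; exact: kD_lt.
    have [_] := measurable_prod_subset_xsection_kernel bD mkr.
    by under eq_fun do rewrite kT.
apply/funext => w.
rewrite (@eq_measure_integral _ _ _ (`[0%R, t]%classic : set (measurableTypeR R)) (kD w)).
  rewrite integral_mkcond; apply: eq_integral => s _.
  by rewrite /k !patchE /= in_setX in_setT.
move=> U mU Ut; rewrite /kD /= /mrestr setIidl// => s /Ut /=.
by rewrite /D /= !in_itv /= => /andP[s0 ->]; rewrite andbT (lt_le_trans _ s0)// ltrN10.
Qed.

End fixed_time.
End stieltjes_kernel.

(** * Integrals against a dual optional projection *)

Lemma cvg_integral_nondecreasing {d} {T : measurableType d} {R : realType}
    (mu : {measure set T -> \bar R}) (D : set T)
    (g : nat -> T -> \bar R) (f : T -> \bar R) :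
  measurable D -> (forall n, measurable_fun D (g n)) ->
  (forall n x, D x -> (0 <= g n x)%E) ->
  (forall x, D x -> nondecreasing_seq (g ^~ x)) ->
  (forall x, D x -> g n x @[n --> \oo] --> f x) ->
  (\int[mu]_(x in D) g n x @[n --> \oo] --> \int[mu]_(x in D) f x)%E.
Proof.
move=> mD mg g0 ndg gf.
have := @cvg_monotone_convergence _ _ _ mu D mD g mg g0 ndg.
rewrite (_ : (\int[mu]_(x in D) limn (g^~ x) = \int[mu]_(x in D) f x)%E)//.
apply: eq_integral => x /set_mem Dx.
by apply/cvg_lim => //; exact: gf.
Qed.

Lemma itv0y_bigcup_nat {R : realType} :
  `[0, +oo[%classic = \bigcup_n `[0, n%:R]%classic :> set R.
Proof.
apply/seteqP; split => s /=; rewrite in_itv /= andbT.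
  move=> s0; exists (Num.truncn s).+1 => //=.
  by rewrite in_itv /= s0 ltW// truncnS_gt.
by move=> [n _] /=; rewrite in_itv /= => /andP[].
Qed.

Section dual_projection.
Context {d : measure_display} {Omega : measurableType d} {R : realType}.
Variables (P : probability Omega R) (F : R -> set (set Omega)).
Hypothesis hF : filtration F.
Variables (L : Omega -> \bar R) (A : Omega -> cumulative R R).
Hypothesis mL : measurable_fun setT L.
Hypothesis L0 : forall w, (0 <= L w)%E.
Hypothesis hAL : dual_optional_projection P F L A.
Local Notation mu w := (lebesgue_stieltjes_measure (A w)).

Lemma dual_projection_neg w t : t < 0 -> A w t = 0.
Proof. by case: hAL => + _ _; exact. Qed.

Lemma dual_projection_adapted : adapted F (fun t w => A w t).
Proof. by case: hAL. Qed.

Lemma optional_progressive_fun (H : R -> Omega -> R) t : 0 <= t ->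
  optional F H -> measurable_fun
    (`[0, t]%classic `*` setT : set (R * g_sigma_algebraType (F t)))
    (fun z => H z.1 z.2).
Proof.
move=> t0 oH _ B mB.
have := optional_progressive hF (oH B mB) t0; congr measurable.
apply/seteqP; split => [[s w] [? [_ ?]]//|[s w] [st Bs]].
by split => //; split => //; case: st; rewrite /= in_itv /= => /andP[].
Qed.

Section nonnegative.
Variable H : R -> Omega -> R.
Hypotheses (oH : optional F H) (H0 : forall t w, 0 <= t -> 0 <= H t w).

Lemma measurable_integral_upto_ge0 t : 0 <= t ->
  measurable_fun [set: g_sigma_algebraType (F t)]
    (fun w => \int[mu w]_(s in `[0%R, t]) (H s w)%:E)%E.
Proof.
move=> t0.
pose D := `[0, t]%classic `*` setT : set (R * g_sigma_algebraType (F t)).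
have mD : measurable D by exact: measurableX.
pose f : R * g_sigma_algebraType (F t) -> \bar R :=
  (fun z => (H z.1 z.2)%:E) \_ D.
have f0 z : (0 <= f z)%E.
  rewrite /f patchE; case: ifPn => //; rewrite inE => -[/= + _].
  by rewrite in_itv /= lee_fin => /andP[? _]; exact: H0.
have mf : measurable_fun setT f.
  apply/(measurable_restrictT (fun z : R * g_sigma_algebraType (F t) =>
    (H z.1 z.2)%:E)) => //.
  by apply/measurable_EFinP; exact: optional_progressive_fun.
have := measurable_stieltjes_integral hF dual_projection_neg
  dual_projection_adapted t0 f0 mf.
rewrite (_ : (fun w => _) =
  fun w => \int[mu w]_(s in `[0%R, t]) (H s w)%:E)%E//.
apply/funext => w; apply: eq_integral => s; rewrite inE /= => st.
by rewrite /f patchE mem_set.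
Qed.

Lemma cvg_integral_upto_ge0 w :
  (\int[mu w]_(s in `[0%R, n%:R]) (H s w)%:E @[n --> \oo] -->
   \int[mu w]_(s in `[0%R, +oo[) (H s w)%:E)%E.
Proof.
rewrite itv0y_bigcup_nat.
apply: (@ge0_nondecreasing_set_cvg_integral _ _ _
  (fun n => `[0%R, n%:R]%classic : set (measurableTypeR R))).
- move=> m n mn; apply/subsetPset => s /=; rewrite !in_itv /=.
  by move=> /andP[-> /le_trans]; apply; rewrite ler_nat.
- by move=> n; exact: measurable_itv.
- move=> n; apply/measurable_EFinP.
  apply: measurable_funS (optional_path_measurable hF w oH) => //.
  by move=> s /=; rewrite !in_itv /= => /andP[->].
- by move=> n s /=; rewrite in_itv /= lee_fin => /andP[? _]; exact: H0.
Qed.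

Lemma measurable_total_integral_ge0 : measurable_fun [set: Omega]
  (fun w => \int[mu w]_(s in `[0%R, +oo[) (H s w)%:E)%E.
Proof.
apply: (@emeasurable_fun_cvg _ _ _ _
    (fun (n : nat) w => \int[mu w]_(s in `[0%R, n%:R]) (H s w)%:E)%E).
  move=> n _ B mB; rewrite setTI; apply: (filtration_sub hF (ler0n _ n)).
  have := measurable_integral_upto_ge0 (ler0n _ n) measurableT mB.
  by rewrite setTI (filtrationE hF _ (ler0n _ n)).
by move=> w _; exact: cvg_integral_upto_ge0.
Qed.

End nonnegative.

(** The identity defining the projection extends from bounded to nonnegative
    optional processes by monotone convergence. *)
Lemma dual_projection_ge0 (H : R -> Omega -> R) :
  optional F H -> (forall t w, 0 <= t -> 0 <= H t w) ->
  (\int[P]_w \int[mu w]_(s in `[0%R, +oo[) (H s w)%:E =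
   \int[P]_w (at_time H L w)%:E)%E.
Proof.
move=> oH H0; pose Hn (n : nat) t w := Num.min (H t w) n%:R.
have oHn n : optional F (Hn n).
  apply/optionalP; apply: measurable_minr => //.
  exact/optionalP.
have Hn0 n t w : 0 <= t -> 0 <= Hn n t w.
  by move=> t0; rewrite le_min H0//=.
have Hnb n : exists K : R, forall t w, 0 <= t -> `|Hn n t w| <= K.
  exists n%:R => t w t0; rewrite ger0_norm ?Hn0//.
  by rewrite ge_min lexx orbT.
have ndHn t w : nondecreasing_seq (fun n => (Hn n t w)%:E).
  move=> m n mn; rewrite lee_fin /Hn le_min !ge_min lexx /=.
  by rewrite ler_nat mn orbT.
have cHn t w : (Hn n t w)%:E @[n --> \oo] --> (H t w)%:E.
  apply: cvg_near_cst; near=> n; rewrite /Hn min_l//.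
  near: n; exists (Num.truncn (H t w)).+1 => // m /= hm.
  by apply: (le_trans (ltW (truncnS_gt _))); rewrite ler_nat.
have c1 w : (\int[mu w]_(s in `[0%R, +oo[) (Hn n s w)%:E @[n --> \oo] -->
    \int[mu w]_(s in `[0%R, +oo[) (H s w)%:E)%E.
  apply: cvg_integral_nondecreasing => //.
  - by move=> n; apply/measurable_EFinP; exact: (optional_path_measurable hF).
  - by move=> n s /=; rewrite in_itv /= andbT lee_fin; exact: Hn0.
have nd1 w : nondecreasing_seq
    (fun n => \int[mu w]_(s in `[0%R, +oo[) (Hn n s w)%:E)%E.
  move=> m n mn; apply: ge0_le_integral => //.
  - by move=> s /=; rewrite in_itv /= andbT lee_fin; exact: Hn0.
  - by apply/measurable_EFinP; exact: (optional_path_measurable hF).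
  - by apply/measurable_EFinP; exact: (optional_path_measurable hF).
  - by move=> s _; exact: ndHn.
have mHn n : measurable_fun [set: Omega]
    (fun w => \int[mu w]_(s in `[0%R, +oo[) (Hn n s w)%:E)%E.
  exact: (measurable_total_integral_ge0 (oHn n) (Hn0 n)).
have c2 : (\int[P]_w \int[mu w]_(s in `[0%R, +oo[) (Hn n s w)%:E
    @[n --> \oo] --> \int[P]_w \int[mu w]_(s in `[0%R, +oo[) (H s w)%:E)%E.
  apply: cvg_integral_nondecreasing => //.
  move=> n w _; apply: integral_ge0 => s /=.
  by rewrite in_itv /= andbT lee_fin; exact: Hn0.
have c3 : (\int[P]_w (at_time (Hn n) L w)%:E @[n --> \oo] -->
    \int[P]_w (at_time H L w)%:E)%E.
  apply: cvg_integral_nondecreasing => //.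
  - move=> n; apply/measurable_EFinP; exact: (measurable_at_time hF).
  - by move=> n w _; rewrite lee_fin Hn0// fine_ge0.
  - by move=> w _; exact: ndHn.
  - by move=> w _; exact: cHn.
have E n : (\int[P]_w \int[mu w]_(s in `[0%R, +oo[) (Hn n s w)%:E =
    \int[P]_w (at_time (Hn n) L w)%:E)%E.
  have [_ _ h] := hAL.
  by rewrite (h _ (oHn n) (Hnb n)) unlock.
move: c2; under eq_fun do rewrite E.
by move=> c2; rewrite -(cvg_lim _ c2)//; exact/cvg_lim.
Unshelve. all: by end_near. Qed.

Lemma optional_norm (y : R -> Omega -> R) : optional F y ->
  optional F (fun t w => `|y t w|).
Proof.
move=> /optionalP my; apply/optionalP.
exact: (measurableT_comp (@normr_measurable R setT) my).
Qed.

Lemma ae_integral_lty (f : Omega -> \bar R) : measurable_fun setT f ->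
  (forall w, (0 <= f w)%E) -> (\int[P]_w f w < +oo)%E ->
  {ae P, forall w, (f w < +oo)%E}.
Proof.
move=> mf f0 fy.
have /integrable_ae : P.-integrable setT f.
  apply/integrableP; split => //.
  by under eq_integral do rewrite gee0_abs//.
move=> /(_ measurableT); apply: filterS => w /(_ Logic.I).
by rewrite ge0_fin_numE.
Qed.

(** Positive and negative parts reduce this to nonnegative processes. *)
Lemma dual_projection_integrable (y : R -> Omega -> R) :
  optional F y -> P.-integrable setT (EFin \o at_time y L) ->
  [/\ {ae P, forall w, (mu w).-integrable `[0%R, +oo[%classic (EFin \o y ^~ w)},
      P.-integrable setT (EFin \o total_integral A y) &
      (\int[P]_w (total_integral A y w)%:E = \int[P]_w (at_time y L w)%:E)%E].
Proof.
move=> oy iy.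
pose ya (t : R) (w : Omega) : R := `|y t w|.
pose yp (t : R) (w : Omega) : R := Num.max (y t w) 0.
pose yn (t : R) (w : Omega) : R := Num.max (- y t w) 0.
have oya : optional F ya by exact: optional_norm.
have oyp : optional F yp.
  by apply/optionalP; apply: measurable_maxr => //; exact/optionalP.
have oyn : optional F yn.
  apply/optionalP; apply: measurable_maxr => //.
  by apply: measurable_funN; exact/optionalP.
have ya0 t w : 0 <= t -> 0 <= ya t w by move=> _; exact: normr_ge0.
have yp0 t w : 0 <= t -> 0 <= yp t w by rewrite le_max lexx orbT.
have yn0 t w : 0 <= t -> 0 <= yn t w by rewrite le_max lexx orbT.
pose I_ (z : R -> Omega -> R) w := (\int[mu w]_(s in `[0%R, +oo[) (z s w)%:E)%E.
have mI z : optional F z -> (forall t w, 0 <= t -> 0 <= z t w) ->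
    measurable_fun setT (I_ z) by exact: measurable_total_integral_ge0.
have I0 z : (forall t w, 0 <= t -> 0 <= z t w) -> forall w, (0 <= I_ z w)%E.
  move=> z0 w; apply: integral_ge0 => s /=.
  by rewrite in_itv /= andbT lee_fin; exact: z0.
have Ia : (\int[P]_w I_ ya w < +oo)%E.
  rewrite dual_projection_ge0//.
  by move/integrableP : iy => [_].
have iIa : P.-integrable setT (I_ ya).
  apply/integrableP; split; first exact: mI.
  by under eq_integral do rewrite gee0_abs ?I0//.
have my w : measurable_fun (`[0, +oo[%classic : set (measurableTypeR R))
    (EFin \o y ^~ w).
  by apply/measurable_EFinP; exact: (optional_path_measurable hF).
have Iylt w : (I_ ya w < +oo)%E ->
    (mu w).-integrable `[0%R, +oo[%classic (EFin \o y ^~ w).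
  by move=> lty; apply/integrableP; split.
have aey : {ae P, forall w, (I_ ya w < +oo)%E}.
  by apply: ae_integral_lty => //; [exact: mI|exact: I0].
have totE w : (\int[mu w]_(s in `[0%R, +oo[) (y s w)%:E = I_ yp w - I_ yn w)%E.
  rewrite integralE; congr (_ - _)%E; apply: eq_integral => s _.
    by rewrite funeposE /yp EFin_max.
  by rewrite funenegE /yn EFin_max.
have mtot : measurable_fun setT (total_integral A y).
  rewrite (_ : total_integral A y = fine \o (I_ yp \- I_ yn)%E).
    apply: measurableT_comp => //; apply: emeasurable_funB; exact: mI.
  by apply/funext => w; rewrite /total_integral /Rintegral totE.
have iI z : optional F z -> (forall t w, 0 <= t -> 0 <= z t w <= ya t w) ->
    P.-integrable setT (I_ z).
  move=> oz hz; apply: (le_integrable measurableT _ _ iIa).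
    by apply: mI => // t w t0; case/andP: (hz t w t0).
  move=> w _; rewrite !gee0_abs ?I0//; last first.
    by move=> t w' t0; case/andP: (hz t w' t0).
  apply: ge0_le_integral => //.
  - by move=> s /=; rewrite in_itv /= andbT lee_fin => /(hz s w)/andP[].
  - by apply/measurable_EFinP; exact: (optional_path_measurable hF).
  - by apply/measurable_EFinP; exact: (optional_path_measurable hF).
  - by move=> s /=; rewrite in_itv /= andbT lee_fin => /(hz s w)/andP[].
have iIp : P.-integrable setT (I_ yp).
  apply: iI => // t w t0; rewrite yp0//= /yp /ya ge_max ler_norm.
  by rewrite normr_ge0.
have iIn : P.-integrable setT (I_ yn).
  apply: iI => // t w t0; rewrite yn0//= /yn /ya ge_max -normrN ler_norm.
  by rewrite normr_ge0.
split.
- by apply: filterS aey => w; exact: Iylt.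
- apply: (le_integrable measurableT _ _ iIa); first exact/measurable_EFinP.
  move=> w _; rewrite [leRHS]gee0_abs ?I0//=.
  have [Iw|Iw] := ltP (I_ ya w) +oo%E; last first.
    by rewrite leye_eq in Iw; rewrite (eqP Iw) leey.
  rewrite /total_integral EFin_normr_Rintegral//; last exact: Iylt.
  exact: (le_abse_integral (mu w) (measurable_itv `[0%R, +oo[) (my w)).
- transitivity (\int[P]_w (I_ yp w - I_ yn w))%E.
    apply: ae_eq_integral => //.
    + exact/measurable_EFinP.
    + by apply: emeasurable_funB; exact: mI.
    + apply: filterS aey => w Iw _.
      rewrite -totE /total_integral /Rintegral fineK//.
      exact: integrable_fin_num (Iylt _ Iw).
  rewrite integralB// !dual_projection_ge0//.
  rewrite [RHS]integralE; congr (_ - _)%E; apply: eq_integral => w _.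
    by rewrite funeposE /= /yp /at_time EFin_max.
  by rewrite funenegE /= /yn /at_time EFin_max.
Qed.

Lemma optional_indic (E : set (R * Omega)) : optional_sets F E ->
  optional F (fun t w => \1_E (t, w)).
Proof.
move=> oE; apply/optionalP.
have mE : measurable (E : set (g_sigma_algebraType (optional_system F))).
  by rewrite -optional_setsE//; exact: optional_sub_time_space oE.
rewrite (_ : (fun z => _) = \1_E); first exact: measurable_indic.
by apply/funext => -[].
Qed.

Lemma dual_projection_null (E : set (R * Omega)) : optional_sets F E ->
  P [set w | E (fine (L w), w)] = 0%E ->
  {ae P, forall w, mu w [set s | E (s, w)] = 0%E}.
Proof.
move=> oE PE0; pose H t w : R := \1_E (t, w).
have oH : optional F H by exact: optional_indic.
have H0 t w : 0 <= t -> 0 <= H t w by [].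
have IE w : (\int[mu w]_(s in `[0%R, +oo[) (H s w)%:E = mu w [set s | E (s, w)])%E.
  have mEw : measurable ([set s | E (s, w)] : set (measurableTypeR R)).
    have := measurable_ysection w (optional_sets_measurable hF oE).
    by congr measurable; apply/seteqP; split => s; rewrite /ysection /= inE.
  rewrite (_ : mu w [set s | E (s, w)] =
    mu w ([set s | E (s, w)] `&` `[0%R, +oo[%classic)).
    by rewrite -integral_indic//; apply: eq_integral => s _; rewrite /H !indicE.
  rewrite setIidl// => s /= /(optional_sub_time_space oE).
  by rewrite in_itv /= andbT.
have := dual_projection_ge0 oH H0.
rewrite (_ : (\int[P]_w (at_time H L w)%:E = 0)%E); last first.
  have mE : measurable [set w | E (fine (L w), w)]; last first.
    rewrite -[RHS]PE0 -[in RHS](setIT [set w | _]) -integral_indic//.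
  have := measurable_at_time hF oH mL L0 measurableT (measurable_set1 1).
  rewrite setTI; congr measurable; apply/seteqP; split => w;
    rewrite /at_time /H /= indicE.
    by case: (boolP (_ \in E)); [rewrite inE|move=> _ /esym/eqP; rewrite oner_eq0].
  by move=> Ew; rewrite mem_set.
move=> I0.
have m0 := measurable_total_integral_ge0 oH H0.
have : ae_eq P setT (fun w => \int[mu w]_(s in `[0%R, +oo[) (H s w)%:E)%E (cst 0%E).
  apply/ae_eq_integral_abs => //; rewrite -[RHS]I0.
  apply: eq_integral => w _; rewrite gee0_abs//.
  by apply: integral_ge0 => s _; rewrite lee_fin.
by apply: filterS => w /(_ Logic.I); rewrite IE.
Qed.

Lemma dual_projection_finite_mass :
  {ae P, forall w, (mu w `[0%R, +oo[%classic < +oo)%E}.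
Proof.
pose H (t : R) (w : Omega) : R := 1.
have oH : optional F H by apply/optionalP; exact: measurable_cst.
have H0 t w : 0 <= t -> 0 <= H t w by [].
have m0 := measurable_total_integral_ge0 oH H0.
have := @ae_integral_lty _ m0.
rewrite dual_projection_ge0// => h.
have : {ae P, forall w, (\int[mu w]_(s in `[0%R, +oo[) (H s w)%:E < +oo)%E}.
  apply: h.
    by move=> w; apply: integral_ge0 => s _; rewrite lee_fin.
  by rewrite /at_time /H integral_cst//= mul1e ltey_eq fin_num_measure.
apply: filterS => w; rewrite /H integral_cst ?mul1e//; exact: measurable_itv.
Qed.

End dual_projection.

(** * Last exit from an optional set *)

Section last_exit.
Context {d : measure_display} {Omega : measurableType d} {R : realType}.
Variable F : R -> set (set Omega).
Hypothesis hF : filtration F.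
Variable P : probability Omega R.
Hypothesis hU : usual_hypotheses P F.
Variable Gamma : set (R * Omega).
Hypothesis oGamma : optional_sets F Gamma.

Let Gamma_ge0 s w : Gamma (s, w) -> 0 <= s.
Proof. by move=> /(optional_sub_time_space oGamma). Qed.

Let visits t w : set R := [set 0] `|` [set s | s < t /\ Gamma (s, w)].

(** The last visit to [Gamma] before [t].  The value 0 is added so that the
    supremum is that of a nonempty set; since the inequality [s < t] is strict,
    the process is left-continuous. *)
Definition last_exit (t : R) (w : Omega) : R := sup (visits t w).

Let visits0 t w : visits t w !=set0.
Proof. by exists 0; left. Qed.

Let visits_ub t w : has_ubound (visits t w).
Proof.
by exists (Num.max 0 t) => s [->|[/ltW st _]]; rewrite le_max ?lexx// st orbT.
Qed.

Lemma last_exit_ge0 t w : 0 <= last_exit t w.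
Proof. by apply: (ub_le_sup (visits_ub t w)); left. Qed.

Lemma last_exit_le t w : 0 <= t -> last_exit t w <= t.
Proof. by move=> t0; apply: (ge_sup (visits0 t w)) => s [->|[/ltW]]. Qed.

Lemma last_exit_ub t s w : s < t -> Gamma (s, w) -> s <= last_exit t w.
Proof. by move=> st Gs; apply: (ub_le_sup (visits_ub t w)); right. Qed.

Lemma last_exit_gt t r w : 0 <= r ->
  r < last_exit t w <-> exists s, r < s < t /\ Gamma (s, w).
Proof.
move=> r0; split => [/(sup_gt (visits0 t w))[s [->|[st Gs]] rs]|[s [/andP[rs st] Gs]]].
- by rewrite ltNge r0 in rs.
- by exists s; rewrite rs st.
- exact: lt_le_trans (last_exit_ub st Gs).
Qed.

Lemma last_exit_mono s t w : s <= t -> last_exit s w <= last_exit t w.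
Proof.
move=> st; apply: (ge_sup (visits0 s w)) => r [->|[rs Gr]]; first exact: last_exit_ge0.
by apply: last_exit_ub => //; exact: lt_le_trans st.
Qed.

(** By the projection theorem, whether [Gamma] is visited during an open time
    interval is known at the end of that interval. *)
Lemma last_exit_adapted : adapted F last_exit.
Proof.
move=> t t0 mD; apply: (measurability _ (RGenOInfty.measurableE R)) => //.
move=> _ [_ [r ->] <-]; rewrite setTI -filtrationE//.
have [r0|r0] := leP 0 r.
  have := optional_projection hF hU t0 (measurable_itv `]r, t[) oGamma.
  congr (F t); apply/seteqP; split => w /=.
    move=> [s [_ + Gs]]; rewrite !in_itv /= andbT => rst.
    by apply/last_exit_gt => //; exists s.
  rewrite in_itv /= andbT => /last_exit_gt -/(_ r0)[s [rst Gs]].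
  exists s; split => //; rewrite (Gamma_ge0 Gs)/=.
  by case/andP: rst => _ /ltW.
rewrite (_ : _ @^-1` _ = setT).
  by rewrite (filtrationE hF _ t0); exact: measurableT.
apply/seteqP; split => // w _ /=; rewrite in_itv /= andbT.
exact: lt_le_trans (last_exit_ge0 _ _).
Qed.

Lemma last_exit_left_continuous w : left_continuous (last_exit ^~ w).
Proof.
move=> t t0; apply/cvgrPdist_lt => e e0.
have dE s : s < t -> `|last_exit t w - last_exit s w| =
    last_exit t w - last_exit s w.
  by move=> st; rewrite ger0_norm// subr_ge0 last_exit_mono// ltW.
have [le0|le0] := ltP (last_exit t w - e) 0.
  near=> s; have st : s < t by near: s; exact: nbhs_left_lt.
  by rewrite dE//; have := last_exit_ge0 s w; lra.
have : last_exit t w - e < last_exit t w by lra.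
move=> /last_exit_gt -/(_ le0)[u [/andP[eu ut] Gu]].
near=> s; have st : s < t by near: s; exact: nbhs_left_lt.
rewrite dE//; have : u <= last_exit s w.
  by apply: last_exit_ub => //; near: s; exact: nbhs_left_gt.
by lra.
Unshelve. all: by end_near. Qed.

Lemma last_exit_optional : optional F last_exit.
Proof.
by apply: adapted_lc_optional => //;
  [exact: last_exit_adapted|exact: last_exit_left_continuous].
Qed.

(** The points of [Gamma], the limits of [Gamma] from the left, and time 0.
    Unlike [Gamma], this set contains the graph of [L] where [L] is finite. *)
Definition left_closure : set (R * Omega) :=
  Gamma `|` [set z | 0 <= z.1 /\ last_exit z.1 z.2 = z.1].

Lemma left_closure_optional : optional_sets F left_closure.
Proof.
have Gt : left_closure `<=` time_space.
  by move=> z [|[//]]; exact: (optional_sub_time_space oGamma).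
rewrite optional_setsE//; apply: measurableU.
  by rewrite -optional_setsE//; exact: (optional_sub_time_space oGamma).
pose X (t : R) (w : Omega) : R := t.
have oX : optional F X.
  apply: adapted_cadlag_optional.
    by move=> t t0; exact: measurable_cst.
  move=> w; split => t t0; first exact: (cvg_at_right_filter cvg_id).
  by exists t; exact: (cvg_at_left_filter cvg_id).
have /optionalP oD : optional F (fun t w => last_exit t w - X t w).
  by apply/optionalP; apply: measurable_funB;
    apply/optionalP => //; exact: last_exit_optional.
rewrite -optional_setsE => [|z []//].
have := oD measurableT [set 0] (measurable_set1 0).
rewrite setTI -optional_systemE; congr optional_sets.
apply/seteqP; split => z [z0 h]; split => //.
  by apply/eqP; rewrite -subr_eq0; apply/eqP.
by apply/eqP; rewrite /= subr_eq0; apply/eqP.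
Qed.

Variable L : Omega -> \bar R.
Hypothesis LE : forall w,
  L w = ereal_sup (0%E |` [set t%:E | t in [set t | Gamma (t, w)]]).

Lemma end_ge0 w : (0 <= L w)%E.
Proof. by rewrite LE; apply: ereal_sup_ubound; left. Qed.

Lemma end_ub s w : Gamma (s, w) -> (s%:E <= L w)%E.
Proof. by move=> Gs; rewrite LE; apply: ereal_sup_ubound; right; exists s. Qed.

Lemma end_le w (r : \bar R) : (0 <= r)%E ->
  (forall s, Gamma (s, w) -> (s%:E <= r)%E) -> (L w <= r)%E.
Proof.
move=> r0 h; rewrite LE; apply: ge_ereal_sup => _ [->//|[s Gs <-]].
exact: h.
Qed.

Lemma end_in_left_closure w l : L w = l%:E -> left_closure (l, w).
Proof.
move=> Ll; have l0 : 0 <= l by rewrite -lee_fin -Ll end_ge0.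
have [Gl|nGl] := pselect (Gamma (l, w)); first by left.
right; split => //=; apply/eqP; rewrite eq_le last_exit_le//=.
rewrite -lee_fin -Ll; apply: end_le; first by rewrite lee_fin last_exit_ge0.
move=> s Gs; rewrite lee_fin; apply: last_exit_ub => //.
have := end_ub Gs; rewrite Ll lee_fin le_eqVlt => /predU1P[sl|//].
by rewrite sl in Gs.
Qed.

Lemma left_closure_le_end t w : left_closure (t, w) -> (t%:E <= L w)%E.
Proof.
move=> [|/= [t0 tE]]; first exact: end_ub.
rewrite leNgt; apply/negP => Lt.
have Lfin : L w = (fine (L w))%:E.
  by rewrite fineK// ge0_fin_numE ?end_ge0// (lt_trans Lt)// ltry.
rewrite Lfin lte_fin -[X in _ < X]tE in Lt.
have fL0 : 0 <= fine (L w) by rewrite fine_ge0// end_ge0.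
have [s [/andP[Ls _] /end_ub]] := (last_exit_gt t w fL0).1 Lt.
by rewrite Lfin lee_fin leNgt Ls.
Qed.

Lemma end_eq_last_exit t w : (L w < t%:E)%E -> L w = (last_exit t w)%:E.
Proof.
move=> Lt; apply/eqP; rewrite eq_le; apply/andP; split.
  apply: end_le; first by rewrite lee_fin last_exit_ge0.
  move=> s Gs; rewrite lee_fin; apply: last_exit_ub => //.
  by rewrite -lte_fin; apply: le_lt_trans Lt; exact: end_ub.
have Lfin : L w = (fine (L w))%:E.
  by rewrite fineK// ge0_fin_numE ?end_ge0// (lt_trans Lt)// ltry.
rewrite Lfin lee_fin; apply: (ge_sup (visits0 t w)) => s [->|[_ /end_ub]].
  by rewrite fine_ge0// end_ge0.
by rewrite Lfin lee_fin.
Qed.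

(** The complement of the left closure is an optional set that the graph of [L]
    does not meet, so [A] does not charge it; it contains all times after
    [L]. *)
Lemma mass_after_end (A : Omega -> cumulative R R) :
  measurable_fun setT L -> dual_optional_projection P F L A ->
  P [set w | L w = +oo%E] = 0%E ->
  {ae P, forall w, lebesgue_stieltjes_measure (A w) `]fine (L w), +oo[%classic = 0%E}.
Proof.
move=> mL hAL hLoo.
pose E : set (R * Omega) := time_space `\` left_closure.
have oE : optional_sets F E.
  by apply: sigma_algebraCD; exact: left_closure_optional.
have Loom : measurable [set w | L w = +oo%E].
  by have := mL measurableT _ (emeasurable_set1 +oo%E); rewrite setTI.
have PE : P [set w | E (fine (L w), w)] = 0%E.
  apply: (subset_measure0 _ Loom _ hLoo).
    have mp : measurable_fun setT (fun w => (fine (L w), w) : R * Omega).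
      apply: measurable_fun_pair => //.
      by apply: measurableT_comp => //; exact: mL.
    by have := mp measurableT _ (optional_sets_measurable hF oE); rewrite setTI.
  move=> w [_ nL] /=; apply: contrapT => Loo; apply: nL.
  apply: end_in_left_closure; rewrite fineK// ge0_fin_numE ?end_ge0//.
  by rewrite ltey; apply/eqP.
have aeLoo : {ae P, forall w, L w <> +oo%E}.
  by exists [set w | L w = +oo%E]; split => // w /= /contrapT.
have := dual_projection_null hF mL end_ge0 hAL oE PE.
apply: filterS2 aeLoo => w Loo h.
have mEw : measurable ([set s | E (s, w)] : set (measurableTypeR R)).
  have := measurable_ysection w (optional_sets_measurable hF oE).
  by congr measurable; apply/seteqP; split => s; rewrite /ysection /= inE.
apply: (subset_measure0 _ mEw _ h); first exact: measurable_itv.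
have Lfin : L w = (fine (L w))%:E.
  by rewrite fineK// ge0_fin_numE ?end_ge0// ltey; apply/eqP.
move=> s /=; rewrite in_itv /= andbT => Ls; split.
  by apply: (le_trans _ (ltW Ls)); rewrite fine_ge0// end_ge0.
by move/left_closure_le_end; rewrite Lfin lee_fin leNgt Ls.
Qed.

End last_exit.

(** * Absence of jumps of the dual projection *)

Section cumulative_paths.
Context {R : realType}.
Variable f : cumulative R R.

Lemma cumulative_cadlag_shift (c : R) : cadlag (fun s => f (s - c)).
Proof.
split => t t0.
  apply/cvgrPdist_lt => e e0.
  have := @cumulative_is_right_continuous _ _ _ f (t - c).
  move=> /cvgrPdist_lt /(_ e e0)[r /= r0 hr]; exists r => // s /= ts st.
  by apply: hr; [move: ts; rewrite /= opprB addrA subrK|rewrite ltrD2r].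
apply/cvg_ex; apply: nondecreasing_at_left_is_cvgr.
  near=> x; move=> a b _ _ ab; apply: cumulative_is_nondecreasing.
  by rewrite lerD2r.
near=> x; exists (f (t - c)) => _ [s + <-].
rewrite /= in_itv /= => /andP[_ st]; apply: cumulative_is_nondecreasing.
by rewrite lerD2r ltW.
Unshelve. all: by end_near. Qed.

Lemma stieltjes_measure_atom_ge (t e : R) :
  (forall n : nat, e <= f t - f (t - n.+1%:R^-1)) ->
  (e%:E <= lebesgue_stieltjes_measure f [set t])%E.
Proof.
move=> he; pose J (n : nat) : set R := `]t - n.+1%:R^-1, t]%classic.
have JE n : lebesgue_stieltjes_measure f (J n) = (f t - f (t - n.+1%:R^-1))%:E.
  by rewrite /J stieltjes_measure_itv_oc// gerBl invr_ge0.
have cJ : (lebesgue_stieltjes_measure f (J n) @[n --> \oo] -->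
    lebesgue_stieltjes_measure f (\bigcap_n J n))%E.
  apply: nonincreasing_cvg_mu => //.
  - by rewrite [X in (X < _)%E](JE 0%N) ltry.
  - by move=> n; exact: measurable_itv.
  - by apply: bigcapT_measurable => n; exact: measurable_itv.
  - move=> m n mn; apply/subsetPset => s; rewrite /J /= !in_itv /=.
    move=> /andP[h1 ->]; rewrite andbT (le_lt_trans _ h1)//.
    by rewrite lerD2l lerN2 lef_pV2 ?posrE// ler_nat ltnS.
rewrite (_ : [set t] = \bigcap_n J n); last first.
  apply/seteqP; split => s /=.
    by move=> -> n _; rewrite /J /= in_itv /= lexx andbT gtrBl invr_gt0.
  move=> Js; apply/eqP; rewrite eq_le; apply/andP; split.
    by have := Js 0%N Logic.I; rewrite /J /= in_itv /= => /andP[].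
  apply/ler_addgt0Pr => r r0; have [n hn] := natSinv_lt r0.
  have := Js n Logic.I; rewrite /J /= in_itv /= => /andP[+ _].
  rewrite ltrBlDr => /ltW/le_trans; apply.
  by rewrite lerD2l ltW.
rewrite -(cvg_lim _ cJ)//; apply: lime_ge.
  by apply/cvg_ex; eexists; exact: cJ.
by apply: nearW => n; rewrite JE lee_fin.
Qed.

End cumulative_paths.

Section jumps.
Context {d : measure_display} {Omega : measurableType d} {R : realType}.
Variables (P : probability Omega R) (F : R -> set (set Omega)).
Hypotheses (hF : filtration F) (hU : usual_hypotheses P F).
Variable A : Omega -> cumulative R R.
Hypothesis A0 : forall w t, t < 0 -> A w t = 0.
Hypothesis aA : adapted F (fun t w => A w t).

Let delayed_optional (c : R) : 0 <= c -> optional F (fun t w => A w (t - c)).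
Proof.
move=> c0; apply: adapted_cadlag_optional; last first.
  by move=> w; exact: cumulative_cadlag_shift.
move=> t t0; apply: (adapted_stieltjes_measurable hF A0 aA).
by rewrite gerBl.
Qed.

(** The times at which [A] jumps by at least [e]. *)
Definition jumps_ge (e : R) : set (R * Omega) :=
  [set z | 0 <= z.1 /\
    forall n : nat, e <= A z.2 z.1 - A z.2 (z.1 - n.+1%:R^-1)].

Lemma jumps_ge_optional e : optional_sets F (jumps_ge e).
Proof.
rewrite optional_setsE => [|z []//].
pose D n (z : g_sigma_algebraType (optional_system F)) :=
  A z.2 z.1 - A z.2 (z.1 - n.+1%:R^-1).
have mD n : measurable_fun setT (D n).
  apply: measurable_funB.
    have /optionalP := delayed_optional (lexx 0).
    by under eq_fun do rewrite subr0.
  by apply/(optionalP _ (fun t w => A w (t - n.+1%:R^-1)));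
    exact: delayed_optional.
rewrite (_ : jumps_ge e = time_space `&` \bigcap_n (D n @^-1` `[e, +oo[%classic)).
  apply: measurableI.
    rewrite -optional_systemE setIid.
    have := @optional_rectangle _ _ _ _ hF 0 setT (lexx 0).
    rewrite (filtrationE hF _ (lexx 0)) => /(_ measurableT).
    by congr optional_sets; apply/seteqP; split => -[s w];
      rewrite /= in_itv /= andbT => // -[].
  apply: bigcapT_measurable => n.
  by have := mD n measurableT _ (measurable_itv `[e, +oo[); rewrite setTI.
apply/seteqP; split => [z [z0 h]|z [z0 h]].
  by split => // n _; rewrite /= in_itv /= andbT; exact: h.
by split => // n; have := h n Logic.I; rewrite /= in_itv /= andbT.
Qed.

(** Jumps of size at least [e] cannot accumulate from the right at a point of
    right-continuity, so there is a first one. *)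
Lemma first_jump (e : R) w t : 0 < e -> jumps_ge e (t, w) ->
  exists2 t1, jumps_ge e (t1, w) & forall s, jumps_ge e (s, w) -> t1 <= s.
Proof.
move=> e0 Jt; pose S := [set s | jumps_ge e (s, w)].
have S0 : S !=set0 by exists t.
have Slb : has_lbound S by exists 0 => s [].
exists (inf S); last by move=> s Js; exact: (ge_inf Slb).
have t10 : 0 <= inf S by apply: lb_le_inf => // s [].
apply: contrapT => nJ.
have := @cumulative_is_right_continuous _ _ _ (A w) (inf S).
move=> /cvgrPdist_lt /(_ e e0)[r /= r0 hr].
have [s Ss sr] := inf_adherent r0 (conj S0 Slb).
have ts : inf S < s.
  rewrite lt_neqAle ge_inf// andbT; apply/eqP => tE.
  by apply: nJ; rewrite tE.
have := hr s; rewrite /= distrC ger0_norm ?subr_ge0 ?(ltW ts)// ltrBlDl => /(_ sr ts).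
rewrite distrC ger0_norm ?subr_ge0; last first.
  by apply: cumulative_is_nondecreasing; exact: ltW.
have [n hn] : exists n : nat, n.+1%:R^-1 < s - inf S.
  by apply: natSinv_lt; rewrite subr_gt0.
have := (Ss.2 n); rewrite /= => h1 h2.
have : A w (inf S) <= A w (s - n.+1%:R^-1).
  by apply: cumulative_is_nondecreasing; rewrite lerBrDr -lerBrDl ltW.
by rewrite leNgt => /negP; apply; move: h1 h2; lra.
Qed.

Definition first_jump_time (e : R) (w : Omega) : \bar R :=
  ereal_inf [set t%:E | t in [set t | jumps_ge e (t, w)]].

Lemma first_jump_timeP (e : R) w : 0 < e ->
  (first_jump_time e w = +oo%E /\ forall t, ~ jumps_ge e (t, w)) \/
  exists t, [/\ first_jump_time e w = t%:E, jumps_ge e (t, w) &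
     forall s, jumps_ge e (s, w) -> t <= s].
Proof.
move=> e0; have [[t Jt]|h] := pselect (exists t, jumps_ge e (t, w)).
  right; have [t1 Jt1 ht1] := first_jump e0 Jt; exists t1; split => //.
  apply/eqP; rewrite eq_le; apply/andP; split.
    by apply: ereal_inf_lbound; exists t1.
  by apply: le_ereal_inf_tmp => _ [s Js <-]; rewrite lee_fin; exact: ht1.
left; split; last by move=> t Jt; apply: h; exists t.
rewrite /first_jump_time (_ : mkset _ = set0) ?image_set0 ?ereal_inf0//.
by apply/seteqP; split => // t Jt; apply: h; exists t.
Qed.

Lemma first_jump_stopping_time e : 0 < e -> stopping_time F (first_jump_time e).
Proof.
move=> e0; split => [w|t t0].
  by apply: le_ereal_inf_tmp => _ [s [s0 _] <-]; rewrite lee_fin.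
have := optional_projection hF hU t0 measurableT (jumps_ge_optional e).
congr (F t); apply/seteqP; split => w /=.
  move=> [s [/andP[_ st] _ Js]]; apply: (@le_trans _ _ s%:E); last by rewrite lee_fin.
  by apply: ereal_inf_lbound; exists s.
case: (first_jump_timeP w e0) => [[-> _]|[s [-> Js _]]].
  by rewrite leNgt ltry.
by rewrite lee_fin => st; exists s; split => //; rewrite st Js.1.
Qed.

(** The indicator of the set of times after [T] is adapted and cadlag; the
    strict inequality is the union of the same sets for the delayed times
    [T + 1/(n+1)]. *)
Lemma graph_optional (T : Omega -> \bar R) : stopping_time F T ->
  optional_sets F [set z | T z.2 = z.1%:E].
Proof.
move=> [T0 sT].
have graph_time : [set z | T z.2 = z.1%:E] `<=` (time_space : set (R * Omega)).
  by move=> z /= Tz; rewrite /time_space /= -lee_fin -Tz.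
pose U (c t : R) (w : Omega) : R := (T w <= (t - c)%:E)%E%:R.
have oU c : 0 <= c -> optional F (U c).
  move=> c0; apply: adapted_cadlag_optional => [t t0|w].
    have mS : measurable ([set w | T w <= (t - c)%:E]%E :
        set (g_sigma_algebraType (F t))).
      rewrite -filtrationE//; have [tc|tc] := leP 0 (t - c).
        by apply: (filtration_mono hF tc); [rewrite gerBl|exact: sT].
      rewrite (_ : mkset _ = set0).
        by rewrite (filtrationE hF _ t0); exact: measurable0.
      apply/seteqP; split => // w /= /(le_trans (T0 w)).
      by rewrite lee_fin leNgt tc.
    rewrite /measurable_wrt (_ : U c t = \1_[set w | T w <= (t - c)%:E]%E).
      exact: measurable_indic.
    apply/funext => w; rewrite /U indicE; congr (_%:R).
    by case: (boolP (T w <= _)%E) => h; [rewrite mem_set|rewrite memNset//; exact/negP].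
  have [Tfin|Tfin] := boolP (T w \is a fin_num).
    rewrite (_ : U c ^~ w = fun s => (fine (T w) + c <= s)%R%:R * 1).
      exact: cadlag_step.
    apply/funext => s; rewrite /U mulr1 -[in LHS](fineK Tfin) lee_fin.
    by rewrite lerBrDr.
  rewrite (_ : U c ^~ w = fun s => (0 <= s)%R%:R * 0); first exact: cadlag_step.
  apply/funext => s; rewrite /U mulr0.
  have -> : T w = +oo%E.
    by move: Tfin; rewrite ge0_fin_numE// -leNgt leye_eq => /eqP.
  by rewrite leNgt ltry.
rewrite optional_setsE//.
pose V c : set (g_sigma_algebraType (optional_system F)) :=
  [set z | T z.2 <= (z.1 - c)%:E]%E.
have mV c : 0 <= c -> measurable (V c).
  move=> c0; have /optionalP mU := oU c c0.
  have := mU measurableT _ (measurable_set1 1); rewrite setTI.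
  congr measurable; apply/seteqP; split => z; rewrite /V /U /=.
    by case: (_ <= _)%E => // /esym/eqP; rewrite oner_eq0.
  by move=> ->.
rewrite (_ : [set z | _] = V 0 `\` \bigcup_n V n.+1%:R^-1).
  apply: measurableD; first exact: mV.
  by apply: bigcupT_measurable => n; apply: mV; rewrite invr_ge0.
apply/seteqP; split => [z /= Tz|z [V0 nV]] /=.
  split; first by rewrite /V /= subr0 Tz.
  move=> [n _]; rewrite /V /= Tz lee_fin leNgt => /negP; apply.
  by rewrite gtrBl invr_gt0.
move: V0; rewrite /V /= subr0 le_eqVlt => /predU1P[//|Tz].
have Tfin : T z.2 \is a fin_num.
  by rewrite ge0_fin_numE// (lt_trans Tz)// ltry.
move: Tz; rewrite -(fineK Tfin) lte_fin => Tz.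
have [n hn] : exists n : nat, n.+1%:R^-1 < z.1 - fine (T z.2).
  by apply: natSinv_lt; rewrite subr_gt0.
exfalso; apply: nV; exists n => //; rewrite /V /= -(fineK Tfin) lee_fin.
by rewrite lerBrDr -lerBrDl ltW.
Qed.

Variable L : Omega -> \bar R.
Hypotheses (mL : measurable_fun setT L) (L0 : forall w, (0 <= L w)%E).
Hypothesis hLoo : P [set w | L w = +oo%E] = 0%E.
Hypothesis hA : avoids_stopping_times P F L.
Hypothesis hAL : dual_optional_projection P F L A.

(** The mass that [A] puts on the graph of the first jump of size at least [e]
    is the probability that [L] is that stopping time, namely 0; but this mass
    is at least [e] wherever the jump exists. *)
Lemma dual_projection_no_jump e : 0 < e ->
  {ae P, forall w, forall t, ~ jumps_ge e (t, w)}.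
Proof.
move=> e0; pose T := first_jump_time e.
have sT : stopping_time F T by exact: first_jump_stopping_time.
have oG := graph_optional sT.
have mTL : measurable [set w | T w = (fine (L w))%:E].
  have mp : measurable_fun setT (fun w => (fine (L w), w) : R * Omega).
    apply: measurable_fun_pair => //.
    by apply: measurableT_comp => //; exact: mL.
  by have := mp measurableT _ (optional_sets_measurable hF oG); rewrite setTI.
have mLoo : measurable [set w | L w = +oo%E].
  by have := mL measurableT (emeasurable_set1 +oo%E); rewrite setTI.
have Lfin w : L w <> +oo%E -> L w = (fine (L w))%:E.
  by move=> Loo; rewrite fineK// ge0_fin_numE// ltey; apply/eqP.
have nLT : P.-negligible [set w | T w = (fine (L w))%:E].
  have : P.-negligible [set w | L w = T w].
    exists ([set w | L w = T w]); split => //; last exact: hA.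
    (* This description, which separates the case [L w = +oo], shows that the event
       is measurable. *)
    have -> : [set w | L w = T w] =
        ([set w | T w = (fine (L w))%:E] `\` [set w | L w = +oo%E]) `|`
        ([set w | L w = +oo%E] `\` \bigcup_(n : nat) [set w | T w <= n%:R%:E]%E).
      apply/seteqP; split => w /=.
        move=> LT; have [Loo|Loo] := pselect (L w = +oo%E).
          right; split => // -[n _] /=; rewrite -LT Loo.
          by rewrite leNgt ltry.
        by left; split => //; rewrite -LT -Lfin.
      move=> [[-> /Lfin //]|[Loo h]]; rewrite Loo; apply/esym/eqP.
      rewrite -leye_eq leNgt; apply/negP => Ty; apply: h.
      have T0 : (0 <= T w)%E by case: sT.
      have Tfin : T w \is a fin_num by rewrite ge0_fin_numE.
      exists (Num.truncn (fine (T w))).+1 => //=.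
      by rewrite -(fineK Tfin) lee_fin ltW// truncnS_gt.
    apply: measurableU; first exact: measurableD.
    apply: measurableD => //; apply: bigcupT_measurable => n.
    by apply: (filtration_sub hF (ler0n _ n)); case: sT => _; exact.
  have : P.-negligible [set w | L w = +oo%E].
    by exists [set w | L w = +oo%E]; split.
  move=> h1 h2; apply: negligibleS (negligibleU h1 h2) => w /= TL.
  have [Loo|/Lfin Loo] := pselect (L w = +oo%E); first by left.
  by right; rewrite /= TL.
have PG : P [set w | [set z | T z.2 = z.1%:E] (fine (L w), w)] = 0%E.
  exact/negligibleP.
have := dual_projection_null hF mL L0 hAL oG PG.
apply: filterS => w /= h t Jt.
have [[_ /(_ t)//]|[s [Ts Js _]]] := first_jump_timeP w e0.
have := stieltjes_measure_atom_ge Js.2; rewrite /= => he.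
have : (lebesgue_stieltjes_measure (A w) [set s] = 0)%E.
  rewrite -h; congr lebesgue_stieltjes_measure; apply/seteqP.
  by split => r /=; rewrite /T Ts; [move=> ->|move=> []].
by move=> s0; move: he; rewrite s0 lee_fin leNgt e0.
Qed.

Lemma dual_projection_left_continuous :
  {ae P, forall w, forall t e, 0 <= t -> 0 < e ->
     exists n : nat, A w t - A w (t - n.+1%:R^-1) < e}.
Proof.
have h (n : nat) : {ae P, forall w, forall t, ~ jumps_ge n.+1%:R^-1 (t, w)}.
  by apply: dual_projection_no_jump; rewrite invr_gt0.
apply: filterS (ae_foralln h) => w hw t e t0 e0.
have [n hn] := natSinv_lt e0.
apply: contrapT => /forallNP nE; apply: (hw n t); split => // m /=.
apply: le_trans (ltW hn) _; rewrite leNgt; apply/negP; exact: nE.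
Qed.

End jumps.

(** * Bounded multipliers and Riemann sums *)

Lemma cvg_integral_dominated {d} {T : measurableType d} {R : realType}
    (mu : {measure set T -> \bar R}) (D : set T)
    (g : nat -> T -> R) (f b : T -> R) :
  measurable D -> (forall n, measurable_fun D (g n)) -> measurable_fun D f ->
  {ae mu, forall x, D x -> g n x @[n --> \oo] --> f x} ->
  mu.-integrable D (EFin \o b) ->
  {ae mu, forall x n, D x -> `|g n x| <= b x} ->
  (\int[mu]_(x in D) (g n x)%:E @[n --> \oo] --> \int[mu]_(x in D) (f x)%:E)%E.
Proof.
move=> mD mg mf gf ib gb.
have [] // := @dominated_convergence _ _ _ mu D mD
  (fun n x => (g n x)%:E) (EFin \o f) (EFin \o b).
- by move=> n; exact/measurable_EFinP.
- exact/measurable_EFinP.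
- apply: filterS gf => x gf Dx; apply/cvg_EFin; first exact: nearW.
  exact: gf.
Qed.

Section conditional_expectation.
Context {d : measure_display} {Omega : measurableType d} {R : realType}.
Variable P : probability Omega R.

Lemma integrable_bounded_mul (xi Z : Omega -> R) (K : R) :
  measurable_fun setT xi -> (forall w, `|xi w| <= K) ->
  P.-integrable setT (EFin \o Z) ->
  P.-integrable setT (fun w => (xi w * Z w)%:E).
Proof.
move=> mxi bxi iZ.
have mZ : measurable_fun setT Z by apply/measurable_EFinP; case/integrableP : iZ.
apply: (le_integrable measurableT _ _ (integrableZl measurableT K iZ)).
  by apply/measurable_EFinP; exact: measurable_funM.
move=> w _; have K0 : 0 <= K by apply: le_trans (bxi w).
by rewrite -EFinM /= lee_fin !normrM ler_wpM2r// (ger0_norm K0).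
Qed.

Lemma integrable_ae_eq (f g : Omega -> R) : measurable_fun setT f ->
  {ae P, forall w, f w = g w} -> P.-integrable setT (EFin \o g) ->
  P.-integrable setT (EFin \o f).
Proof.
move=> mf fg ig; have mg : measurable_fun setT (EFin \o g).
  by case/integrableP : ig.
apply/integrableP; split; first exact/measurable_EFinP.
case/integrableP : ig => _; congr (_ < _)%E; apply: ae_eq_integral => //.
- exact: measurableT_comp.
- by apply: measurableT_comp => //; exact/measurable_EFinP.
- by apply: filterS fg => w h _; rewrite /= h.
Qed.

Variable G : set (set Omega).
Hypotheses (sG : sigma_algebra setT G) (mG : G `<=` measurable).

Lemma measurable_wrt_sub (X : Omega -> R) :
  measurable_wrt G X -> measurable_fun setT X.
Proof.
move=> mX _ B mB; rewrite setTI; apply: mG.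
have : (measurable (X @^-1` B : set (g_sigma_algebraType G))).
  by rewrite -[X in measurable X]setTI; exact: mX.
by rewrite -(sigma_measurableE sG).
Qed.

(** Rounding [xi] down to a grid gives finite combinations of indicators of sets
    of [G] that converge uniformly to [xi]. *)
Lemma integral_mul_eq0 (W xi : Omega -> R) (K : R) :
  P.-integrable setT (EFin \o W) ->
  (forall B, G B -> (\int[P]_(w in B) (W w)%:E = 0)%E) ->
  measurable_wrt G xi -> (forall w, 0 <= xi w <= K) ->
  (\int[P]_w (xi w * W w)%:E = 0)%E.
Proof.
move=> iW W0 mxi bxi.
have mxi' := measurable_wrt_sub mxi.
have mW : measurable_fun setT W by apply/measurable_EFinP; case/integrableP : iW.
pose B n k := [set w | Num.truncn (n.+1%:R * xi w) = k].
have GB n k : G (B n k).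
  rewrite (sigma_measurableE sG).
  have mn : measurable_fun [set: g_sigma_algebraType G]
      (fun w : g_sigma_algebraType G => n.+1%:R * xi w).
    by apply: measurable_funM => //; exact: mxi.
  by have := mn measurableT _ (measurable_truncn_preimage k); rewrite setTI.
have mB n k : measurable (B n k) by exact: mG.
pose g n w := grid_down n (xi w).
have gE n w : g n w * W w = \sum_(k < (Num.truncn (n.+1%:R * K)).+1)
    (k%:R / n.+1%:R) * (\1_(B n k) w * W w).
  have kN : (Num.truncn (n.+1%:R * xi w) < (Num.truncn (n.+1%:R * K)).+1)%N.
    rewrite ltnS; apply: le_truncn; rewrite ler_wpM2l//.
    by case/andP: (bxi w).
  rewrite (bigD1 (Ordinal kN))//= indicE mem_set// mul1r big1 ?addr0//.
  move=> k kN'; rewrite indicE memNset ?mul0r ?mulr0// => Bk.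
  by move/negP: kN'; apply; apply/eqP/val_inj; rewrite /= Bk.
have iB n k : P.-integrable setT (fun w => (\1_(B n k) w * W w)%:E).
  apply: (@integrable_bounded_mul _ _ 1) => // w.
  by rewrite indicE; case: (_ \in _); rewrite ?normr1 ?normr0.
have g0 n : (\int[P]_w (g n w * W w)%:E = 0)%E.
  under eq_integral do rewrite gE -sumEFin.
  rewrite integral_sum//; last first.
    move=> k; under eq_fun do rewrite EFinM.
    exact: integrableZl.
  rewrite big1// => k _; under eq_integral do rewrite EFinM.
  rewrite integralZl// (_ : \int[P]_w _ = 0)%E ?mule0//.
  rewrite -[RHS](W0 _ (GB n k)) [RHS]integral_mkcond.
  apply: eq_integral => w _; rewrite patchE indicE.
  by case: ifPn; rewrite ?mul1r ?mul0r.
have bg n w : 0 <= g n w <= K.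
  have /andP[x0 xK] := bxi w.
  have /andP[_ gx] := grid_down_bounds n x0.
  by rewrite (le_trans gx xK) andbT /g /grid_down divr_ge0.
have mg n : measurable_fun setT (g n).
  apply: measurable_funM => //.
  apply: (@measurable_fun_nat_index _ _ Omega R
    (fun w => Num.truncn (n.+1%:R * xi w)) (fun k _ => k%:R)) => // k.
  exact: mB.
have : (\int[P]_w (g n w * W w)%:E @[n --> \oo] -->
    \int[P]_w (xi w * W w)%:E)%E; last first.
  under eq_fun do rewrite g0.
  by move=> h; rewrite -(cvg_lim _ h)// lim_cst.
apply: (@cvg_integral_dominated _ _ _ P _ _ _ (fun w => K * `|W w|)) => //.
- by move=> n; exact: measurable_funM.
- exact: measurable_funM.
- apply: aeW => w _; apply: cvgM; last exact: cvg_cst.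
  have /andP[x0 xK] := bxi w; apply: cvg_of_natSinv_bound => n.
  have /andP[h1 h2] := grid_down_bounds n x0.
  by rewrite ger0_norm ?subr_ge0// lerBlDl -lerBlDr.
- rewrite (_ : EFin \o _ = fun w => K%:E * (`|W w|)%:E)%E; last first.
    by apply/funext => w; rewrite /= EFinM.
  by apply: integrableZl => //; exact: integrable_norm.
- apply: aeW => w n _; rewrite normrM ler_wpM2r//.
  by have /andP[? ?] := bg n w; rewrite ger0_norm.
Qed.

(** Adding a constant to [xi] makes it nonnegative, and [integral_mul_eq0]
    applies to [Y - X]. *)
Lemma cond_exp_mul_bounded (X Y xi : Omega -> R) (K : R) :
  cond_exp P G X Y -> measurable_wrt G xi -> (forall w, `|xi w| <= K) ->
  (\int[P]_w (xi w * Y w)%:E = \int[P]_w (xi w * X w)%:E)%E.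
Proof.
move=> [iX mY iY XY] mxi bxi.
have mxi' := measurable_wrt_sub mxi.
pose W w := Y w - X w.
have iW : P.-integrable setT (EFin \o W).
  rewrite (_ : EFin \o W = (EFin \o Y) \- (EFin \o X))%E//.
  exact: integrableB.
have W0 B : G B -> (\int[P]_(w in B) (W w)%:E = 0)%E.
  move=> GB; have mB := mG GB.
  under eq_integral do rewrite EFinB.
  rewrite integralB//; [|exact: integrableS iY|exact: integrableS iX].
  rewrite XY ?subee//; last first.
    by rewrite -[X in X B](sigma_algebra_id sG) in GB.
  by apply: integrable_fin_num => //; exact: integrableS iX.
pose xi' w := xi w + K.
have bxi' w : 0 <= xi' w <= K + K.
  by have := bxi w; rewrite ler_norml /xi' lerD2r => /andP[h1 ->]; rewrite -lerBlDr sub0r h1.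
have mxi1 : measurable_wrt G xi' by apply: measurable_funD => //; exact: measurable_cst.
have := integral_mul_eq0 iW W0 mxi1 bxi'.
have ixY := integrable_bounded_mul mxi' bxi iY.
have ixX := integrable_bounded_mul mxi' bxi iX.
have ixW : P.-integrable setT (fun w => (xi w * W w)%:E).
  exact: (integrable_bounded_mul mxi' bxi iW).
rewrite (_ : (fun w => _) = fun w => (xi w * W w)%:E + K%:E * (W w)%:E)%E; last first.
  by apply/funext => w; rewrite /xi' mulrDl EFinD EFinM.
rewrite integralD//; last exact: integrableZl.
rewrite integralZl// W0 ?mule0 ?adde0; last first.
  by rewrite (sigma_measurableE sG); exact: measurableT.
rewrite (_ : (fun w => _) = fun w => (xi w * Y w)%:E - (xi w * X w)%:E)%E; last first.
  by apply/funext => w; rewrite /W mulrBr EFinB.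
rewrite integralB// => /eqP; rewrite sube_eq ?add0e => [/eqP//||].
  by apply: integrable_fin_num.
by rewrite fin_num_adde_defl// ; exact: integrable_fin_num.
Qed.

End conditional_expectation.

Section riemann_sums.
Context {R : realType}.
Variable f : cumulative R R.
Local Notation mu := (lebesgue_stieltjes_measure f).

Lemma stieltjes_measure_itv_co (a b : R) : a <= b ->
  mu [set a] = 0%E -> mu [set b] = 0%E ->
  mu `[a, b[%classic = (f b - f a)%:E.
Proof.
move=> ab ma mb; rewrite -stieltjes_measure_itv_oc//.
have mI (i : interval R) : measurable ([set` i] : set (measurableTypeR R)).
  exact: measurable_itv.
have m1 (r : R) : measurable ([set r] : set (measurableTypeR R)).
  exact: measurable_set1.
apply/eqP; rewrite eq_le; apply/andP; split.
  apply: (@le_trans _ _ (mu (`]a, b]%classic `|` [set a]))).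
    apply: le_measure; rewrite ?inE; [exact: mI|exact: measurableU|].
    move=> s /=; rewrite !in_itv /= => /andP[as_ sb].
    move: as_; rewrite le_eqVlt => /predU1P[->|as_]; first by right.
    by left; rewrite as_ ltW.
  by rewrite measureU0//; exact: m1.
apply: (@le_trans _ _ (mu (`[a, b[%classic `|` [set b]))).
  apply: le_measure; rewrite ?inE; [exact: mI|exact: measurableU|].
  move=> s /=; rewrite !in_itv /= => /andP[as_ sb].
  move: sb; rewrite le_eqVlt => /predU1P[->|sb]; first by right.
  by left; rewrite sb ltW.
by rewrite measureU0//; exact: m1.
Qed.

Hypothesis mass_fin : (mu `[0%R, +oo[%classic < +oo)%E.
Hypothesis atomless : forall t, 0 <= t -> mu [set t] = 0%E.

Definition riemann_sum (h : R -> R) (n : nat) : R :=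
  \sum_(k < n.+1 * n.+1)
    h (k.+1%:R / n.+1%:R) * (f (k.+1%:R / n.+1%:R) - f (k%:R / n.+1%:R)).

(** The sum of rank [n] is the integral of the step function equal to
    [h (grid_up n s)] for [s < n + 1] and to 0 afterwards, whose steps
    are closed on the left, whereas the increments of [f] are the masses of
    intervals closed on the right; without atoms the masses are the same. *)
Lemma cvg_riemann_sum (h : R -> R) :
  measurable_fun (`[0, +oo[%classic : set R) h ->
  (forall s, 0 <= s -> `|h s| <= 1) ->
  (forall s, 0 <= s -> h r @[r --> s^'+] --> h s) ->
  (riemann_sum h n)%:E @[n --> \oo] --> (\int[mu]_(s in `[0%R, +oo[) (h s)%:E)%E.
Proof.
move=> mh bh rch.
pose D : set (measurableTypeR R) := `[0%R, +oo[%classic.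
have mD : measurable D by exact: measurable_itv.
pose I_ n k : set (measurableTypeR R) :=
  `[k%:R / n.+1%:R, k.+1%:R / n.+1%:R[%classic.
have mI n k : measurable (I_ n k) by exact: measurable_itv.
pose g n (s : measurableTypeR R) : R := \sum_(k < n.+1 * n.+1)
  h (k.+1%:R / n.+1%:R) * \1_(I_ n k) s.
have n0 (n : nat) : 0 < n.+1%:R :> R by [].
have in_I n k s : 0 <= s -> (s \in I_ n k) = (Num.truncn (n.+1%:R * s) == k).
  move=> s0; rewrite truncn_eq ?mulr_ge0//; apply/idP/idP.
    by rewrite inE /I_ /= in_itv /= ler_pdivrMr// ltr_pdivlMr// [s * _]mulrC.
  by rewrite inE /I_ /= in_itv /= ler_pdivrMr// ltr_pdivlMr// [s * _]mulrC.
have gE n s : 0 <= s -> g n s = if s < n.+1%:R then h (grid_up n s) else 0.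
  move=> s0; have ns0 : 0 <= n.+1%:R * s by rewrite mulr_ge0.
  case: ifPn => sn.
    have kN : (Num.truncn (n.+1%:R * s) < n.+1 * n.+1)%N.
      by rewrite truncn_lt_nat// natrM ltr_pM2l.
    rewrite /g (bigD1 (Ordinal kN))//= indicE in_I// eqxx mulr1 big1 ?addr0//.
    move=> k kN'; rewrite indicE in_I//; case: eqP => [kE|]; last by rewrite mulr0.
    by move/negP: kN'; case; apply/eqP/val_inj; rewrite /= kE.
  rewrite /g big1// => k _; rewrite indicE in_I//; case: eqP => [kE|]; last by rewrite mulr0.
  exfalso; have := ltn_ord k; rewrite -kE truncn_lt_nat// natrM ltr_pM2l//.
  by rewrite (negbTE sn).
have mg n : measurable_fun D (g n).
  apply: measurable_sum => k; apply: measurable_funM.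
    exact: measurable_cst.
  exact: measurable_indic.
have iI n k : mu.-integrable D (fun s => (\1_(I_ n k) s)%:E).
  apply/integrableP; split; first by apply/measurable_EFinP; exact: measurable_indic.
  apply: (@le_lt_trans _ _ (\int[mu]_(s in D) (cst 1 s)))%E; last first.
    by rewrite integral_cst// mul1e.
  apply: ge0_le_integral => //.
    by apply: measurableT_comp => //; apply/measurable_EFinP; exact: measurable_indic.
  by move=> s _; rewrite /= lee_fin indicE; case: (_ \in _); rewrite ?normr1 ?normr0.
have gint n : (\int[mu]_(s in D) (g n s)%:E = (riemann_sum h n)%:E)%E.
  rewrite /g; under eq_integral do rewrite -sumEFin.
  rewrite integral_sum//; last first.
    by move=> k; under eq_fun do rewrite EFinM; exact: integrableZl.
  rewrite /riemann_sum -sumEFin; apply: eq_bigr => k _.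
  under eq_integral do rewrite EFinM.
  rewrite integralZl// integral_indic// EFinM; congr (_ * _)%E.
  have k0 j : 0 <= j%:R / n.+1%:R :> R by rewrite divr_ge0.
  rewrite setIidl; last first.
    move=> s; rewrite /I_ /D /= !in_itv /= andbT => /andP[+ _].
    exact: le_trans.
  apply: stieltjes_measure_itv_co; [|exact: atomless..].
  by rewrite ler_pM2r ?invr_gt0// ler_nat.
under eq_fun do rewrite -gint.
apply: (@cvg_integral_dominated _ _ _ mu _ _ _ (cst 1)) => //.
- apply: aeW => s; rewrite /D /= in_itv /= andbT => s0.
  have hs : h (grid_up n s) @[n --> \oo] --> h s.
    apply: cvg_at_right_seq; first exact: rch.
      by move=> n; have /andP[] := grid_up_bounds n s0.
    apply: cvg_of_natSinv_bound => n; have /andP[h1 h2] := grid_up_bounds n s0.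
    by rewrite distrC ger0_norm ?subr_ge0// lerBlDl.
  apply: cvg_trans hs; apply: near_eq_cvg; near=> n.
  rewrite /= gE// ifT//; apply: (lt_le_trans (truncnS_gt s)); rewrite ler_nat ltnS.
  by near: n; exists (Num.truncn s).
- apply/integrableP; split; first by apply/measurable_EFinP; exact: measurable_cst.
  by under eq_integral do rewrite /= normr1; rewrite integral_cst// mul1e.
- apply: aeW => s n; rewrite /D /= in_itv /= andbT => s0; rewrite gE//.
  case: ifP => _; last by rewrite normr0.
  apply: bh; apply: (le_trans s0).
  by have /andP[] := grid_up_bounds n s0.
Unshelve. all: by end_near. Qed.

End riemann_sums.

(** * The part of a conditional expectation due to the past *)

Section integral_process.
Context {R : realType}.
Variables (f : cumulative R R) (g : R -> R).
Local Notation mu := (lebesgue_stieltjes_measure f).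
Hypothesis ig : mu.-integrable `[0%R, +oo[%classic (EFin \o g).

Let D : set (measurableTypeR R) := `[0%R, +oo[%classic.
Let mD : measurable D. Proof. exact: measurable_itv. Qed.

Lemma cvg_integral_sets (E : nat -> set (measurableTypeR R))
    (E' : set (measurableTypeR R)) :
  (forall n, measurable (E n)) -> measurable E' ->
  (forall n, E n `<=` D) -> E' `<=` D ->
  (forall s, 0 <= s -> \forall n \near \oo, E n s <-> E' s) ->
  (\int[mu]_(s in E n) (g s)%:E @[n --> \oo] --> \int[mu]_(s in E') (g s)%:E)%E.
Proof.
move=> mE mE' ED E'D EE'.
have mg : measurable_fun D g by apply/measurable_EFinP; case/integrableP : ig.
have restrictE (B : set (measurableTypeR R)) : B `<=` D ->
    (\int[mu]_(s in B) (g s)%:E = \int[mu]_(s in D) (\1_B s * g s)%:E)%E.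
  move=> BD; rewrite -{1}(setIidr BD) integral_mkcondr.
  apply: eq_integral => s _; rewrite patchE indicE.
  by case: ifPn; rewrite ?mul1r ?mul0r.
under eq_fun do rewrite restrictE//; rewrite restrictE//.
apply: (@cvg_integral_dominated _ _ _ mu _ _ _ (fun s => `|g s|)) => //.
- by move=> n; apply: measurable_funM => //; exact: measurable_indic.
- by apply: measurable_funM => //; exact: measurable_indic.
- apply: aeW => s; rewrite /D /= in_itv /= andbT => s0.
  apply: cvg_near_cst; have := EE' s s0; apply: filterS => n h.
  congr (_ * _); rewrite !indicE; congr (_%:R); congr nat_of_bool.
  by apply/idP/idP; rewrite !inE; apply h.
- exact: integrable_norm.
- apply: aeW => s n _; by rewrite normrM ger0_norm// ler_piMl.
Qed.

Lemma integral_sub_fin_num (E : set (measurableTypeR R)) : measurable E ->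
  E `<=` D -> (\int[mu]_(s in E) (g s)%:E)%E \is a fin_num.
Proof.
by move=> mE ED; apply: integrable_fin_num => //; exact: integrableS ig.
Qed.

Lemma cvg_Rintegral_sets (E : nat -> set (measurableTypeR R))
    (E' : set (measurableTypeR R)) :
  (forall n, measurable (E n)) -> measurable E' ->
  (forall n, E n `<=` D) -> E' `<=` D ->
  (forall s, 0 <= s -> \forall n \near \oo, E n s <-> E' s) ->
  \int[mu]_(s in E n) g s @[n --> \oo] --> \int[mu]_(s in E') g s.
Proof.
move=> mE mE' ED E'D EE'; apply: fine_cvg.
rewrite /Rintegral fineK; last exact: integral_sub_fin_num.
exact: cvg_integral_sets.
Qed.

Let itv0c_D (t : R) : (`[0%R, t]%classic : set (measurableTypeR R)) `<=` D.
Proof. by move=> s; rewrite /D /= !in_itv /= andbT => /andP[]. Qed.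

(** The left limit at [t] is the integral over [[0, t[]. *)
Lemma integral_process_cadlag :
  cadlag (fun t => \int[mu]_(s in `[0%R, t]) g s).
Proof.
split => t t0.
  apply/cvg_at_rightP => u [ut cu].
  apply: cvg_Rintegral_sets => //; try by move=> *; exact: measurable_itv.
  move=> s s0; have [st|ts] := leP s t.
    near=> n; rewrite /= !in_itv /= s0 st /=.
    by split => // _; rewrite (le_trans st)// ltW.
  near=> n; rewrite /= !in_itv /= s0 /= [s <= t]leNgt ts /=.
  split => // sn; suff : u n < s by rewrite ltNge sn.
  by near: n; exact: (cvgr_lt t).
exists (\int[mu]_(s in `[0%R, t[) g s).
apply/cvg_at_leftP => u [ut cu].
apply: cvg_Rintegral_sets => //; try by move=> *; exact: measurable_itv.
  by move=> s; rewrite /D /= !in_itv /= andbT => /andP[].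
move=> s s0; have [ts|st] := leP t s.
  near=> n; rewrite /= !in_itv /= s0 /= [s < t]ltNge ts /=.
  by split => // sn; have := lt_le_trans (ut n) (le_trans ts sn); rewrite ltxx.
near=> n; rewrite /= !in_itv /= s0 st /=; split => // _.
by apply: ltW; near: n; exact: (cvgr_gt t).
Unshelve. all: by end_near. Qed.

End integral_process.

Lemma cadlagD {R : realType} (f g : R -> R) :
  cadlag f -> cadlag g -> cadlag (fun t => f t + g t).
Proof.
move=> [rf lf] [rg lg]; split => t t0; first by apply: cvgD; [exact: rf|exact: rg].
by have [a fa] := lf t t0; have [b gb] := lg t t0; exists (a + b); exact: cvgD.
Qed.

Lemma cadlagN {R : realType} (f : R -> R) : cadlag f -> cadlag (fun t => - f t).
Proof.
move=> [rf lf]; split => t t0; first by apply: cvgN; exact: rf.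
by have [a fa] := lf t t0; exists (- a); exact: cvgN.
Qed.

Section past_part.
Context {d : measure_display} {Omega : measurableType d} {R : realType}.
Variables (P : probability Omega R) (F : R -> set (set Omega)).
Hypotheses (hF : filtration F) (hU : usual_hypotheses P F).
Variable L : Omega -> \bar R.
Hypotheses (mL : measurable_fun setT L) (L0 : forall w, (0 <= L w)%E).
Hypothesis hLoo : P [set w | L w = +oo%E] = 0%E.
Variables (A : Omega -> cumulative R R) (x M N : R -> Omega -> R).
Hypothesis hAL : dual_optional_projection P F L A.
Hypothesis ox : optional F x.
Hypothesis hM : cadlag_cond_exp P F (at_time x L) M.
Hypothesis hN : cadlag_cond_exp P F (total_integral A x) N.
Local Notation mu w := (lebesgue_stieltjes_measure (A w)).

Let good : set Omega :=
  [set w | (mu w).-integrable `[0%R, +oo[%classic (EFin \o x ^~ w)].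

Lemma at_time_integrable : P.-integrable setT (EFin \o at_time x L).
Proof. by have [_ /(_ 0 (lexx _))[]] := hM. Qed.

Lemma ae_path_integrable : {ae P, forall w, good w}.
Proof. by have [] := dual_projection_integrable hF mL L0 hAL ox at_time_integrable. Qed.

Let good_filtration t : 0 <= t -> F t good.
Proof.
move=> t0; have : F t (~` good).
  apply: (negligible_filtration hF hU t0); case: ae_path_integrable => B [mB B0 h].
  by exists B; split.
rewrite !(filtrationE hF _ t0) => /measurableC.
by rewrite setCK.
Qed.

(** A cadlag version of [E[x_L 1_{L <= t} | F_t]].  The indicator removes the
    null set of paths along which [x] is not integrable, so that every path is
    cadlag. *)
Definition past_part (t : R) (w : Omega) : R :=
  \1_good w * (M t w - N t w + integral_upto A x t w).

Lemma past_partE w t : good w ->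
  past_part t w = M t w - future_integral A x N t w.
Proof.
move=> gw; rewrite /past_part indicE mem_set// mul1r /future_integral.
by rewrite opprB addrA addrAC.
Qed.

Lemma past_part_cadlag w : cadlag (past_part ^~ w).
Proof.
have [gw|ngw] := pselect (good w); last first.
  rewrite (_ : past_part ^~ w = fun s => (0 <= s)%R%:R * 0).
    exact: cadlag_step.
  by apply/funext => t; rewrite /past_part indicE memNset// mul0r mulr0.
rewrite (_ : past_part ^~ w = fun t => M t w + - N t w + integral_upto A x t w).
  case: hM => cM _; case: hN => cN _.
  by do 2?[apply: cadlagD] => //; [exact: cadlagN|exact: integral_process_cadlag].
by apply/funext => t; rewrite /past_part indicE mem_set// mul1r.
Qed.

Lemma integral_upto_adapted : adapted F (integral_upto A x).
Proof.
move=> t t0.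
have oxp : optional F (fun t w => Num.max (x t w) 0).
  by apply/optionalP; apply: measurable_maxr => //; exact/optionalP.
have oxn : optional F (fun t w => Num.max (- x t w) 0).
  apply/optionalP; apply: measurable_maxr => //.
  by apply: measurable_funN; exact/optionalP.
have m0 (a : R) : 0 <= Num.max a 0 by rewrite le_max lexx orbT.
have mp := measurable_integral_upto_ge0 hF hAL oxp (fun _ _ _ => m0 _) t0.
have mn := measurable_integral_upto_ge0 hF hAL oxn (fun _ _ _ => m0 _) t0.
rewrite /measurable_wrt (_ : integral_upto A x t = fine \o
  ((fun w => \int[mu w]_(s in `[0%R, t]) (Num.max (x s w) 0)%:E) \-
   (fun w => \int[mu w]_(s in `[0%R, t]) (Num.max (- x s w) 0)%:E))%E).
  by apply: measurableT_comp => //; exact: emeasurable_funB.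
apply/funext => w; rewrite /integral_upto /Rintegral /=; congr fine.
rewrite integralE; congr (_ - _)%E; apply: eq_integral => s _.
  by rewrite funeposE EFin_max.
by rewrite funenegE EFin_max.
Qed.

Lemma cadlag_cond_exp_adapted X Y : cadlag_cond_exp P F X Y -> adapted F Y.
Proof. by move=> [_ h] t t0; case: (h t t0). Qed.

Lemma past_part_adapted : adapted F past_part.
Proof.
move=> t t0; apply: measurable_funM.
  by apply: measurable_indic; rewrite -filtrationE//; exact: good_filtration.
apply: measurable_funD; last exact: integral_upto_adapted.
by apply: measurable_funB;
  [exact: cadlag_cond_exp_adapted hM t t0|exact: cadlag_cond_exp_adapted hN t t0].
Qed.

(** [E[x_L 1_{L > t} | F_t]] is the conditional expectation of the integral of
    [x] against [A] after time [t]; what remains of [M] is the past part. *)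
Lemma past_part_cond_exp t : 0 <= t ->
  cond_exp P (F t) (fun w => at_time x L w * \1_[set w | L w <= t%:E]%E w)
    (past_part t).
Proof.
move=> t0.
have mLt : measurable [set w | (L w <= t%:E)%E].
  by rewrite -[X in measurable X]setTI; exact: emeasurable_fun_infty_c.
have iX := at_time_integrable.
have mX : measurable_fun setT (at_time x L) by exact: (measurable_at_time hF).
have sF := filtration_sigma hF t0.
have iXL : P.-integrable setT
    (EFin \o (fun w => at_time x L w * \1_[set w | (L w <= t%:E)%E] w)).
  apply: (le_integrable measurableT _ _ iX).
    by apply/measurable_EFinP; apply: measurable_funM.
  move=> w _; rewrite /= lee_fin normrM ler_piMr// indicE.
  by case: (_ \in _); rewrite ?normr1 ?normr0.
have mgood : measurable good by apply: (filtration_sub hF t0); exact: good_filtration.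
have [iM mM iMt EM] := hM.2 t t0.
have [itot mN iNt EN] := hN.2 t t0.
pose T w := \1_good w * (total_integral A x w - integral_upto A x t w).
have mtot : measurable_fun setT (total_integral A x).
  by apply/measurable_EFinP; case/integrableP : itot.
have mT : measurable_fun setT T.
  apply: measurable_funM => //; apply: measurable_funB => //.
  exact: (measurable_wrt_fun hF t0 (integral_upto_adapted t0)).
(* The value of [y B] at [L] is [x_L] on [B] and the event [t < L], and its total
   integral is [T] on [B]. *)
pose y B s w := x s w * \1_(`]t, +oo[%classic `*` B) (s, w).
have oy B : F t B -> optional F (y B).
  move=> FB; have oE : optional_sets F (`]t, +oo[%classic `*` B).
    rewrite (_ : _ `*` _ =
        \bigcup_n (`[t + n.+1%:R^-1, +oo[%classic `*` B)).
      apply: sigma_algebra_bigcup => n; have n0 : 0 <= n.+1%:R^-1 :> R by [].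
      apply: optional_rectangle => //; first exact: addr_ge0.
      by apply: (filtration_mono hF t0) => //; rewrite lerDl.
    apply/seteqP; split => [[s w] [/=]|[s w] [n _ [/=]]].
      rewrite in_itv /= andbT => ts Bw.
      have [n hn] : exists n : nat, n.+1%:R^-1 < s - t.
        by apply: natSinv_lt; rewrite subr_gt0.
      by exists n => //; split => //=; rewrite in_itv /= andbT -lerBrDl ltW.
    rewrite in_itv /= andbT => ts Bw; split => //=.
    by rewrite in_itv /= andbT (lt_le_trans _ ts)// ltrDl.
  have := optional_indic oE => /optionalP mE.
  by apply/optionalP; apply: measurable_funM => //; exact/optionalP.
have yL B w : L w <> +oo%E -> at_time (y B) L w =
    at_time x L w * \1_[set w | (t%:E < L w)%E] w * \1_B w.
  move=> Loo; have Lfin : L w = (fine (L w))%:E.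
    by rewrite fineK// ge0_fin_numE// ltey; apply/eqP.
  rewrite /at_time /y -mulrA; congr (_ * _).
  rewrite !indicE -natrM mulnb; congr (nat_of_bool _)%:R.
  rewrite in_setX; congr (_ && _).
  by apply/idP/idP; rewrite !inE /= in_itv /= andbT -lte_fin -Lfin.
have aeL : {ae P, forall w, L w <> +oo%E}.
  exists [set w | L w = +oo%E]; split => //; last by move=> w /= /contrapT.
  by rewrite -[X in measurable X]setTI; exact: (mL measurableT (emeasurable_set1 +oo%E)).
have iyL B : F t B -> P.-integrable setT (EFin \o at_time (y B) L).
  move=> FB; apply: (le_integrable measurableT _ _ iX).
    by apply/measurable_EFinP; apply: (measurable_at_time hF) => //; exact: oy.
  move=> w _; rewrite /= lee_fin /at_time /y normrM ler_piMr// indicE.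
  by case: (_ \in _); rewrite ?normr1 ?normr0.
have Ty B w : good w -> total_integral A (y B) w = \1_B w * T w.
  move=> gw; rewrite /T indicE [in X in _ * (X * _)]indicE (mem_set gw) mul1r.
  have mI (i : interval R) : measurable ([set` i] : set (measurableTypeR R)).
    exact: measurable_itv.
  have -> : total_integral A x w - integral_upto A x t w =
      \int[mu w]_(s in `]t, +oo[) x s w.
    rewrite /total_integral (_ : `[0%R, +oo[%classic =
        `[0%R, t]%classic `|` `]t, +oo[%classic :> set R); last first.
      by rewrite -itv_bndbnd_setU// bnd_simp.
    rewrite Rintegral_setU//; first by rewrite addrC addKr.
      by rewrite -itv_bndbnd_setU// bnd_simp.
    apply/disj_setPLR => s /=; rewrite !in_itv /= andbT => /andP[_ st].
    by rewrite leNgt in st; exact/negP.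
  rewrite /total_integral.
  have [Bw|nBw] := boolP (w \in B); last first.
    rewrite mul0r /Rintegral integral0_eq// => s _.
    by rewrite /y indicE in_setX (negbTE nBw) andbF mulr0.
  rewrite mul1r /Rintegral; congr fine.
  rewrite (_ : `]t, +oo[%classic = `[0%R, +oo[%classic `&` `]t, +oo[%classic :> set R).
    rewrite integral_mkcondr; apply: eq_integral => s _.
    rewrite patchE /y indicE in_setX Bw andbT.
    by case: ifPn => _; rewrite ?mulr1 ?mulr0.
  apply/seteqP; split => s /=; rewrite !in_itv /= !andbT; last by case.
  by move=> ts; split => //; exact: le_trans (ltW ts).
have FT : F t setT by rewrite (filtrationE hF _ t0); exact: measurableT.
have iT : P.-integrable setT (EFin \o T).
  have [_ iy _] := dual_projection_integrable hF mL L0 hAL (oy _ FT) (iyL _ FT).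
  apply: (integrable_ae_eq mT _ iy).
  by apply: filterS ae_path_integrable => w /(Ty setT) ->; rewrite indicT mul1r.
have ET B : F t B -> (\int[P]_(w in B) (T w)%:E =
    \int[P]_(w in B) (at_time x L w * \1_[set w | (t%:E < L w)%E] w)%:E)%E.
  move=> FB; have mB : measurable B by exact: (filtration_sub hF t0).
  have [_ iy E] := dual_projection_integrable hF mL L0 hAL (oy _ FB) (iyL _ FB).
  have indE (f : Omega -> R) :
      (\int[P]_(w in B) (f w)%:E = \int[P]_w (\1_B w * f w)%:E)%E.
    rewrite integral_mkcond; apply: eq_integral => w _.
    by rewrite patchE indicE; case: ifPn; rewrite ?mul1r ?mul0r.
  rewrite !indE; transitivity (\int[P]_w (total_integral A (y B) w)%:E)%E.
    apply: ae_eq_integral => //.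
    - by apply/measurable_EFinP; exact: measurable_funM.
    - by case/integrableP : iy.
    - by apply: filterS ae_path_integrable => w /(Ty B) ->.
  rewrite E; apply: ae_eq_integral => //.
  - by case/integrableP : (iyL _ FB).
  - apply/measurable_EFinP; apply: measurable_funM => //.
    apply: measurable_funM => //; apply: measurable_indic.
    by rewrite -[X in measurable X]setTI; exact: emeasurable_fun_o_infty.
  - by apply: filterS aeL => w /(yL B) -> _; rewrite mulrC.
pose Z w := M t w - N t w + total_integral A x w.
have iZ : P.-integrable setT (EFin \o Z).
  rewrite (_ : EFin \o Z = ((EFin \o M t) \- (EFin \o N t)) \+
    (EFin \o total_integral A x))%E//.
  by apply: integrableD => //; exact: integrableB.
have mpast : measurable_fun setT (past_part t).
  exact: (measurable_wrt_fun hF t0 (past_part_adapted t0)).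
have pastE : {ae P, forall w, past_part t w = Z w - T w}.
  apply: filterS ae_path_integrable => w gw.
  by rewrite /past_part /T /Z indicE mem_set// !mul1r; ring.
have ZTE : EFin \o (fun w => Z w - T w) = ((EFin \o Z) \- (EFin \o T))%E by [].
have iZT : P.-integrable setT (EFin \o (fun w => Z w - T w)).
  by rewrite ZTE; exact: integrableB.
split => //.
- exact: past_part_adapted.
- exact: integrable_ae_eq pastE iZT.
move=> B; rewrite sigma_algebra_id// => FB.
have mB : measurable B by exact: (filtration_sub hF t0).
have iS f : P.-integrable setT (EFin \o f) -> P.-integrable B (EFin \o f).
  exact: integrableS.
transitivity (\int[P]_(w in B) (Z w - T w)%:E)%E.
  apply: ae_eq_integral => //.
  - by apply/measurable_EFinP; exact: measurable_funTS.
  - by case/integrableP : (iS _ iZT).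
  - by apply: filterS pastE => w -> _.
have sFB : <<s F t >> B by rewrite sigma_algebra_id.
under eq_integral do rewrite EFinB.
rewrite integralB//; [|exact: iS..].
under eq_integral do rewrite EFinD EFinB.
rewrite integralD//; [|by apply: integrableB => //; exact: iS|exact: iS].
rewrite integralB//; [|exact: iS..].
rewrite EM// EN// subeK; last by apply: integrable_fin_num => //; exact: iS.
rewrite ET// -integralB//; [|exact: iS|].
  apply: eq_integral => w _; rewrite -EFinB !indicE; congr EFin.
  have mE (b : Omega -> bool) : (w \in [set v | b v]) = b w.
    by apply/idP/idP; rewrite inE.
  rewrite (mE (fun v => (L v <= t%:E)%E)) (mE (fun v => (t%:E < L v)%E)).
  by case: leP => _; rewrite ?mulr1 ?mulr0 ?subr0 ?subrr.
apply: (le_integrable mB _ _ (iS _ iX)).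
  apply/measurable_EFinP; apply: measurable_funTS; apply: measurable_funM => //.
  apply: measurable_indic.
  by rewrite -[X in measurable X]setTI; exact: emeasurable_fun_o_infty.
move=> w _; rewrite /= lee_fin normrM ler_piMr// indicE.
by case: (_ \in _); rewrite ?normr1 ?normr0.
Qed.

End past_part.

(** * The past part vanishes at the end of an optional set *)

Lemma expR_increment {R : realType} (a b : R) :
  expR (- b) * (b - a) <= expR (- a) - expR (- b).
Proof.
have -> : expR (- a) = expR (- b) * expR (b - a).
  by rewrite -expRD; congr expR; ring.
rewrite -[X in _ <= _ - X]mulr1 -mulrBr ler_wpM2l ?expR_ge0//.
by rewrite lerBrDl expR_ge1Dx.
Qed.

Lemma sum_telescope {R : realType} (a : nat -> R) (n : nat) :
  \sum_(k < n) (a k.+1 - a k) = a n - a 0%N.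
Proof.
by rewrite -(telescope_sumr a (leq0n n)) big_mkord.
Qed.

Section damp.
Context {R : realType}.

(** A bounded odd function with [y * damp y > 0] for [y != 0]. *)
Definition damp (y : R) : R := y / (1 + y ^+ 2).

Let den_gt0 (y : R) : 0 < 1 + y ^+ 2.
Proof. by rewrite ltr_pwDl// sqr_ge0. Qed.

Lemma damp_continuous : continuous damp.
Proof.
move=> y; apply: cvgM; first exact: cvg_id.
apply: cvgV; first by rewrite gt_eqF.
apply: cvgD; first exact: cvg_cst.
by rewrite expr2; under eq_fun do rewrite expr2; apply: cvgM; exact: cvg_id.
Qed.

Lemma norm_damp_le1 y : `|damp y| <= 1.
Proof.
rewrite /damp normrM normfV (gtr0_norm (den_gt0 y)) ler_pdivrMr// mul1r.
have := sqr_ge0 (`|y| - 1); rewrite sqrrB mulr1 expr1n real_normK ?num_real//.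
have := normr_ge0 y; set u := `|y|; set v := y ^+ 2; lra.
Qed.

Lemma mul_damp_bounds y : 0 <= y * damp y <= 1.
Proof.
rewrite /damp mulrA -expr2; apply/andP; split.
  by rewrite divr_ge0 ?sqr_ge0// ltW.
by rewrite ler_pdivrMr// mul1r lerDr.
Qed.

Lemma mul_damp_eq0 y : y * damp y = 0 -> y = 0.
Proof.
rewrite /damp mulrA -expr2 => /eqP; rewrite mulf_eq0 invr_eq0 (gt_eqF (den_gt0 y)).
by rewrite orbF sqrf_eq0 => /eqP.
Qed.

End damp.

Section past_part_at_end.
Context {d : measure_display} {Omega : measurableType d} {R : realType}.
Variables (P : probability Omega R) (F : R -> set (set Omega)).
Hypotheses (hF : filtration F) (hU : usual_hypotheses P F).
Variable L : Omega -> \bar R.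
Hypotheses (mL : measurable_fun setT L) (L0 : forall w, (0 <= L w)%E).
Hypothesis hLoo : P [set w | L w = +oo%E] = 0%E.
Variables (A : Omega -> cumulative R R) (x M N : R -> Omega -> R).
Hypothesis hAL : dual_optional_projection P F L A.
Hypothesis ox : optional F x.
Hypothesis hM : cadlag_cond_exp P F (at_time x L) M.
Hypothesis hN : cadlag_cond_exp P F (total_integral A x) N.
Local Notation mu w := (lebesgue_stieltjes_measure (A w)).
Hypothesis no_mass_after :
  {ae P, forall w, mu w `]fine (L w), +oo[%classic = 0%E}.
Hypothesis left_cont : {ae P, forall w, forall t e, 0 <= t -> 0 < e ->
  exists n : nat, A w t - A w (t - n.+1%:R^-1) < e}.

Let Y := past_part A x M N.
Let psi (t : R) (w : Omega) : R := expR (- A w t).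
Let f (t : R) (w : Omega) : R := Y t w * damp (Y t w) * psi t w.

Let A_ge0 t w : 0 <= A w t.
Proof.
rewrite -(dual_projection_neg hAL w (ltrN10 R)).
have [t0|t0] := leP (-1) t; first exact: cumulative_is_nondecreasing.
by rewrite !(dual_projection_neg hAL)// (lt_trans t0).
Qed.

Let psi_bounds t w : 0 <= psi t w <= 1.
Proof. by rewrite /psi expR_ge0 -expR0 ler_expR oppr_le0 A_ge0. Qed.

Let f_bounds t w : 0 <= f t w <= 1.
Proof.
have /andP[h1 h2] := mul_damp_bounds (Y t w).
have /andP[h3 h4] := psi_bounds t w.
by rewrite /f mulr_ge0//= -[leRHS]mulr1 ler_pM.
Qed.

Let f_rc w s : 0 <= s -> f r w @[r --> s^'+] --> f s w.
Proof.
move=> s0.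
have rY : Y r w @[r --> s^'+] --> Y s w.
  by have [+ _] := past_part_cadlag hM hN w; exact.
have rA : A w r @[r --> s^'+] --> A w s.
  exact: cumulative_is_right_continuous.
apply: cvgM; last first.
  by apply: (cvg_comp _ _ (cvgN rA)); exact: continuous_expR.
apply: cvgM => //.
by apply: (cvg_comp _ _ rY); exact: damp_continuous.
Qed.

Let A_optional : optional F (fun t w => A w t).
Proof.
apply: adapted_cadlag_optional; first exact: (dual_projection_adapted hAL).
move=> w; have := cumulative_cadlag_shift (A w) 0.
by under eq_fun do rewrite subr0.
Qed.

Let Y_optional : optional F Y.
Proof.
apply: adapted_cadlag_optional.
  exact: (past_part_adapted hF hU mL L0 hAL ox hM hN).
exact: (past_part_cadlag hM hN).
Qed.

Let f_optional : optional F f.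
Proof.
have /optionalP mY := Y_optional; have /optionalP mA := A_optional.
apply/optionalP; apply: measurable_funM.
  apply: measurable_funM => //; apply: (measurableT_comp _ mY).
  exact: continuous_measurable_fun damp_continuous.
apply: (measurableT_comp (@measurable_expR R)).
exact: measurable_funN.
Qed.

Let grid (n k : nat) : R := k%:R / n.+1%:R.

Let xi (n k : nat) (w : Omega) : R :=
  damp (Y (grid n k.+1) w) * psi (grid n k.+1) w *
  (A w (grid n k.+1) - A w (grid n k)).

Let grid_ge0 n k : 0 <= grid n k. Proof. by rewrite divr_ge0. Qed.

Let grid_le n k : grid n k <= grid n k.+1.
Proof. by rewrite ler_pM2r ?invr_gt0// ler_nat. Qed.

Let gridS n k : grid n k.+1 - n.+1%:R^-1 = grid n k.
Proof. by rewrite /grid -natr1 mulrDl mul1r addrK. Qed.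

Let xi_le_psi n k w : `|xi n k w| <= psi (grid n k) w - psi (grid n k.+1) w.
Proof.
have /andP[h3 h4] := psi_bounds (grid n k.+1) w.
apply: le_trans (expR_increment _ _).
have dA : 0 <= A w (grid n k.+1) - A w (grid n k).
  by rewrite subr_ge0 cumulative_is_nondecreasing.
rewrite /xi -mulrA normrM [X in _ * X]ger0_norm ?mulr_ge0//.
by rewrite ler_piMl ?norm_damp_le1// mulr_ge0.
Qed.

Let xi_le_A n k w : `|xi n k w| <= A w (grid n k.+1) - A w (grid n k).
Proof.
have /andP[h3 h4] := psi_bounds (grid n k.+1) w.
have dA : 0 <= A w (grid n k.+1) - A w (grid n k).
  by rewrite subr_ge0 cumulative_is_nondecreasing.
rewrite /xi normrM (ger0_norm dA) ler_piMl// normrM (ger0_norm h3).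
by rewrite -[leRHS]mulr1 ler_pM// norm_damp_le1.
Qed.

Let xi_le1 n k w : `|xi n k w| <= 1.
Proof.
apply: (le_trans (xi_le_psi _ _ _)).
have /andP[h1 h2] := psi_bounds (grid n k) w.
have /andP[h3 h4] := psi_bounds (grid n k.+1) w.
lra.
Qed.

Let sum_xi_le1 n w : \sum_(k < n.+1 * n.+1) `|xi n k w| <= 1.
Proof.
apply: (@le_trans _ _ (\sum_(k < n.+1 * n.+1)
    (psi (grid n k) w - psi (grid n k.+1) w))).
  by apply: ler_sum => k _; exact: xi_le_psi.
rewrite (eq_bigr (fun k : 'I_(n.+1 * n.+1) =>
  (- psi (grid n k.+1) w) - (- psi (grid n k) w))); last first.
  by move=> k _; rewrite opprK addrC.
rewrite (sum_telescope (fun k => - psi (grid n k) w)) opprK addrC.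
have /andP[h1 h2] := psi_bounds (grid n 0) w.
have /andP[h3 h4] := psi_bounds (grid n (n.+1 * n.+1)) w.
lra.
Qed.

Let xi_measurable n k : measurable_wrt (F (grid n k.+1)) (xi n k).
Proof.
have g0 := grid_ge0 n k.+1.
have mY : measurable_wrt (F (grid n k.+1)) (Y (grid n k.+1)).
  exact: (past_part_adapted hF hU mL L0 hAL ox hM hN).
have mA s : s <= grid n k.+1 -> measurable_wrt (F (grid n k.+1)) (fun w => A w s).
  apply: (adapted_stieltjes_measurable hF).
    exact: (dual_projection_neg hAL).
  exact: (dual_projection_adapted hAL).
apply: measurable_funM; last by apply: measurable_funB; exact: mA.
apply: measurable_funM.
  apply: (measurableT_comp _ mY).
  exact: continuous_measurable_fun damp_continuous.
apply: (measurableT_comp (@measurable_expR R)).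
by apply: measurable_funN; exact: mA.
Qed.

Let before n k w : R := \1_[set w | (L w <= (grid n k.+1)%:E)%E] w.

Let S_ n w : R := \sum_(k < n.+1 * n.+1) xi n k w * before n k w.

Let before_bounds n k w : 0 <= before n k w <= 1.
Proof. by rewrite /before indicE; case: (_ \in _); rewrite ?lexx ?ler01. Qed.

Let S_le1 n w : `|S_ n w| <= 1.
Proof.
apply: (le_trans (ler_norm_sum _ _ _)); apply: le_trans (sum_xi_le1 n w).
apply: ler_sum => k _; rewrite normrM ler_piMr//.
by have /andP[? ?] := before_bounds n k w; rewrite ger0_norm.
Qed.

(** Only the grid intervals that lie after [L], or contain it, contribute. *)
Let S_le n w l : L w = l%:E -> (forall t, A w t <= A w l) ->
  `|S_ n w| <= A w l - A w (l - n.+1%:R^-1).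
Proof.
move=> Ll Al.
(* Grid points are moved up to [l - 1/(n+1)]: the increments stay nonnegative,
   those over the intervals that do not end before [l] do not change, and their
   sum telescopes. *)
pose a k := A w (Num.max (grid n k) (l - n.+1%:R^-1)).
apply: (le_trans (ler_norm_sum _ _ _)).
apply: (@le_trans _ _ (\sum_(k < n.+1 * n.+1) (a k.+1 - a k))).
  apply: ler_sum => k _; rewrite normrM /before indicE.
  have [lk|kl] := leP l (grid n k.+1).
    have kE j : grid n k <= grid n j -> a j = A w (grid n j).
      move=> kj; rewrite /a max_l//; apply: le_trans kj.
      by rewrite -gridS lerD2r.
    rewrite (kE k.+1 (grid_le n k)) (kE k (lexx _)).
    apply: le_trans (xi_le_A _ _ _); rewrite ler_piMr//.
    by case: (_ \in _); rewrite ?normr1 ?normr0.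
  rewrite memNset ?normr0 ?mulr0; last first.
    by rewrite /= Ll lee_fin => /(lt_le_trans kl); rewrite ltxx.
  rewrite subr_ge0; apply: cumulative_is_nondecreasing.
  by rewrite ge_max !le_max grid_le lexx orbT.
rewrite sum_telescope lerB//; first exact: Al.
by apply: cumulative_is_nondecreasing; rewrite le_max lexx orbT.
Qed.

Let riemannE n w : riemann_sum (A w) (f ^~ w) n =
  \sum_(k < n.+1 * n.+1) xi n k w * Y (grid n k.+1) w.
Proof.
apply: eq_bigr => k _; rewrite /f /xi -/(grid n k.+1) -/(grid n k).
by ring.
Qed.

Let riemann_le1 n w : `|riemann_sum (A w) (f ^~ w) n| <= 1.
Proof.
apply: (le_trans (ler_norm_sum _ _ _)).
apply: (@le_trans _ _ (\sum_(k < n.+1 * n.+1)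
    (psi (grid n k) w - psi (grid n k.+1) w))).
  apply: ler_sum => k _; rewrite -/(grid n k.+1) -/(grid n k).
  apply: le_trans (expR_increment _ _).
  have /andP[h1 h2] := mul_damp_bounds (Y (grid n k.+1) w).
  have /andP[h3 h4] := psi_bounds (grid n k.+1) w.
  have dA : 0 <= A w (grid n k.+1) - A w (grid n k).
    by rewrite subr_ge0 cumulative_is_nondecreasing.
  rewrite normrM (ger0_norm dA) ler_wpM2r// /f normrM (ger0_norm h1) (ger0_norm h3).
  by rewrite ler_piMl.
rewrite (eq_bigr (fun k : 'I_(n.+1 * n.+1) =>
  (- psi (grid n k.+1) w) - (- psi (grid n k) w))); last first.
  by move=> k _; rewrite opprK addrC.
rewrite (sum_telescope (fun k => - psi (grid n k) w)) opprK addrC.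
have /andP[h1 h2] := psi_bounds (grid n 0) w.
have /andP[h3 h4] := psi_bounds (grid n (n.+1 * n.+1)) w.
lra.
Qed.

Let mxi n k : measurable_fun setT (xi n k).
Proof. exact: (measurable_wrt_fun hF (grid_ge0 n k.+1)). Qed.

Let mX : measurable_fun setT (at_time x L).
Proof. exact: (measurable_at_time hF). Qed.

Let iX : P.-integrable setT (EFin \o at_time x L).
Proof. exact: (at_time_integrable hM). Qed.

Let past n k := past_part_cond_exp hF hU mL L0 hLoo hAL ox hM hN (grid_ge0 n k.+1).

Let mbefore n k : measurable_fun setT (before n k).
Proof.
apply: measurable_indic.
by rewrite -[X in measurable X]setTI; exact: emeasurable_fun_infty_c.
Qed.

Let mS n : measurable_fun setT (S_ n).
Proof. by apply: measurable_sum => k; exact: measurable_funM. Qed.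

Let integral_riemann n :
  (\int[P]_w (riemann_sum (A w) (f ^~ w) n)%:E =
   \int[P]_w (at_time x L w * S_ n w)%:E)%E.
Proof.
have mF k := filtration_sub hF (grid_ge0 n k.+1).
have sF k := filtration_sigma hF (grid_ge0 n k.+1).
under eq_integral do rewrite riemannE -sumEFin.
rewrite integral_sum//; last first.
  move=> k; have [_ _ iY _] := past n k.
  exact: (integrable_bounded_mul (mxi n k) (xi_le1 n k)).
under [RHS]eq_integral do rewrite /S_ mulr_sumr -sumEFin.
rewrite integral_sum//; last first.
  move=> k; under eq_fun do rewrite mulrC -mulrA [_ * at_time _ _ _]mulrC.
  have [iXk _ _ _] := past n k.
  exact: (integrable_bounded_mul (mxi n k) (xi_le1 n k)).
apply: eq_bigr => k _.
rewrite (cond_exp_mul_bounded (sF k) (mF k) (past n k)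
  (@xi_measurable n k) (xi_le1 n k)).
by apply: eq_integral => w _; rewrite mulrCA.
Qed.

(** Along a fine grid, the average of [f] against [dA] equals the average of
    [x_L] against weights that only see times after [L], where [A] no longer
    increases. *)
Lemma past_part_at_end : {ae P, forall w, at_time Y L w = 0}.
Proof.
have aeL : {ae P, forall w, L w = (fine (L w))%:E}.
  exists [set w | L w = +oo%E]; split => //.
    by rewrite -[X in measurable X]setTI; exact: (mL measurableT (emeasurable_set1 +oo%E)).
  move=> w /= nfin; apply: contrapT => Loo; apply: nfin.
  by rewrite fineK// ge0_fin_numE// ltey; apply/eqP.
have flat : {ae P, forall w t, A w t <= A w (fine (L w))}.
  apply: filterS no_mass_after => w h t.
  have [tl|lt] := leP t (fine (L w)); first exact: cumulative_is_nondecreasing.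
  rewrite -subr_le0 -lee_fin -stieltjes_measure_itv_oc ?(ltW lt)//.
  apply: (@le_trans _ _ (mu w `]fine (L w), +oo[%classic)); last by rewrite h.
  apply: le_measure; rewrite ?inE; [exact: measurable_itv|exact: measurable_itv|].
  by move=> s /=; rewrite !in_itv /= andbT => /andP[].
have atomless : {ae P, forall w t, 0 <= t -> mu w [set t] = 0%E}.
  apply: filterS left_cont => w h t t0; apply/eqP; rewrite -measure_le0.
  apply/lee_addgt0Pr => e e0; have [n hn] := h t e t0 e0.
  rewrite add0e; apply: (@le_trans _ _ (mu w `]t - n.+1%:R^-1, t]%classic)).
    apply: le_measure; rewrite ?inE; [exact: measurable_set1|exact: measurable_itv|].
    by move=> s /= ->; rewrite in_itv /= lexx andbT gtrBl invr_gt0.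
  rewrite stieltjes_measure_itv_oc ?lee_fin ?gerBl ?invr_ge0//.
  exact: ltW.
have fin := dual_projection_finite_mass hF mL L0 hAL.
have cR : {ae P, forall w, riemann_sum (A w) (f ^~ w) n @[n --> \oo] -->
    total_integral A f w}.
  apply: filterS2 atomless fin => w atl mfin.
  suff : (riemann_sum (A w) (f ^~ w) n)%:E @[n --> \oo] -->
      (total_integral A f w)%:E by move/fine_cvg.
  rewrite /total_integral /Rintegral fineK.
    apply: cvg_riemann_sum => //.
    - exact: (optional_path_measurable hF).
    - by move=> s s0; have /andP[? ?] := f_bounds s w; rewrite ger0_norm.
    - exact: f_rc.
  have mI : measurable (`[0%R, +oo[%classic : set (measurableTypeR R)).
    exact: measurable_itv.
  apply: integrable_fin_num => //.
  have i1 : (mu w).-integrable `[0%R, +oo[%classic (EFin \o cst (1 : R)).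
    apply/integrableP; split; first by apply/measurable_EFinP; exact: measurable_cst.
    by under eq_integral do rewrite /= normr1; rewrite integral_cst// mul1e.
  apply: (le_integrable mI _ _ i1).
    by apply/measurable_EFinP; exact: (optional_path_measurable hF).
  move=> s _; rewrite /= lee_fin normr1.
  by have /andP[? ?] := f_bounds s w; rewrite ger0_norm.
have cS : {ae P, forall w, S_ n w @[n --> \oo] --> (0 : R)}.
  apply: filterS3 aeL flat left_cont => w Lw fl lc.
  apply/cvgrPdist_lt => e e0; rewrite /=.
  have [n hn] := lc (fine (L w)) e (fine_ge0 (L0 w)) e0.
  exists n => // m /= nm; rewrite sub0r normrN.
  apply: le_lt_trans (S_le m Lw fl) _; apply: le_lt_trans hn.
  rewrite lerB//; apply: cumulative_is_nondecreasing.
  by rewrite lerB// lef_pV2 ?posrE// ler_nat ltnS.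
have ifL : P.-integrable setT (EFin \o at_time f L).
  have i1 : P.-integrable setT (EFin \o cst (1 : R)).
    exact: finite_measure_integrable_cst.
  apply: (le_integrable measurableT _ _ i1).
    by apply/measurable_EFinP; exact: (measurable_at_time hF).
  move=> w _; rewrite /= lee_fin normr1 /at_time.
  by have /andP[? ?] := f_bounds (fine (L w)) w; rewrite ger0_norm.
have [_ itf Ef] := dual_projection_integrable hF mL L0 hAL f_optional ifL.
have c1 : (\int[P]_w (riemann_sum (A w) (f ^~ w) n)%:E @[n --> \oo] -->
    \int[P]_w (total_integral A f w)%:E)%E.
  apply: (@cvg_integral_dominated _ _ _ P _ _ _ (cst 1)) => //.
  - move=> n; under eq_fun do rewrite riemannE.
    apply: measurable_sum => k; apply: measurable_funM => //.
    exact: (measurable_wrt_fun hF (grid_ge0 n k.+1)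
      (past_part_adapted hF hU mL L0 hAL ox hM hN _)).
  - by apply/measurable_EFinP; case/integrableP : itf.
  - by apply: filterS cR => w h _.
  - exact: finite_measure_integrable_cst.
  - by apply: aeW => w n _; exact: riemann_le1.
have c2 : (\int[P]_w (at_time x L w * S_ n w)%:E @[n --> \oo] -->
    \int[P]_w (at_time x L w * 0)%:E)%E.
  apply: (@cvg_integral_dominated _ _ _ P _ _ _ (fun w => `|at_time x L w|)) => //.
  - by move=> n; exact: measurable_funM.
  - exact: measurable_funM.
  - by apply: filterS cS => w h _; apply: cvgM => //; exact: cvg_cst.
  - exact: integrable_norm.
  - by apply: aeW => w n _; rewrite normrM ler_piMr.
have fL0 : (\int[P]_w (at_time f L w)%:E = 0)%E.
  rewrite -Ef -(cvg_lim _ c1)//; under eq_fun do rewrite integral_riemann.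
  rewrite (cvg_lim _ c2)//; under eq_integral do rewrite mulr0.
  exact: integral0.
have : ae_eq P setT (EFin \o at_time f L) (cst 0%E).
  apply/ae_eq_integral_abs => //; first by case/integrableP : ifL.
  rewrite -[RHS]fL0; apply: eq_integral => w _; rewrite gee0_abs// lee_fin.
  by rewrite /at_time; have /andP[] := f_bounds (fine (L w)) w.
apply: filterS => w /(_ Logic.I) /= [] /eqP.
rewrite /at_time /f mulf_eq0 => /orP[/eqP|]; last by rewrite gt_eqF// expR_gt0.
exact: mul_damp_eq0.
Qed.

End past_part_at_end.

(** * A maximal inequality and upward convergence *)

Section levy.
Context {d : measure_display} {Omega : measurableType d} {R : realType}.
Variable P : probability Omega R.

(** Multiply by the sign of [Y], which is known. *)
Lemma cond_exp_norm_le (G : set (set Omega)) (Z Y : Omega -> R) (B : set Omega) :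
  sigma_algebra setT G -> G `<=` measurable -> cond_exp P G Z Y -> G B ->
  (\int[P]_(w in B) (`|Y w|)%:E <= \int[P]_(w in B) (`|Z w|)%:E)%E.
Proof.
move=> sG mG hY GB; have [iZ mY iY _] := hY.
have mB := mG _ GB.
pose xi w : R := \1_B w * (2 * \1_[set w | 0 <= Y w] w - 1).
have xiE w : xi w = \1_B w * (if 0 <= Y w then 1 else -1).
  rewrite /xi [X in 2 * X]indicE; case: ifPn => Y0.
    by rewrite mem_set// mulr1; congr (_ * _); ring.
  by rewrite memNset ?mulr0 ?sub0r//; exact/negP.
have b01 w : 0 <= (\1_B w : R) <= 1.
  by rewrite indicE; case: (_ \in _); rewrite ?lexx ?ler01.
have bxi w : `|xi w| <= 1.
  rewrite xiE normrM ger0_norm; last by case/andP: (b01 w).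
  rewrite (_ : `|if _ then _ else _| = 1); last by case: ifP; rewrite ?normrN normr1.
  by rewrite mulr1; case/andP: (b01 w).
have mxi : measurable_wrt G xi.
  have mI (C : set Omega) : G C ->
      measurable_fun [set: g_sigma_algebraType G] (\1_C : _ -> R).
    by move=> GC; apply: measurable_indic; rewrite -(sigma_measurableE sG).
  apply: measurable_funM; first exact: mI.
  apply: measurable_funB => //; apply: measurable_funM => //; apply: mI.
  rewrite (sigma_measurableE sG).
  have := mY measurableT _ (measurable_itv `[0, +oo[); rewrite setTI.
  by congr measurable; apply/seteqP; split => w /=; rewrite in_itv /= andbT.
have mxi' := measurable_wrt_sub sG mG mxi.
have indE (f : Omega -> R) :
    (\int[P]_(w in B) (f w)%:E = \int[P]_w (\1_B w * f w)%:E)%E.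
  rewrite integral_mkcond; apply: eq_integral => w _.
  by rewrite patchE indicE; case: ifPn; rewrite ?mul1r ?mul0r.
rewrite !indE.
rewrite (_ : (\int[P]_w (\1_B w * `|Y w|)%:E = \int[P]_w (xi w * Y w)%:E)%E); last first.
  apply: eq_integral => w _; rewrite xiE -mulrA; congr (_ * _)%:E.
  case: ifPn => Y0; first by rewrite mul1r ger0_norm.
  by rewrite mulN1r ltr0_norm// ltNge.
rewrite (cond_exp_mul_bounded sG mG hY mxi bxi).
have mZ : measurable_fun setT Z by apply/measurable_EFinP; case/integrableP : iZ.
apply: le_integral => //.
- exact: integrable_bounded_mul bxi iZ.
- apply: (@integrable_bounded_mul _ _ _ P _ (fun w => `|Z w|) 1) => //.
    by move=> w; rewrite ger0_norm; case/andP: (b01 w).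
  exact: integrable_norm.
- move=> w _; rewrite lee_fin xiE -mulrA ler_wpM2l//.
  by case: ifP => _; [rewrite mul1r ler_norm|rewrite mulN1r -[leRHS]normrN ler_norm].
Qed.

(** Decompose the event according to the first index at which the level is
    exceeded, and use that this event is known at that index. *)
Lemma doob_maximal_seq (G : nat -> set (set Omega)) (Z : Omega -> R)
    (D : nat -> Omega -> R) (l : R) :
  (forall k, sigma_algebra setT (G k)) -> (forall k, G k `<=` measurable) ->
  (forall j k, (j <= k)%N -> G j `<=` G k) ->
  (forall k, cond_exp P (G k) Z (D k)) -> 0 <= l ->
  (l%:E * P (\bigcup_k [set w | (l < `|D k w|)%R]) <= \int[P]_w (`|Z w|)%:E)%E.
Proof.
move=> sG mG ndG hD l0.
pose U k := [set w | (l < `|D k w|)%R].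
have GU k : G k (U k).
  rewrite (sigma_measurableE (sG k)); have [_ mD _ _] := hD k.
  have mDn : measurable_fun [set: g_sigma_algebraType (G k)]
      (fun w : g_sigma_algebraType (G k) => `|D k w|).
    exact: (measurableT_comp (@normr_measurable R setT) mD).
  have := mDn measurableT _ (measurable_itv `]l, +oo[); rewrite setTI.
  by congr measurable; apply/seteqP; split => w /=; rewrite in_itv /= andbT.
pose E k := seqDU U k.
have GE k : G k (E k).
  rewrite (sigma_measurableE (sG k)); apply: measurableD.
    by rewrite -(sigma_measurableE (sG k)).
  rewrite -bigcup_mkord; apply: bigcup_measurable => j /= jk.
  by rewrite -(sigma_measurableE (sG k)); exact: (ndG _ _ (ltnW jk)).
have mE k : measurable (E k) by exact: (mG k).
have tE : trivIset setT E by exact: trivIset_seqDU.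
have mZ : measurable_fun setT Z.
  by apply/measurable_EFinP; have [/integrableP[]] := hD 0%N.
have mZn : measurable_fun setT (fun w => (`|Z w|)%:E).
  apply/measurable_EFinP.
  exact: (measurableT_comp (@normr_measurable R setT) mZ).
rewrite seqDU_bigcup_eq measure_bigcup//.
rewrite -nneseriesZl// (eq_eseriesl _ (Q := xpredT)); last by move=> k; rewrite in_setT.
apply: (@le_trans _ _ (\int[P]_(w in \bigcup_k E k) (`|Z w|)%:E)%E); last first.
  by apply: ge0_subset_integral => //; exact: bigcupT_measurable.
rewrite ge0_integral_bigcup//; last exact: measurable_funTS.
apply: lee_nneseries => k _.
  by rewrite mule_ge0 ?lee_fin.
apply: le_trans (cond_exp_norm_le (sG k) (mG k) (hD k) (GE k)).
rewrite -integral_cst//; apply: ge0_le_integral => //.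
  have [_ mD _ _] := hD k.
  apply/measurable_EFinP/measurable_funTS.
  apply: (measurableT_comp (@normr_measurable R setT)).
  exact: (measurable_wrt_sub (sG k) (mG k)).
by move=> w [/ltW Uw _]; rewrite lee_fin.
Qed.

Variable F : R -> set (set Omega).
Hypothesis hF : filtration F.

(** Each grid of times [m + k / (n + 1)] is covered by the discrete inequality.
    By right-continuity a crossing of the level is seen on all fine enough
    grids, hence the lower limit of the events of the grids. *)
Lemma doob_maximal (Z : Omega -> R) (D : R -> Omega -> R) (m l : R) :
  0 <= m -> 0 <= l -> (forall w, cadlag (D ^~ w)) ->
  (forall t, m <= t -> cond_exp P (F t) Z (D t)) ->
  exists V, [/\ measurable V, [set w | exists2 t, m <= t & l < `|D t w|] `<=` V &
    (l%:E * P V <= \int[P]_w (`|Z w|)%:E)%E].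
Proof.
move=> m0 l0 cD hD.
pose tm (n k : nat) : R := m + k%:R / n.+1%:R.
have mtm n k : m <= tm n k by rewrite lerDl divr_ge0.
have tm0 n k : 0 <= tm n k by exact: le_trans (mtm n k).
pose U n := \bigcup_k [set w | l < `|D (tm n k) w|].
have mU n : measurable (U n).
  apply: bigcupT_measurable => k.
  have [_ mD _ _] := hD _ (mtm n k).
  have mDn : measurable_fun setT (fun w => `|D (tm n k) w|).
    apply: (measurableT_comp (@normr_measurable R setT)).
    exact: (measurable_wrt_fun hF (tm0 n k)).
  have := mDn measurableT _ (measurable_itv `]l, +oo[); rewrite setTI.
  by congr measurable; apply/seteqP; split => w /=; rewrite in_itv /= andbT.
have PU n : (l%:E * P (U n) <= \int[P]_w (`|Z w|)%:E)%E.
  apply: (@doob_maximal_seq (fun k => F (tm n k))) => //.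
  - by move=> k; exact: (filtration_sigma hF).
  - by move=> k; exact: (filtration_sub hF).
  - move=> j k jk; apply: (filtration_mono hF (tm0 n j)).
    by rewrite lerD2l ler_pM2r ?invr_gt0// ler_nat.
  - by move=> k; exact: hD.
pose VN N := \bigcap_n U (N + n)%N.
have mVN N : measurable (VN N) by exact: bigcapT_measurable.
exists (\bigcup_N VN N); split; first exact: bigcupT_measurable.
  move=> w [t mt lD].
  have tm_ge0 : 0 <= t - m by rewrite subr_ge0.
  have cvgD : D (m + grid_up n (t - m)) w @[n --> \oo] --> D t w.
    apply: (@cvg_at_right_seq _ (D ^~ w)).
    - by have [+ _] := cD w; apply; exact: le_trans mt.
    - by move=> n; have /andP[+ _] := grid_up_bounds n tm_ge0; rewrite lerBlDl.
    - apply: cvg_of_natSinv_bound => n; have /andP[h1 h2] := grid_up_bounds n tm_ge0.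
      by rewrite distrC ger0_norm; move: h1 h2; set g := grid_up _ _; set v := _^-1; lra.
  have [N _ hN] : \forall n \near \oo, l < `|D (m + grid_up n (t - m)) w|.
    by apply: (cvgr_gt `|D t w|) => //; exact: cvg_norm.
  exists N => // n _; exists (Num.truncn ((N + n).+1%:R * (t - m))).+1 => //=.
  by apply: (hN (N + n)%N); rewrite /= leq_addr.
have cV : (P (VN N) @[N --> \oo] --> P (\bigcup_N VN N))%E.
  apply: nondecreasing_cvg_mu => //; first exact: bigcupT_measurable.
  move=> i j ij; apply/subsetPset => w hw n _.
  by have := hw (j - i + n)%N Logic.I; rewrite addnA subnKC.
have cV' : (l%:E * P (VN N) @[N --> \oo] --> l%:E * P (\bigcup_N VN N))%E.
  by apply: cvgeZl => //.
rewrite -(cvg_lim _ cV')//; apply: lime_le; first by apply/cvg_ex; eexists; exact: cV'.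
apply: nearW => N; apply: le_trans (PU N).
rewrite lee_wpmul2l ?lee_fin//; apply: le_measure; rewrite ?inE//.
by move=> w /(_ 0%N Logic.I); rewrite addn0.
Qed.

(** Levy's upward theorem.  If [Z] is known at time [m], then [M - Z] is from [m]
    on the conditional expectation of [X - Z], so the maximal inequality bounds
    the oscillation of [M] around [Z] after [m], and Markov's inequality the
    distance from [Z] to [X], both by the L1-distance of [X] and [Z]. *)
Lemma levy_upward (X : Omega -> R) (M : R -> Omega -> R) :
  cadlag_cond_exp P F X M ->
  (forall e, 0 < e -> exists m Z, [/\ 0 <= m, measurable_wrt (F m) Z,
     P.-integrable setT (EFin \o Z) &
     (\int[P]_w (`|X w - Z w|)%:E <= e%:E)%E]) ->
  {ae P, forall w, M t w @[t --> +oo] --> X w}.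
Proof.
move=> [cM hM] approx.
have [iX _ _ _] := hM 0 (lexx 0).
have mX : measurable_fun setT X by apply/measurable_EFinP; case/integrableP : iX.
pose bad l := [set w | forall m, exists2 t, m <= t & l + l < `|M t w - X w|].
have step l e : 0 < l -> 0 < e -> exists V, [/\ measurable V, bad l `<=` V &
    (l%:E * P V <= (e + e)%:E)%E].
  move=> l0 /approx[m [Z [m0 mZ iZ XZ]]].
  have mZ' := measurable_wrt_fun hF m0 mZ.
  pose D t w := M t w - Z w.
  have cD w : cadlag (D ^~ w).
    apply: cadlagD => //; rewrite (_ : (fun _ => _) = fun s => - ((0 <= s)%R%:R * 0 + Z w)).
      apply: cadlagN; apply: cadlagD; first exact: cadlag_step.
      by split => t t0; [exact: cvg_cst|exists (Z w); exact: cvg_cst].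
    by apply/funext => s; rewrite mulr0 add0r.
  have hD t : m <= t -> cond_exp P (F t) (fun w => X w - Z w) (D t).
    move=> mt; have t0 := le_trans m0 mt; have [_ mM iM EM] := hM t t0.
    have iXZ : P.-integrable setT (EFin \o (fun w => X w - Z w)).
      rewrite (_ : _ \o _ = (EFin \o X) \- (EFin \o Z))%E//.
      exact: integrableB.
    have iD : P.-integrable setT (EFin \o D t).
      rewrite (_ : _ \o _ = (EFin \o M t) \- (EFin \o Z))%E//.
      exact: integrableB.
    split => //.
      apply: measurable_funB => //; exact: (measurable_wrt_mono hF m0 mt).
    move=> B sB.
    have mB : measurable B.
      by apply: (filtration_sub hF t0); rewrite -(sigma_algebra_id (filtration_sigma hF t0)).
    have iS f : P.-integrable setT (EFin \o f) -> P.-integrable B (EFin \o f).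
      exact: integrableS.
    rewrite /D; under eq_integral do rewrite EFinB.
    under [in RHS]eq_integral do rewrite EFinB.
    by rewrite !integralB//; [rewrite EM|exact: iS..].
  have [V [mV DV PV]] := doob_maximal m0 (ltW l0) cD hD.
  pose W := [set w | l < `|X w - Z w|].
  have mXZ : measurable_fun setT (fun w => `|X w - Z w|).
    apply: (measurableT_comp (@normr_measurable R setT)).
    exact: measurable_funB.
  have mW : measurable W.
    have := mXZ measurableT _ (measurable_itv `]l, +oo[); rewrite setTI.
    by congr measurable; apply/seteqP; split => w /=; rewrite in_itv /= andbT.
  exists (V `|` W); split; first exact: measurableU.
    move=> w /(_ m)[t mt lMX]; have [Ww|nW] := pselect (W w); first by right.
    left; apply: DV; exists t => //; rewrite /D.
    have lXZ : `|X w - Z w| <= l by rewrite leNgt; exact/negP.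
    have := ler_normB (M t w - Z w) (X w - Z w).
    by rewrite opprB addrA subrK => h; move: lMX lXZ h; lra.
  apply: (@le_trans _ _ (l%:E * (P V + P W))%E).
    by rewrite lee_wpmul2l ?lee_fin ?(ltW l0)//; exact: measureU2.
  rewrite muleDr// ?ge0_adde_def ?inE//; rewrite EFinD; apply: leeD.
    exact: le_trans PV XZ.
  apply: le_trans XZ.
  apply: (@le_trans _ _ (\int[P]_(w in W) (`|X w - Z w|)%:E)%E).
    rewrite -integral_cst//; apply: ge0_le_integral => //.
    - by move=> w _; rewrite lee_fin ltW.
    - by apply/measurable_EFinP; exact: measurable_funTS.
    by move=> w /ltW; rewrite lee_fin.
  by apply: ge0_subset_integral => //; apply/measurable_EFinP.
have bad0 l : 0 < l -> P.-negligible (bad l).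
  move=> l0.
  have /choice[V hV] : forall n : nat, exists V, [/\ measurable V, bad l `<=` V &
      (l%:E * P V <= (n.+1%:R^-1 + n.+1%:R^-1)%:E)%E].
    by move=> n; apply: step => //; rewrite invr_gt0.
  exists (\bigcap_n V n); split.
  - by apply: bigcapT_measurable => n; case: (hV n).
  - have mI : measurable (\bigcap_n V n).
      by apply: bigcapT_measurable => n; case: (hV n).
    apply/eqP; rewrite -measure_le0.
    suff : (l%:E * P (\bigcap_n V n) <= 0)%E by rewrite pmule_rle0// lte_fin.
    apply/lee_addgt0Pr => e e0; rewrite add0e.
    have [n hn] : exists n : nat, n.+1%:R^-1 < e / 2 by apply: natSinv_lt; rewrite divr_gt0.
    have [mV _ PV] := hV n.
    apply: (@le_trans _ _ (l%:E * P (V n))%E).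
      rewrite lee_wpmul2l ?lee_fin ?(ltW l0)//; apply: le_measure; rewrite ?inE//.
      exact: bigcap_inf.
    apply: (le_trans PV); rewrite lee_fin [leRHS]splitr.
    by apply: lerD; exact: ltW.
  - by move=> w bw n _; have [_ /(_ _ bw)] := hV n.
have : {ae P, forall w (n : nat), ~ bad n.+1%:R^-1 w}.
  apply: ae_foralln => n; have n0 : (0 : R) < n.+1%:R^-1 by rewrite invr_gt0.
  by apply: negligibleS (bad0 _ n0) => w /= /contrapT.
apply: filterS => w hw; apply/cvgrPdist_le => e e0.
have [n hn] : exists n : nat, n.+1%:R^-1 < e / 2 by apply: natSinv_lt; rewrite divr_gt0.
have /existsNP[m hm] := hw n.
exists m; split; first exact: num_real.
move=> t mt; rewrite distrC leNgt; apply/negP => lt; apply: hm.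
exists t; first exact: ltW.
by apply: lt_trans lt; rewrite [ltRHS]splitr ltrD.
Qed.

End levy.

(** * The terminal value and the equivalence *)

Definition truncate {R : realType} (k y : R) : R := if `|y| <= k then y else 0.

Lemma measurable_truncate {R : realType} (k : R) :
  measurable_fun setT (truncate k).
Proof.
apply: measurable_fun_ifT => //.
by apply: measurable_fun_ler => //; exact: measurable_normr.
Qed.

Lemma norm_truncate {R : realType} (k y : R) : 0 <= k -> `|truncate k y| <= k.
Proof. by rewrite /truncate; case: ifP; rewrite ?normr0. Qed.

Lemma norm_truncate_sub {R : realType} (k y : R) : `|y - truncate k y| <= `|y|.
Proof. by rewrite /truncate; case: ifP; rewrite ?subrr ?normr0 ?subr0. Qed.

Lemma integral_upto_eq_total {d} {Omega : measurableType d} {R : realType}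
    (A : Omega -> cumulative R R) (x : R -> Omega -> R) (t : R) (w : Omega) :
  0 <= t ->
  (lebesgue_stieltjes_measure (A w)).-integrable `[0%R, +oo[%classic
    (EFin \o x^~ w) ->
  lebesgue_stieltjes_measure (A w) `]t, +oo[%classic = 0%E ->
  integral_upto A x t w = total_integral A x w.
Proof.
move=> t0 gw nw.
have mI (i : interval R) : measurable ([set` i] : set (measurableTypeR R)).
  exact: measurable_itv.
have tE : `[0%R, +oo[%classic = `[0%R, t]%classic `|` `]t, +oo[%classic :> set R.
  by rewrite -itv_bndbnd_setU// bnd_simp.
rewrite /total_integral tE Rintegral_setU//.
- rewrite -[LHS]addr0; congr (_ + _); rewrite /Rintegral null_set_integral//.
  have /integrableP[mx _] := gw; apply: measurable_funS mx => //.
  by move=> s /=; rewrite !in_itv /= !andbT => ts; exact: le_trans (ltW ts).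
- by rewrite -tE.
- apply/disj_setPLR => s /=; rewrite !in_itv /= andbT => /andP[_ st].
  by rewrite leNgt in st; exact/negP.
Qed.

Section terminal_value.
Context {d : measure_display} {Omega : measurableType d} {R : realType}.
Variables (P : probability Omega R) (F : R -> set (set Omega)).
Hypotheses (hF : filtration F) (hU : usual_hypotheses P F).
Variables (L : Omega -> \bar R) (Gamma : set (R * Omega)).
Hypothesis mL : measurable_fun setT L.
Hypothesis oGamma : optional_sets F Gamma.
Hypothesis LE : forall w,
  L w = ereal_sup (0%E |` [set t%:E | t in [set t | Gamma (t, w)]]).
Hypothesis hLoo : P [set w | L w = +oo%E] = 0%E.

Let L0 := end_ge0 LE.

Lemma ae_end_lty : {ae P, forall w, (L w < +oo)%E}.
Proof.
exists [set w | L w = +oo%E]; split => //.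
  by rewrite -[X in measurable X]setTI; exact: (mL measurableT (emeasurable_set1 +oo%E)).
by move=> w /= /negP; rewrite ltey negbK => /eqP.
Qed.

Lemma optional_measurable_at_time (X : R -> Omega -> R) : optional F X ->
  measurable_wrt (sigma_at_time F L) (at_time X L).
Proof.
move=> oX _ B mB; rewrite setTI; apply: sub_sigma_algebra.
by apply: sub_sigma_algebra; exists X, B.
Qed.

Lemma sigma_at_time_sub : sigma_at_time F L `<=` (measurable : set (set Omega)).
Proof.
apply: smallest_sub; first exact: sigma_algebra_measurable.
move=> _ [z [B [oz mB ->]]].
by rewrite -[X in measurable X]setTI; exact: (measurable_at_time hF).
Qed.

(** Once a finite time exceeds [L], the last visit before that time is [L];
    truncated values of [x] there are therefore known at finite times and
    approximate [x_L]. *)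
Lemma at_time_approx (x : R -> Omega -> R) : optional F x ->
  P.-integrable setT (EFin \o at_time x L) ->
  forall e, 0 < e -> exists m Z, [/\ 0 <= m, measurable_wrt (F m) Z,
     P.-integrable setT (EFin \o Z) &
     (\int[P]_w (`|at_time x L w - Z w|)%:E <= e%:E)%E].
Proof.
move=> ox iX e e0; set X := at_time x L.
have mX : measurable_fun setT X by apply/measurable_EFinP; case/integrableP : iX.
have iXn : P.-integrable setT (EFin \o (fun w => `|X w|)) by exact: integrable_norm.
have mnorm (f : Omega -> R) : measurable_fun setT f ->
    measurable_fun setT (fun w => `|f w|).
  by move=> mf; exact: (measurableT_comp (@normr_measurable R setT) mf).
have mtX k : measurable_fun setT (fun w => truncate k%:R (X w)).
  by apply: (measurableT_comp _ mX); exact: measurable_truncate.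
have c1 : (\int[P]_w (`|X w - truncate k%:R (X w)|)%:E @[k --> \oo] -->
    \int[P]_w ((0 : R)%:E))%E.
  apply: (@cvg_integral_dominated _ _ _ P _ _ (cst 0) (fun w => `|X w|)) => //.
  - by move=> k; apply: mnorm; exact: measurable_funB.
  - apply: aeW => w _; apply: cvg_near_cst.
    exists (Num.truncn `|X w|).+1 => // k /= hk.
    rewrite /truncate ifT ?subrr ?normr0//.
    by apply: ltW; apply: lt_le_trans (truncnS_gt _) _; rewrite ler_nat.
  - by apply: aeW => w k _; rewrite normr_id norm_truncate_sub.
have [k _ hk] : \forall k \near \oo,
    (\int[P]_w (`|X w - truncate k%:R (X w)|)%:E < e%:E)%E.
  apply: (c1 [set y | (y < e%:E)%E]); apply: open_nbhs_nbhs.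
  by split; [exact: open_ereal_lt_ereal|rewrite /= integral0 lte_fin].
have {}hk := hk k (leqnn k).
pose Z m w := truncate k%:R (x (last_exit Gamma m%:R w) w).
have mZ m : measurable_wrt (F m%:R) (Z m).
  rewrite /Z /measurable_wrt; apply: (measurableT_comp (measurable_truncate k%:R)).
  apply: (optional_at_bounded_time hF (t := m%:R)) => //.
  - exact: (last_exit_adapted hF hU oGamma).
  - by move=> w; rewrite last_exit_ge0 last_exit_le.
have mZ' m : measurable_fun setT (Z m) by exact: (measurable_wrt_fun hF (ler0n _ m)).
have c2 : (\int[P]_w (`|X w - Z m w|)%:E @[m --> \oo] -->
    \int[P]_w (`|X w - truncate k%:R (X w)|)%:E)%E.
  apply: (@cvg_integral_dominated _ _ _ P _ _ _ (fun w => `|X w| + k%:R)) => //.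
  - by move=> m; apply: mnorm; exact: measurable_funB.
  - by apply: mnorm; exact: measurable_funB.
  - apply: filterS ae_end_lty => w Lw _; apply: cvg_near_cst.
    have Lfin : L w = (fine (L w))%:E by rewrite fineK// ge0_fin_numE.
    exists (Num.truncn (fine (L w))).+1 => // m /= hm.
    have Lm : (L w < m%:R%:E)%E.
      by rewrite Lfin lte_fin (lt_le_trans (truncnS_gt _))// ler_nat.
    by rewrite /Z /X /at_time (end_eq_last_exit LE Lm).
  - rewrite (_ : _ \o _ = (EFin \o (fun w => `|X w|%R)) \+ cst (k%:R)%:E)%E//.
    by apply: integrableD => //; exact: finite_measure_integrable_cst.
  - apply: aeW => w m _; rewrite normr_id (le_trans (ler_normB _ _))// lerD2l.
    exact: norm_truncate.
have [m _ hm] : \forall m \near \oo, (\int[P]_w (`|X w - Z m w|)%:E < e%:E)%E.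
  apply: (c2 [set y | (y < e%:E)%E]); apply: open_nbhs_nbhs.
  by split; [exact: open_ereal_lt_ereal|].
exists m%:R, (Z m); split => //; last by apply: ltW; exact: (hm m (leqnn m)).
have i1 : P.-integrable setT (EFin \o cst (k%:R : R)).
  exact: finite_measure_integrable_cst.
apply: (le_integrable measurableT _ _ i1); first exact/measurable_EFinP.
by move=> w _; rewrite /= lee_fin (ger0_norm (ler0n R k)) norm_truncate.
Qed.

Lemma terminal_value_at_time (x M : R -> Omega -> R) : optional F x ->
  cadlag_cond_exp P F (at_time x L) M ->
  {ae P, forall w, terminal_value M w = at_time x L w}.
Proof.
move=> ox hM; have iX : P.-integrable setT (EFin \o at_time x L).
  by have [_ /(_ 0 (lexx _))[]] := hM.
apply: filterS (levy_upward hF hM (at_time_approx ox iX)) => w h.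
exact: cvg_lim.
Qed.

(** Completeness: the subsets of null sets are measurable. *)
Lemma ae_measurable (f g : Omega -> R) : measurable_fun setT f ->
  {ae P, forall w, g w = f w} -> measurable_fun setT g.
Proof.
move=> mf [N [mN N0 hN]] _ B mB; rewrite setTI.
have mneg E : E `<=` N -> measurable E.
  by move=> EN; apply: (negligible_measurable hF hU); exists N; split.
rewrite (_ : g @^-1` B = (f @^-1` B `\` N) `|` (g @^-1` B `&` N)).
  apply: measurableU; last by apply: mneg => w [].
  by apply: measurableD => //; rewrite -[X in measurable X]setTI; exact: mf.
have gf w : ~ N w -> g w = f w.
  by move=> nN; apply: contrapT => h; apply: nN; exact: hN.
apply/seteqP; split => w /=.
  by have [Nw|nN] := pselect (N w); [right|rewrite (gf _ nN); left].
by move=> [[Bf nN]|[]//]; rewrite (gf _ nN).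
Qed.

(** Integrate [Y - X] against [damp (Y - X)], which is bounded and known, so
    that the nonnegative product has integral 0. *)
Lemma cond_exp_known (G : set (set Omega)) (X Y : Omega -> R) :
  sigma_algebra setT G -> G `<=` measurable -> measurable_wrt G X ->
  cond_exp P G X Y -> {ae P, forall w, Y w = X w}.
Proof.
move=> sG mG mX hY; have [iX mY iY _] := hY.
pose xi w := damp (Y w - X w).
have mxi : measurable_wrt G xi.
  apply: (measurableT_comp (continuous_measurable_fun (@damp_continuous R))).
  exact: measurable_funB.
have mX' := measurable_wrt_sub sG mG mX.
have mY' := measurable_wrt_sub sG mG mY.
have mxi' := measurable_wrt_sub sG mG mxi.
have bxi w : `|xi w| <= 1 by exact: norm_damp_le1.
have iXiY := integrable_bounded_mul mxi' bxi iY.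
have iXiX := integrable_bounded_mul mxi' bxi iX.
have : ae_eq P setT (fun w => ((Y w - X w) * xi w)%:E) (cst 0%E).
  apply/ae_eq_integral_abs => //.
    by apply/measurable_EFinP; apply: measurable_funM => //; exact: measurable_funB.
  transitivity (\int[P]_w (xi w * Y w)%:E - \int[P]_w (xi w * X w)%:E)%E.
    rewrite -integralB//; apply: eq_integral => w _.
    rewrite gee0_abs; last by rewrite lee_fin; case/andP: (mul_damp_bounds (Y w - X w)).
    by rewrite -EFinB mulrC mulrBr.
  rewrite (cond_exp_mul_bounded sG mG hY mxi bxi) subee//.
  exact: integrable_fin_num.
apply: filterS => w /(_ Logic.I) [] /mul_damp_eq0 /eqP.
by rewrite subr_eq0 => /eqP.
Qed.

End terminal_value.

Theorem proposition4p11 (d : measure_display) (Omega : measurableType d)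
    (R : realType) (P : probability Omega R) (F : R -> set (set Omega))
    (hF : filtration F) (hU : usual_hypotheses P F)
    (L : Omega -> \bar R) (hL : honest_time F L)
    (hL0 : P [set w | L w = 0%E] = 0%E)
    (hLoo : P [set w | L w = +oo%E] = 0%E)
    (hA : avoids_stopping_times P F L)
    (A : Omega -> cumulative R R) (hAL : dual_optional_projection P F L A)
    (x : R -> Omega -> R) (hx : predictable F x)
    (M : R -> Omega -> R) (hM : cadlag_cond_exp P F (at_time x L) M)
    (hMm : martingale P F M) (hMui : uniformly_integrable P M)
    (N : R -> Omega -> R) (hN : cadlag_cond_exp P F (total_integral A x) N) :
  [/\ {ae P, forall w,
         at_time M L w = at_time (future_integral A x N) L w},
      {ae P, forall w,
         at_time (future_integral A x N) L w
         = at_time N L w - total_integral A x w} &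
      cond_exp P (sigma_at_time F L) (terminal_value M) (at_time M L) <->
      {ae P, forall w,
         at_time (future_integral A x N) L w = at_time x L w}].
Proof.
have [mL [Gamma oG LE]] := hL.
have L0 := end_ge0 LE.
have ox := predictable_optional hF hx.
have nomass := mass_after_end hF hU oG LE mL hAL hLoo.
have left_cont := dual_projection_left_continuous hF hU
  (dual_projection_neg hAL) (dual_projection_adapted hAL) mL L0 hLoo hA hAL.
have past0 := past_part_at_end hF hU mL L0 hLoo hAL ox hM hN nomass left_cont.
have path := ae_path_integrable hF mL L0 hAL ox hM.
have ML : {ae P, forall w,
    at_time M L w = at_time (future_integral A x N) L w}.
  apply: filterS2 path past0 => w gw; rewrite /at_time past_partE// => /eqP.
  by rewrite subr_eq0 => /eqP.
split => //.
  apply: filterS2 path nomass => w gw nw; rewrite /at_time /future_integral.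
  by rewrite (integral_upto_eq_total _ gw nw)// fine_ge0.
have termx := terminal_value_at_time hF hU mL oG LE hLoo ox hM.
have oM : optional F M.
  by apply: adapted_cadlag_optional; [exact: cadlag_cond_exp_adapted hM|case: hM].
have sS : sigma_algebra setT (sigma_at_time F L) by exact: smallest_sigma_algebra.
have mS := sigma_at_time_sub hF mL LE.
have iX := at_time_integrable hM.
have mX := measurable_at_time hF ox mL L0.
have mM := measurable_at_time hF oM mL L0.
have mT := ae_measurable hF hU mX termx.
have iT := integrable_ae_eq mT termx iX.
have intE f g B : measurable_fun setT f -> measurable_fun setT g ->
    measurable B -> {ae P, forall w, f w = g w} ->
    (\int[P]_(w in B) (f w)%:E = \int[P]_(w in B) (g w)%:E)%E.
  move=> mf mg mB fg; apply: ae_eq_integral => //.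
  - by apply/measurable_EFinP; exact: measurable_funTS.
  - by apply/measurable_EFinP; exact: measurable_funTS.
  - by apply: filterS fg => w -> _.
have mB B : <<s sigma_at_time F L>> B -> measurable B.
  by rewrite sigma_algebra_id//; exact: mS.
split=> [[_ sM iM EM]|fx].
  have hMX : cond_exp P (sigma_at_time F L) (at_time x L) (at_time M L).
    split => // B sB; rewrite EM//; apply: intE termx => //; exact: mB.
  have := cond_exp_known sS mS (optional_measurable_at_time ox) hMX.
  by apply: filterS2 ML => w -> ->.
have Mx : {ae P, forall w, at_time M L w = at_time x L w}.
  by apply: filterS2 ML fx => w -> ->.
split => //.
- exact: optional_measurable_at_time.
- exact: integrable_ae_eq Mx iX.
- move=> B sB; rewrite (intE _ _ B mT mX (mB _ sB) termx).
  by apply: intE Mx => //; exact: mB.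
Qed.
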